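(* (i) If $D$ is a minimal set over a model $\mathfrak M$ of $T$ and either - $T$ is dictionaric and has no Vaughtian pairs, or - $T$ has no open-in-definable Vaughtian pairs, then $D$ is strongly minimal. (ii) If $D$ is a minimal set over $\mathfrak M$, where $\mathfrak M$ is an approximately $\aleph_0$-saturated model, then $D$ is strongly minimal.
   Context: Setting: continuous first-order logic for metric structures. $S_n(A)$ is the space of complete $n$-types over a parameter set $A$, a compact Hausdorff space under the logic topology, also equipped with the metric $d(p,q)=\inf\{d(\bar a,\bar b):\bar a\models p,\ \bar b\models q\}$ computed in a monster model. A formula over $A$ is a continuous function $S_n(A)\to\mathbb R$. For $Q\subseteq S_n(A)$, $Q^{<\varepsilon}=\{q:d(q,Q)<\varepsilon\}$. A closed set $D\subseteq S_n(A)$ is ($A$-)definable if for every $\varepsilon>0$ there is an open $U$ with $D\subseteq U\subseteq D^{<\varepsilon}$. An $A$-zeroset is a set of types of the form $\{\varphi=0\}$ for a formula $\varphi$ over $A$ (equivalently a closed $G_\delta$). For $X\subseteq S_n(A)$ and a model $\mathfrak M\supseteq A$, $X(\mathfrak M)$ is the set of tuples of $\mathfrak M$ whose type over $A$ lies in $X$. A zeroset or type $X$ over $A$ is algebraic if $X(\mathfrak M)$ is metrically compact for every model $\mathfrak M\supseteq A$. A non-algebraic definable set $D$ is minimal over the set $A$ if for each pair $F,G\subseteq D$ of disjoint $A$-zerosets, at most one of $F$ and $G$ is non-algebraic. A definable set is strongly minimal if it is minimal over every set of parameters (over which it is definable). $X$ is open-in-definable if it is a relatively open subset of a definable set. If $X\subseteq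 S_1(A)$ is a definable (resp. open-in-definable) set containing a non-algebraic type, with $A$ countable, and $\mathfrak M\succ\mathfrak N\supseteq A$ is a proper elementary pair of models with $X(\mathfrak M)=X(\mathfrak N)$, then $(\mathfrak M,\mathfrak N)$ is a Vaughtian pair (resp. open-in-definable Vaughtian pair). A theory $T$ is dictionaric if for every $n<\omega$ and parameter set $A$, $S_n(A)$ has a basis of definable neighborhoods: for every $p\in S_n(A)$ and closed $F\not\ni p$ there is a definable $D$ with $p\in\operatorname{int}D$ and $D\cap F=\varnothing$. $\mathfrak M$ is approximately $\aleph_0$-saturated if for every finite tuple $\bar a\in\mathfrak M$, every complete type $q(\bar x,\bar y)$ over $\varnothing$ in finitely many variables with $q(\bar x,\bar a)$ consistent, and every $\varepsilon>0$, there are $\bar b,\bar a'\in\mathfrak M$ with $\bar b\bar a'\models q$ and $d(\bar a,\bar a')<\varepsilon$. *)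

(* Defs.v *)
From mathcomp Require Import all_boot all_order all_algebra.
From mathcomp Require Import all_classical all_reals all_analysis.

Set Implicit Arguments.
Unset Strict Implicit.
Unset Printing Implicit Defensive.

Import Order.TTheory GRing.Theory Num.Theory.
Import numFieldNormedType.Exports.

Local Open Scope classical_set_scope.
Local Open Scope ring_scope.

(** * Continuous first-order logic for (bounded, single-sorted) metric
    structures. Tuples of length [n] are row vectors ['rV[M]_n]. *)

(* The moduli of uniform continuity and the bounds are part of the
   signature. *)
Record signature (R : realType) := Signature {
  funsym : Type;
  fun_arity : funsym -> nat;
  fun_mod : funsym -> R -> R;
  fun_mod_gt0 : forall f e, 0 < e -> 0 < fun_mod f e;
  relsym : Type;
  rel_arity : relsym -> nat;
  rel_mod : relsym -> R -> R;
  rel_mod_gt0 : forall P e, 0 < e -> 0 < rel_mod P e;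
  rel_bound : relsym -> R;
  diam_bound : R
}.

Definition tdist (R : realType) (M : metricType R) n (a b : 'rV[M]_n) : R :=
  \big[Num.max/0]_(i < n) mdist (a ord0 i) (b ord0 i).

Record structure (R : realType) (L : signature R) := Structure {
  carrier :> metricType R;
  fun_interp : forall f : funsym L, 'rV[carrier]_(fun_arity f) -> carrier;
  rel_interp : forall P : relsym L, 'rV[carrier]_(rel_arity P) -> R;
  carrier_nonempty : [set: carrier] !=set0;
  carrier_complete : forall F : set_system carrier,
    ProperFilter F -> cauchy F -> exists x : carrier, F --> x;
  mdist_bounded : forall x y : carrier, mdist x y <= diam_bound L;
  fun_unif_cont : forall (f : funsym L) (a b : 'rV[carrier]_(fun_arity f)) e,
    0 < e -> tdist a b < fun_mod f e ->
    mdist (fun_interp a) (fun_interp b) <= e;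
  rel_bounded : forall (P : relsym L) (a : 'rV[carrier]_(rel_arity P)),
    `|rel_interp a| <= rel_bound P;
  rel_unif_cont : forall (P : relsym L) (a b : 'rV[carrier]_(rel_arity P)) e,
    0 < e -> tdist a b < rel_mod P e ->
    `|rel_interp a - rel_interp b| <= e
}.

Inductive term (R : realType) (L : signature R) (n : nat) : Type :=
| Var of 'I_n
| App (f : funsym L) of ('I_(fun_arity f) -> term L n).

(* [formula L n]: real-valued formulas with free variables among ['I_n];
   every continuous function on a power of [R] is a connective. [Sup] and
   [Inf] bind the variable 0. *)
Inductive formula (R : realType) (L : signature R) : nat -> Type :=
| Dist n : term L n -> term L n -> formula L n
| Rel n (P : relsym L) : ('I_(rel_arity P) -> term L n) -> formula L n
| Conn n k (u : 'rV[R]_k -> R) :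
    continuous u -> ('I_k -> formula L n) -> formula L n
| Sup n : formula L n.+1 -> formula L n
| Inf n : formula L n.+1 -> formula L n.

Section Semantics.
Context {R : realType} {L : signature R}.
Implicit Types M N : structure L.

Fixpoint term_eval M n (t : term L n) (v : 'rV[M]_n) : M :=
  match t with
  | Var i => v ord0 i
  | App f ts => fun_interp (\row_i term_eval (ts i) v)
  end.

Definition extend M n (x : M) (v : 'rV[M]_n) : 'rV[M]_n.+1 :=
  row_mx (const_mx x : 'rV[M]_1) v.

Fixpoint formula_eval M n (phi : formula L n) : 'rV[M]_n -> R :=
  match phi in formula _ n return 'rV[M]_n -> R with
  | Dist _ t u => fun v => mdist (term_eval t v) (term_eval u v)
  | Rel _ P ts => fun v => rel_interp (\row_i term_eval (ts i) v)
  | Conn _ _ u _ phis => fun v => u (\row_i formula_eval (phis i) v)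
  | Sup _ psi => fun v => sup [set formula_eval psi (extend x v) | x in [set: M]]
  | Inf _ psi => fun v => inf [set formula_eval psi (extend x v) | x in [set: M]]
  end.

(* A theory is a set of sentences; [sigma] stands for the closed condition
   [sigma = 0]. *)
Definition theory := set (formula L 0).

Definition models M (T : theory) :=
  forall sigma, T sigma -> forall v : 'rV[M]_0, formula_eval sigma v = 0.

Definition elementary_embedding M N (f : M -> N) :=
  forall n (phi : formula L n) (a : 'rV[M]_n),
    formula_eval phi (map_mx f a) = formula_eval phi a.

(* [elementary_over g]: via [g], the structure [N] is a model containing the
   parameter set [A], i.e. a model of the theory of [M] with constants for
   [A]. *)
Definition elementary_over M (A : set M) N (g : A -> N) :=
  forall n (phi : formula L n) (a : 'rV[A]_n),
    formula_eval phi (map_mx g a) = formula_eval phi (map_mx val a).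

(* Syntactic formulas with parameters in [A]. *)
Record pformula M (A : set M) (n : nat) := PFormula {
  nparams : nat;
  pform : formula L (n + nparams);
  params : 'rV[A]_nparams
}.

Definition tp M (A : set M) N (g : A -> N) n (b : 'rV[N]_n) :
    pformula A n -> R :=
  fun phi => formula_eval (pform phi) (row_mx b (map_mx g (params phi))).

(* The space S_n(A). A complete type is the evaluation functional of a
   realization; the topology is that induced by pointwise convergence, i.e.
   the coarsest one making every pformula continuous. *)
Definition types M (A : set M) (n : nat) :=
  set_type [set p : prod_topology (fun _ : pformula A n => R) |
    exists (N : structure L) (g : A -> N) (b : 'rV[N]_n),
      elementary_over g /\ p = tp g b].

(* X(N) for a model [N] containing [A] via [g]. *)
Definition realizations M (A : set M) n (X : set (types A n)) N (g : A -> N) :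
    set 'rV[N]_n :=
  [set b | exists2 p, X p & val p = tp g b].

Definition type_dist M (A : set M) n (p q : types A n) : R :=
  inf [set r | exists (N : structure L) (g : A -> N) (a b : 'rV[N]_n),
    [/\ elementary_over g, val p = tp g a, val q = tp g b & r = tdist a b]].

Definition thickening M (A : set M) n (Q : set (types A n)) (e : R) :
    set (types A n) :=
  [set q | (ereal_inf [set (type_dist q p)%:E | p in Q] < e%:E)%E].

Definition definable M (A : set M) n (D : set (types A n)) :=
  closed D /\
  forall e : R, 0 < e ->
    exists U, [/\ open U, D `<=` U & U `<=` thickening D e].

Definition open_in_definable M (A : set M) n (X : set (types A n)) :=
  exists U D, [/\ open U, definable D & X = U `&` D].

Definition zeroset M (A : set M) n (F : set (types A n)) :=
  exists phi : types A n -> R, continuous phi /\ F = [set p | phi p = 0].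

Definition algebraic M (A : set M) n (X : set (types A n)) :=
  forall N (g : A -> N), elementary_over g -> compact (realizations X g).

Definition minimal M (A : set M) n (D : set (types A n)) :=
  [/\ definable D, ~ algebraic D &
    forall F G, zeroset F -> zeroset G -> F `<=` D -> G `<=` D ->
      F `&` G = set0 -> ~ (~ algebraic F /\ ~ algebraic G)].

(* [D] (over [A], seen inside [N] via [g]) and [E] (over a subset [B] of [N])
   are the same definable set: they agree in every elementary extension of
   [N], hence in the monster model. *)
Definition same_set M (A : set M) N (g : A -> N) (B : set N) n
    (D : set (types A n)) (E : set (types B n)) :=
  forall N' (h : N -> N'), elementary_embedding h ->
    realizations D (h \o g) = realizations E (h \o val).

(* The parameter sets [B] range over subsets of arbitrary models [N]
   containing [A]. *)
Definition strongly_minimal M (A : set M) n (D : set (types A n)) :=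
  definable D /\
  forall N (g : A -> N), elementary_over g ->
  forall (B : set N) (E : set (types B n)),
    definable E -> same_set g D E -> minimal E.

(* [M] is a proper elementary extension of [N] via [f], and
   [X(M) = X(N)]. *)
Definition vaughtian_for N M (f : N -> M) (A : set N) (X : set (types A 1)) :=
  [/\ countable A,
      exists2 p, X p & ~ algebraic [set p],
      elementary_embedding f,
      range f <> [set: M] &
      realizations X (f \o val) = [set map_mx f b | b in realizations X val]].

Definition has_vaughtian_pair (T : theory) :=
  exists N M (f : N -> M) (A : set N) (X : set (types A 1)),
    [/\ models N T, models M T, definable X & vaughtian_for f X].

Definition has_open_in_definable_vaughtian_pair (T : theory) :=
  exists N M (f : N -> M) (A : set N) (X : set (types A 1)),
    [/\ models N T, models M T, open_in_definable X & vaughtian_for f X].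

Definition dictionaric (T : theory) :=
  forall M, models M T -> forall n (A : set M) (p : types A n) F,
    closed F -> ~ F p ->
    exists D, [/\ definable D, interior D p & D `&` F = set0].

(* The consistency of q(x, a) is realizability in an elementary extension. *)
Definition approx_aleph0_saturated M :=
  forall n m (a : 'rV[M]_m) (q : types (set0 : set M) (n + m)) (e : R),
    0 < e ->
    (exists N (f : M -> N) (b : 'rV[N]_n), elementary_embedding f /\
       val q = tp (f \o val) (row_mx b (map_mx f a))) ->
    exists (b : 'rV[M]_n) (a' : 'rV[M]_m),
      val q = tp val (row_mx b a') /\ tdist a a' < e.

End Semantics.

Arguments theory {R} L.

(* Main.v *)
(* If [D] is minimal over [M] but not strongly minimal, some formula
   [Psi (x, b)], with [b] in an elementary extension, has arbitrarily many
   separated points of [D] both where it is small and where it is close to [1].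
   If [M] is approximately saturated, [b] can be pulled back to a single [c] in
   [M], which contradicts minimality.  In general one gets for every [k] some
   [c k] in [M] with at least [k] separated points on either side, and by
   minimality one side, always the same one along a subsequence, is algebraic.
   Algebraic sets over [M] do not grow in elementary extensions, so in the
   ultrapower of a proper pair [M < M1] the corresponding set over [(c k)_k] is
   non-algebraic and has the same points in both models.  As [D] consists of
   tuples, this is applied to the thickened projection
   [psi (z, c) = inf_x max (d (z, x_i), Psi (x, c), d (x, D))] to a suitable
   coordinate: minimality of [D] makes [D /\ {psi (x_i, c k) <= 1/2}] algebraic
   as soon as the thickening is smaller than the distance from [M] to some
   point of [D] outside [M]. *)
From HB Require Import structures.
Require Import Defs.
From mathcomp Require Import all_boot all_order all_algebra.
From mathcomp Require Import all_classical all_reals all_analysis.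
From mathcomp Require Import ring lra.

Set Implicit Arguments.
Unset Strict Implicit.
Unset Printing Implicit Defensive.

Import Order.TTheory GRing.Theory Num.Theory.
Import numFieldNormedType.Exports.

Local Open Scope classical_set_scope.
Local Open Scope ring_scope.

(** * Uniform bounds and moduli for formulas *)

(** Definability, algebraicity and minimality speak of all models, whereas the argument changes
    parameters and passes to ultraproducts. Everything is therefore reduced to solvability of strict
    inequalities between formulas in finitely many variables, which transfers between elementarily
    equivalent structures. A definable set becomes a sequence of formulas subject to a first-order
    scheme, and completeness moves approximate solutions into the set; as countably many formulas
    have countably many parameters, the set obtained is definable over a countable set even if [M]
    is uncountable. Non-algebraicity becomes the existence, for each [k], of [k] points separated in
    one coordinate. Each passage enlarges a bound, whence the thresholds [1/6 < 1/3 < 2/5 < 1/2]. No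
    monster model is used: every extension that is constructed is an ultraproduct. In the
    dictionaric case the obstacle is that the pair comes with an open subset of a definable set [Y],
    while an intersection of definable sets need not be definable: a definable neighbourhood cannot
    simply be cut with [Y], and a relative one is built as a limit. *)

Section FormulaBounds.
Context {R : realType} {L : signature R}.
Implicit Types M N : structure L.

Lemma tdist_ge0 (T : metricType R) n (a b : 'rV[T]_n) : 0 <= tdist a b.
Proof. by apply: bigmax_ge_id. Qed.

Lemma mdist_le_tdist (T : metricType R) n (a b : 'rV[T]_n) i :
  mdist (a ord0 i) (b ord0 i) <= tdist a b.
Proof. exact: (le_bigmax _ (fun i => mdist (a ord0 i) (b ord0 i))). Qed.

Lemma tdist_leP (T : metricType R) n (a b : 'rV[T]_n) e : 0 <= e ->
  (forall i, mdist (a ord0 i) (b ord0 i) <= e) -> tdist a b <= e.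
Proof. by move=> e0 h; apply: bigmax_le => // i _; apply: h. Qed.

Lemma tdist_ltP (T : metricType R) n (a b : 'rV[T]_n) e : 0 < e ->
  (forall i, mdist (a ord0 i) (b ord0 i) < e) -> tdist a b < e.
Proof. by move=> e0 h; apply: bigmax_lt => // i _; apply: h. Qed.

Lemma tdistC (T : metricType R) n (a b : 'rV[T]_n) : tdist a b = tdist b a.
Proof. by apply: eq_bigr => i _; rewrite metric_sym. Qed.

Lemma tdistxx (T : metricType R) n (a : 'rV[T]_n) : tdist a a = 0.
Proof.
by apply/eqP; rewrite eq_le tdist_ge0 andbT; apply: tdist_leP => // i; rewrite mdistxx.
Qed.

Lemma extendE N n (x : N) (v : 'rV[N]_n) (i : 'I_n.+1) :
  extend x v ord0 i = oapp (v ord0) x (unlift ord0 i).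
Proof.
rewrite /extend; case: unliftP => [j ->|->] /=.
  have -> : lift ord0 j = rshift 1 j by exact: val_inj.
  exact: row_mxEr.
have -> : ord0 = lshift n (ord0 : 'I_1) by exact: val_inj.
by apply: etrans (row_mxEl _ _ _ _) _; rewrite mxE.
Qed.

(** The bound depends on the formula alone, so the values along any family of structures have an
    ultralimit. A connective is an arbitrary continuous function; it is bounded on the compact box
    given by the bounds of its arguments. *)
Lemma formula_bounded n (phi : formula L n) :
  exists B : R, forall N (v : 'rV[N]_n), `|formula_eval phi v| <= B.
Proof.
elim: phi => {n} [n t u|n P ts|n k u cu phis IH|n psi [B IH]|n psi [B IH]].
- exists (diam_bound L) => N v /=.
  by rewrite ger0_norm ?mdist_ge0 ?mdist_bounded.
- by exists (rel_bound P) => N v /=; apply: rel_bounded.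
- have [B hB] := choice IH.
  have cpt : compact [set v : 'rV[R]_k | forall i, `[- B i, B i]%classic (v ord0 i)].
    by apply: (@rV_compact _ _ (fun i => `[- B i, B i]%classic)) => i; exact: segment_compact.
  have : bounded_set (u @` [set v : 'rV[R]_k | forall i, `[- B i, B i]%classic (v ord0 i)]).
    apply/compact_bounded; apply: continuous_compact cpt.
    by apply: continuous_subspaceT.
  move=> [C [_ hC]]; exists (C + 1) => N v /=.
  apply: hC; first by rewrite ltrDl.
  eexists; last by [].
  by move=> i /=; rewrite mxE in_itv/= -ler_norml.
- exists B => N v /=; set S := (X in sup X).
  have [x0 _] := carrier_nonempty N.
  have S0 : S (formula_eval psi (extend x0 v)) by exists x0.
  have hS : has_sup S.
    split; first by eexists; exact: S0.
    by exists B => _ [x _ <-]; rewrite (le_trans (ler_norm _)).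
  rewrite ler_norml; apply/andP; split.
    apply: le_trans (ub_le_sup hS.2 S0).
    by have := IH N (extend x0 v); rewrite ler_norml => /andP[].
  apply: ge_sup; first exact: hS.1.
  by move=> _ [x _ <-]; rewrite (le_trans (ler_norm _)).
- exists B => N v /=; set S := (X in inf X).
  have [x0 _] := carrier_nonempty N.
  have S0 : S (formula_eval psi (extend x0 v)) by exists x0.
  have hS : has_inf S.
    split; first by eexists; exact: S0.
    exists (- B) => _ [x _ <-]; have := IH N (extend x v).
    by rewrite ler_norml => /andP[].
  rewrite ler_norml; apply/andP; split.
    apply: lb_le_inf; first exact: hS.1.
    move=> _ [x _ <-]; have := IH N (extend x v).
    by rewrite ler_norml => /andP[].
  apply: le_trans (ge_inf hS.2 S0) _.
  by rewrite (le_trans (ler_norm _)).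
Qed.

Lemma formula_image_has_inf n (phi : formula L n.+1) N (v : 'rV[N]_n) :
  has_inf [set formula_eval phi (extend x v) | x in [set: N]].
Proof.
have [B hB] := formula_bounded phi; have [x0 _] := carrier_nonempty N.
split; first by exists (formula_eval phi (extend x0 v)), x0.
exists (- B) => _ [x _ <-]; have := hB N (extend x v).
by rewrite ler_norml => /andP[].
Qed.

Lemma formula_image_has_sup n (phi : formula L n.+1) N (v : 'rV[N]_n) :
  has_sup [set formula_eval phi (extend x v) | x in [set: N]].
Proof.
have [B hB] := formula_bounded phi; have [x0 _] := carrier_nonempty N.
split; first by exists (formula_eval phi (extend x0 v)), x0.
by exists B => _ [x _ <-]; rewrite (le_trans (ler_norm _)).
Qed.

Lemma term_unif_cont n (t : term L n) (e : R) : 0 < e ->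
  exists2 d : R, 0 < d & forall N (v w : 'rV[N]_n), tdist v w < d ->
    mdist (term_eval t v) (term_eval t w) <= e.
Proof.
elim: t e => [i|f ts IH] e e0.
  by exists e => // N v w h /=; apply: le_trans (ltW h); exact: mdist_le_tdist.
(* The induction hypothesis yields [<=] while the modulus of [f] asks for [<]; halving it bridges
   the gap. *)
have [m0 m2] : 0 < fun_mod f e / 2 /\ fun_mod f e / 2 < fun_mod f e.
  by have := fun_mod_gt0 f e0; split; lra.
have {}IH i : exists d : R, 0 < d /\ forall N (v w : 'rV[N]_n), tdist v w < d ->
    mdist (term_eval (ts i) v) (term_eval (ts i) w) <= fun_mod f e / 2.
  by have [d d0 h] := IH i _ m0; exists d.
have [d hd] := choice IH.
exists (\big[Num.min/1]_i d i).
  by apply: lt_bigmin => // i _; exact: (hd i).1.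
move=> N v w h /=; apply: fun_unif_cont => //.
apply: le_lt_trans m2; apply: tdist_leP => [|i]; first exact: ltW.
rewrite !mxE; apply: (hd i).2; apply: lt_le_trans h _.
exact: bigmin_le.
Qed.

(** By contradiction: for pairs at distance below [1/(m+1)] with images more than [e] apart, the
    first components cluster at some [v] in the box, and continuity at [v] brings both images of a
    late pair within [e/2] of [u v]. *)
Lemma conn_unif_cont k (u : 'rV[R]_k -> R) (B : 'I_k -> R) (e : R) :
  continuous u -> 0 < e ->
  exists2 d : R, 0 < d & forall v w : 'rV[R]_k,
    (forall i, `|v ord0 i| <= B i) -> (forall i, `|w ord0 i| <= B i) ->
    (forall i, `|v ord0 i - w ord0 i| < d) -> `|u v - u w| <= e.
Proof.
move=> cu e0.
set K := [set v : 'rV[R]_k | forall i, `[- B i, B i]%classic (v ord0 i)].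
have cK : compact K by apply: (@rV_compact _ _ (fun i => `[- B i, B i]%classic)) => i; exact: segment_compact.
apply: contrapT => nd.
have step (m : nat) : exists vw : 'rV[R]_k * 'rV[R]_k,
    [/\ K vw.1, K vw.2, (forall i, `|vw.1 ord0 i - vw.2 ord0 i| < m.+1%:R^-1) &
      e < `|u vw.1 - u vw.2|].
  apply: contrapT => nvw; apply: nd; exists m.+1%:R^-1 => // v w hv hw hvw.
  rewrite leNgt; apply/negP => lt; apply: nvw; exists (v, w).
  by split => //= i; rewrite /= in_itv/= -ler_norml.
have [vw hvw] := choice step.
have FK : ((fst \o vw) @ \oo) K.
  by exists 0%N => // m _; have [] := hvw m.
have [v [Kv cl]] := cK _ _ FK.
have /= ball_u := cu v.
have e20 : 0 < e / 2 by lra.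
have nb : nbhs v [set w | `|u v - u w| < e / 2].
  by move/cvgrPdist_lt: ball_u => /(_ _ e20).
have [d /= d0 hd] := (nbhs_ballP _ _).1 nb.
have d20 : 0 < d / 2 by lra.
have nearN : \forall m \near \oo, (m.+1%:R^-1 : R) < d / 2.
  by apply: near_infty_natSinv_lt (PosNum d20).
have ballv : nbhs v (ball v (d / 2)) by exact: nbhsx_ballx.
have : ((fst \o vw) @ \oo) [set x | exists m, x = fst (vw m) /\ m.+1%:R^-1 < d / 2 ].
  by apply: filterS nearN => m hm; exists m.
move=> /cl /(_ ballv) [x [[m [-> hm]] hx]].
have [_ _ h3 h4] := hvw m.
have w1 : `|u v - u (vw m).1| < e / 2.
  by apply: hd; apply: le_ball hx; lra.
have w2 : `|u v - u (vw m).2| < e / 2.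
  apply: hd; rewrite [d]splitr; apply: ball_triangle hx _.
  split=> // i j; rewrite (ord1 i) /ball/=.
  exact: lt_trans (h3 j) hm.
have : `|u (vw m).1 - u (vw m).2| < e.
  rewrite [e]splitr (_ : _ - _ = (u v - u (vw m).2) - (u v - u (vw m).1)); last ring.
  by rewrite (le_lt_trans (ler_normB _ _))// ltrD.
by rewrite ltNge (ltW h4).
Qed.

Lemma tdist_extend N n (x : N) (v w : 'rV[N]_n) :
  tdist (extend x v) (extend x w) <= tdist v w.
Proof.
apply: tdist_leP => [|i]; first exact: tdist_ge0.
rewrite !extendE; case: (unlift ord0 i) => [j|] /=; first exact: mdist_le_tdist.
by rewrite mdistxx tdist_ge0.
Qed.

(** One modulus serves all structures and all parameters at once, which later gives estimates
    uniform along a sequence of parameters. *)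
Lemma formula_unif_cont n (phi : formula L n) (e : R) : 0 < e ->
  exists2 d : R, 0 < d & forall N (v w : 'rV[N]_n), tdist v w < d ->
    `|formula_eval phi v - formula_eval phi w| <= e.
Proof.
elim: phi e => {n} [n t u|n P ts|n k u cu phis IH|n psi IH|n psi IH] e e0.
- have e20 : 0 < e / 2 by lra.
  have [d1 d10 h1] := term_unif_cont t e20.
  have [d2 d20 h2] := term_unif_cont u e20.
  exists (Num.min d1 d2); first by rewrite lt_min d10.
  move=> N v w; rewrite lt_min => /andP[/h1 tv /h2 uv] /=.
  have t1 := metric_triangle (term_eval t v) (term_eval t w) (term_eval u v).
  have t2 := metric_triangle (term_eval t w) (term_eval u w) (term_eval u v).
  have t3 := metric_triangle (term_eval t w) (term_eval t v) (term_eval u w).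
  have t4 := metric_triangle (term_eval t v) (term_eval u v) (term_eval u w).
  rewrite (metric_sym (term_eval t w) (term_eval t v)) in t3.
  rewrite (metric_sym (term_eval u w) (term_eval u v)) in t2.
  by rewrite ler_norml; apply/andP; split; lra.
- have m0 := rel_mod_gt0 P e0.
  have m20 : 0 < rel_mod P e / 2 by lra.
  have {}IH i : exists d : R, 0 < d /\ forall N (v w : 'rV[N]_n), tdist v w < d ->
      mdist (term_eval (ts i) v) (term_eval (ts i) w) <= rel_mod P e / 2.
    by have [d d0 h] := term_unif_cont (ts i) m20; exists d.
  have [d hd] := choice IH.
  exists (\big[Num.min/1]_i d i).
    by apply: lt_bigmin => // i _; exact: (hd i).1.
  move=> N v w h /=; apply: rel_unif_cont => //.
  apply: (@le_lt_trans _ _ (rel_mod P e / 2)); last by lra.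
  apply: tdist_leP => [|i]; first exact: ltW.
  by rewrite !mxE; apply: (hd i).2; apply: lt_le_trans h _; exact: bigmin_le.
- have [B hB] := choice (fun i => formula_bounded (phis i)).
  have [d d0 hd] := conn_unif_cont B cu e0.
  have d20 : 0 < d / 2 by lra.
  have {}IH i : exists d' : R, 0 < d' /\ forall N (v w : 'rV[N]_n), tdist v w < d' ->
      `|formula_eval (phis i) v - formula_eval (phis i) w| <= d / 2.
    by have [d' d'0 h] := IH i _ d20; exists d'.
  have [d' hd'] := choice IH.
  exists (\big[Num.min/1]_i d' i).
    by apply: lt_bigmin => // i _; exact: (hd' i).1.
  move=> N v w h /=; apply: hd => i; rewrite ?mxE //.
  apply: (@le_lt_trans _ _ (d / 2)); last by lra.
  by apply: (hd' i).2; apply: lt_le_trans h _; exact: bigmin_le.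
- have [d d0 hd] := IH e e0; exists d => // N.
  have main v w : tdist v w < d -> formula_eval (Sup psi) v <= formula_eval (Sup psi) (w : 'rV[N]_n) + e.
    move=> vw; apply: ge_sup; first exact: (formula_image_has_sup psi v).1.
    move=> _ [x _ <-]; change (formula_eval psi (extend x v) <= formula_eval (Sup psi) w + e).
    have /hd : tdist (extend x v) (extend x w) < d.
      exact: le_lt_trans (tdist_extend _ _ _) vw.
    have : formula_eval psi (extend x w) <= formula_eval (Sup psi) w.
      by apply: ub_le_sup; [exact: (formula_image_has_sup psi w).2|exists x].
    by rewrite ler_norml => h /andP[h1 h2]; lra.
  move=> v w vw; have := main _ _ vw; rewrite tdistC in vw; have := main _ _ vw.
  by rewrite ler_norml => h1 h2; apply/andP; split; lra.
- have [d d0 hd] := IH e e0; exists d => // N.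
  have main v w : tdist v w < d -> formula_eval (Inf psi) v - e <= formula_eval (Inf psi) (w : 'rV[N]_n).
    move=> vw; apply: lb_le_inf; first exact: (formula_image_has_inf psi w).1.
    move=> _ [x _ <-]; change (formula_eval (Inf psi) v - e <= formula_eval psi (extend x w)).
    have /hd : tdist (extend x v) (extend x w) < d.
      exact: le_lt_trans (tdist_extend _ _ _) vw.
    have : formula_eval (Inf psi) v <= formula_eval psi (extend x v).
      by apply: ge_inf; [exact: (formula_image_has_inf psi v).2|exists x].
    by rewrite ler_norml => h /andP[h1 h2]; lra.
  move=> v w vw; have := main _ _ vw; rewrite tdistC in vw; have := main _ _ vw.
  by rewrite ler_norml => h1 h2; apply/andP; split; lra.
Qed.

Lemma formula_le_sup n (psi : formula L n.+1) N (v : 'rV[N]_n) x :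
  formula_eval psi (extend x v) <= formula_eval (Sup psi) v.
Proof.
by apply: ub_le_sup; [exact: (formula_image_has_sup psi v).2|exists x].
Qed.

Lemma formula_inf_le n (psi : formula L n.+1) N (v : 'rV[N]_n) x :
  formula_eval (Inf psi) v <= formula_eval psi (extend x v).
Proof.
by apply: ge_inf; [exact: (formula_image_has_inf psi v).2|exists x].
Qed.

Lemma formula_sup_approx n (psi : formula L n.+1) N (v : 'rV[N]_n) e : 0 < e ->
  exists x, formula_eval (Sup psi) v - e < formula_eval psi (extend x v).
Proof.
move=> e0.
by have [_ [x _ <-] hx] := sup_adherent e0 (formula_image_has_sup psi v); exists x.
Qed.

Lemma formula_inf_approx n (psi : formula L n.+1) N (v : 'rV[N]_n) e : 0 < e ->
  exists x, formula_eval psi (extend x v) < formula_eval (Inf psi) v + e.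
Proof.
move=> e0.
by have [_ [x _ <-] hx] := inf_adherent e0 (formula_image_has_inf psi v); exists x.
Qed.

End FormulaBounds.

Section Renaming.
Context {R : realType} {L : signature R}.
Implicit Types M N : structure L.

Fixpoint term_rename n m (s : 'I_n -> 'I_m) (t : term L n) : term L m :=
  match t with
  | Var i => Var L (s i)
  | App f ts => App (fun i => term_rename s (ts i))
  end.

Definition lift_renaming n m (s : 'I_n -> 'I_m) (i : 'I_n.+1) : 'I_m.+1 :=
  oapp (fun j => lift ord0 (s j)) ord0 (unlift ord0 i).

Fixpoint formula_rename n (phi : formula L n) :
    forall m, ('I_n -> 'I_m) -> formula L m :=
  match phi in formula _ n return forall m, ('I_n -> 'I_m) -> formula L m with
  | Dist _ t u => fun m s => Dist (term_rename s t) (term_rename s u)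
  | Rel _ P ts => fun m s => Rel (fun i => term_rename s (ts i))
  | Conn _ _ u cu phis =>
      fun m s => Conn cu (fun i => formula_rename (phis i) s)
  | Sup _ psi => fun m s => Sup (formula_rename psi (lift_renaming s))
  | Inf _ psi => fun m s => Inf (formula_rename psi (lift_renaming s))
  end.

Lemma term_renameE n m (s : 'I_n -> 'I_m) (t : term L n) N (v : 'rV[N]_m) :
  term_eval (term_rename s t) v = term_eval t (\row_i v ord0 (s i)).
Proof.
elim: t => [i|f ts IH] /=; first by rewrite mxE.
by congr fun_interp; apply/rowP => i; rewrite !mxE IH.
Qed.

Lemma extend_rename n m (s : 'I_n -> 'I_m) N (x : N) (v : 'rV[N]_m) :
  \row_i extend x v ord0 (lift_renaming s i) = extend x (\row_i v ord0 (s i)).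
Proof.
apply/rowP => i; rewrite mxE !extendE /lift_renaming.
by have [j ij|ij] := unliftP ord0 i; subst i; rewrite ?liftK ?unlift_none /= ?liftK ?unlift_none /= ?mxE.
Qed.

Lemma formula_renameE n (phi : formula L n) m (s : 'I_n -> 'I_m)
    N (v : 'rV[N]_m) :
  formula_eval (formula_rename phi s) v =
    formula_eval phi (\row_i v ord0 (s i)).
Proof.
elim: phi m s v => {n} [n t u|n P ts|n k u cu phis IH|n psi IH|n psi IH] m s v /=.
- by rewrite !term_renameE.
- by congr rel_interp; apply/rowP => i; rewrite !mxE term_renameE.
- by congr u; apply/rowP => i; rewrite !mxE IH.
- by congr sup; apply: eq_imagel => x _; rewrite IH extend_rename.
- by congr inf; apply: eq_imagel => x _; rewrite IH extend_rename.
Qed.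

End Renaming.

(** * Predicates given by formulas, uniformly in the structure *)

Section FormulaPredicates.
Context {R : realType} {L : signature R}.
Implicit Types M N : structure L.

(* Variables are indexed by an arbitrary finite type rather than by an ['I_n],
   so that they can be renamed, paired and added without arithmetic. *)
Definition fml (I : finType) (P : forall N, (I -> N) -> R) :=
  exists phi : formula L #|I|, forall N (v : I -> N),
    P N v = formula_eval phi (\row_k v (enum_val k)).

Lemma fml_eval n (phi : formula L n) :
  fml (fun N (v : 'I_n -> N) => formula_eval phi (\row_i v i)).
Proof.
exists (formula_rename phi (fun i => enum_rank i)) => N v.
rewrite formula_renameE; congr formula_eval; apply/rowP => i.
by rewrite !mxE enum_rankK.
Qed.

Lemma fml_rename (I J : finType) (s : I -> J) (P : forall N, (I -> N) -> R) :
  fml P -> fml (fun N (v : J -> N) => P N (v \o s)).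
Proof.
move=> [phi hphi].
exists (formula_rename phi (fun k => enum_rank (s (enum_val k)))) => N v.
rewrite hphi formula_renameE; congr formula_eval; apply/rowP => i.
by rewrite !mxE enum_rankK.
Qed.

Lemma fml_dist (I : finType) (i j : I) :
  fml (fun N (v : I -> N) => mdist (v i) (v j)).
Proof.
exists (Dist (Var L (enum_rank i)) (Var L (enum_rank j))) => N v.
by rewrite /= !mxE !enum_rankK.
Qed.

Lemma fml_conn (I : finType) k (u : 'rV[R]_k -> R)
    (P : 'I_k -> forall N, (I -> N) -> R) :
  continuous u -> (forall i, fml (P i)) ->
  fml (fun N (v : I -> N) => u (\row_i P i N v)).
Proof.
move=> cu hP; have [phi hphi] := choice hP.
exists (Conn cu phi) => N v /=.
by congr u; apply/rowP => i; rewrite !mxE hphi.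
Qed.

Lemma cvg_row (T : Type) (F : set_system T) {FF : Filter F} k
    (f : 'I_k -> T -> R) (l : 'I_k -> R) :
  (forall i, f i x @[x --> F] --> l i) ->
  (\row_i f i x : 'rV[R]_k) @[x --> F] --> (\row_i l i : 'rV[R]_k).
Proof.
move=> cf; apply/cvg_mx_entourageP => A entA.
have h j : \forall y \near F, A (l j, f j y).
  by have /cvg_app_entourageP/(_ _ entA) := cf j.
have : \forall y \near F, forall j, A (l j, f j y) by apply: filter_forall.
by apply: filterS => y hy i j; rewrite !mxE inE.
Qed.

Lemma fml_comp (I : finType) (u : R -> R) (P : forall N, (I -> N) -> R) :
  continuous u -> fml P -> fml (fun N v => u (P N v)).
Proof.
move=> cu hP.
have cu' : continuous (fun v : 'rV[R]_1 => u (v ord0 ord0)).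
  by move=> v; apply: continuous_comp; [exact: coord_continuous|exact: cu].
have [phi hphi] := fml_conn cu' (fun _ => hP).
by exists phi => N v; rewrite -hphi mxE.
Qed.

Lemma fml_comp2 (I : finType) (u : R * R -> R) (P Q : forall N, (I -> N) -> R) :
  continuous u -> fml P -> fml Q -> fml (fun N v => u (P N v, Q N v)).
Proof.
move=> cu hP hQ.
have cu' : continuous (fun v : 'rV[R]_2 => u (v ord0 ord0, v ord0 ord_max)).
  move=> v; apply: (@continuous_comp _ _ _
    (fun v : 'rV[R]_2 => (v ord0 ord0, v ord0 ord_max)) u); last exact: cu.
  have h1 : (fun w : 'rV[R]_2 => w ord0 ord0) x @[x --> v] --> v ord0 ord0.
    exact: coord_continuous.
  have h2 : (fun w : 'rV[R]_2 => w ord0 ord_max) x @[x --> v] --> v ord0 ord_max.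
    exact: coord_continuous.
  exact: (cvg_pair h1 h2).
have h (i : 'I_2) : fml (if i == ord0 then P else Q) by case: ifP.
have [phi hphi] := fml_conn cu' h.
by exists phi => N v; rewrite -hphi !mxE.
Qed.

Lemma fml_cst (I : finType) (c : R) : fml (fun N (v : I -> N) => c).
Proof.
have cu : continuous (fun _ : 'rV[R]_0 => c) by exact: cst_continuous.
have h (i : 'I_0) : fml (fun N (v : I -> N) => 0 : R) by case: i => m; rewrite ltn0.
have [phi hphi] := fml_conn cu h.
by exists phi => N v; rewrite -hphi.
Qed.

Lemma fml_inf1 (I : finType) (P : forall N, (option I -> N) -> R) :
  fml P -> fml (fun N (v : I -> N) => inf [set P N (oapp v x) | x in [set: N]]).
Proof.
move=> [phi hphi].
pose s (k : 'I_#|{: option I}|) : 'I_#|I|.+1 :=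
  oapp (fun i => lift ord0 (enum_rank i)) ord0 (enum_val k).
exists (Inf (formula_rename phi s)) => N v /=.
congr inf; apply: eq_imagel => x _; rewrite hphi formula_renameE.
congr formula_eval; apply/rowP => k; rewrite mxE [RHS]mxE extendE /s.
by case: (enum_val k) => [i|] /=; rewrite ?liftK ?unlift_none /= ?mxE ?enum_rankK.
Qed.

Lemma fml_bounded (I : finType) (P : forall N, (I -> N) -> R) : fml P ->
  exists B : R, forall N (v : I -> N), `|P N v| <= B.
Proof.
move=> [phi hphi]; have [B hB] := formula_bounded phi.
by exists B => N v; rewrite hphi.
Qed.

Lemma fml_unif_cont (I : finType) (P : forall N, (I -> N) -> R) (e : R) :
  fml P -> 0 < e -> exists2 d : R, 0 < d & forall N (v w : I -> N),
    (forall i, mdist (v i) (w i) < d) -> `|P N v - P N w| <= e.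
Proof.
move=> [phi hphi] e0; have [d d0 hd] := formula_unif_cont phi e0.
exists d => // N v w vw; rewrite !hphi; apply: hd.
by apply: tdist_ltP => // i; rewrite !mxE.
Qed.

End FormulaPredicates.

(** * Ultraproducts and the theorem of Los *)

Lemma pow2_small (R : realType) (e : R) : 0 < e -> exists k, 2^-1 ^+ k < e.
Proof.
move=> e0; have /cvgrPdist_lt/(_ _ e0) : (2^-1 ^+ k : R) @[k --> \oo] --> (0 : R).
  by apply: cvg_expr; rewrite ger0_norm//; lra.
move=> [k _ /(_ k (leqnn k))]; rewrite /= sub0r normrN ger0_norm ?exprn_ge0//.
by exists k.
Qed.

Lemma pow2_gt0 (R : realType) k : 0 < (2^-1 : R) ^+ k.
Proof. by rewrite exprn_gt0. Qed.

Lemma pow2_le (R : realType) j k : (j <= k)%N -> (2^-1 : R) ^+ k <= 2^-1 ^+ j.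
Proof. by move=> jk; apply: ler_wiXn2l => //; lra. Qed.

Section Completeness.
Context {R : realType} {L : signature R}.

Lemma seq_complete (N : structure L) (s : nat -> N) :
  (forall e : R, 0 < e -> exists K, forall j l, (K <= j)%N -> (K <= l)%N ->
    mdist (s j) (s l) < e) ->
  exists y, forall e : R, 0 < e -> exists K, forall j, (K <= j)%N ->
    mdist (s j) y < e.
Proof.
move=> cs.
have cF : cauchy (s @ \oo).
  apply/cauchy_ballP => e e0; have [K hK] := cs e e0.
  pose A := s @` [set j | (K <= j)%N].
  exists (A, A); first by split; exists K => // j jK; exists j.
  move=> [_ _] /= [[j jK <-] [l lK <-]]; rewrite ballEmdist /=; exact: hK.
have [y hy] := carrier_complete (fmap_proper_filter s _) cF; exists y => e e0.
have /hy [K _ hK] : nbhs y (ball y e) by exact: nbhsx_ballx.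
by exists K => j /hK; rewrite ballEmdist /= metric_sym.
Qed.

End Completeness.

Section UltraLimit.
Context {R : realType} {I : Type} (U : set_system I) {UU : UltraFilter U}.
Implicit Types h : I -> R.

Definition ubounded h := exists B : R, forall i, `|h i| <= B.

Definition ulim h : R := lim (h @ U).

(** The image of an ultrafilter is an ultrafilter, and it contains the compact segment that bounds
    [h]. *)
Lemma ulim_cvg h : ubounded h -> h @ U --> ulim h.
Proof.
move=> [B hB]; apply/cvg_ex.
have UF : UltraFilter (h @ U).
  split=> [|G GG hG]; first exact: fmap_proper_filter.
  rewrite predeqE => A; split=> [GA|]; last exact: hG.
  have [//|nA] := in_ultra_setVsetC (h @^-1` A) UU.
  have : G (A `&` ~` A) by apply: filterI => //; apply: hG.
  by rewrite setICr => /filter_ex [].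
have /= := @segment_compact R (- B) B; rewrite compact_ultra.
move=> /(_ (h @ U) UF) [|l [_ hl]]; last by exists l.
suff : U (h @^-1` `[- B, B]%classic) by [].
apply: filterE => i; rewrite /preimage/= in_itv/= -ler_norml; exact: hB.
Qed.

Lemma ulimP h l : h @ U --> l -> ulim h = l.
Proof. by move=> hl; apply: cvg_lim hl; exact: Rhausdorff. Qed.

Lemma ulim_lt h r : ubounded h -> ulim h < r -> U [set i | h i < r].
Proof. by move=> /ulim_cvg bh hr; exact: (cvgr_lt _ bh _ hr). Qed.

Lemma ulim_gt h r : ubounded h -> r < ulim h -> U [set i | r < h i].
Proof. by move=> /ulim_cvg bh hr; exact: (cvgr_gt _ bh _ hr). Qed.

Lemma ulim_le h r : ubounded h -> U [set i | h i <= r] -> ulim h <= r.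
Proof.
move=> bh hU; rewrite leNgt; apply/negP => /(ulim_gt bh) hr.
have [i [/= h1 h2]] := filter_ex (filterI hU hr).
by move: h1; rewrite leNgt h2.
Qed.

Lemma ulim_ge h r : ubounded h -> U [set i | r <= h i] -> r <= ulim h.
Proof.
move=> bh hU; rewrite leNgt; apply/negP => /(ulim_lt bh) hr.
have [i [/= h1 h2]] := filter_ex (filterI hU hr).
by move: h1; rewrite leNgt h2.
Qed.

Lemma ulim_eqP h l : ubounded h ->
  (forall e, 0 < e -> U [set i | `|h i - l| <= e]) -> ulim h = l.
Proof.
move=> bh hl; apply/eqP; rewrite eq_le; apply/andP; split.
  apply/ler_addgt0Pl => e e0; apply: ulim_le => //.
  by apply: filterS (hl _ e0) => i /=; rewrite ler_norml => /andP[h1 h2]; lra.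
apply/ler_addgt0Pl => e e0; rewrite -lerBlDl; apply: ulim_ge => //.
by apply: filterS (hl _ e0) => i /=; rewrite ler_norml => /andP[h1 h2]; lra.
Qed.

Lemma ulim_leD h k c : ubounded h -> ubounded k ->
  (forall i, h i <= k i + c) -> ulim h <= ulim k + c.
Proof.
move=> bh bk hk; apply/ler_addgt0Pl => e e0; apply: ulim_le => //.
have : ulim k < ulim k + e by rewrite ltrDl.
move=> /(ulim_lt bk); apply: filterS => i /= h1.
by have := hk i; lra.
Qed.

End UltraLimit.

Section UltraProduct.
Context {R : realType} {L : signature R} {I : Type} {U : set_system I}.
Variables (UU : UltraFilter U) (N_ : I -> structure L).

Definition usection := forall i, N_ i.

Definition udist (x y : usection) : R := ulim U (fun i => mdist (x i) (y i)).

Lemma mdist_ubounded (x y : usection) : ubounded (fun i => mdist (x i) (y i)).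
Proof. by exists (diam_bound L) => i; rewrite ger0_norm ?mdist_ge0 ?mdist_bounded. Qed.
Hint Resolve mdist_ubounded : core.

Lemma udistxx x : udist x x = 0.
Proof.
apply: ulim_eqP => // e e0; apply: filterE => i /=.
by rewrite mdistxx subrr normr0 ltW.
Qed.

Lemma udistC x y : udist x y = udist y x.
Proof. by congr (ulim U _); apply/funext => i; rewrite metric_sym. Qed.

Lemma udist_ge0 x y : 0 <= udist x y.
Proof. by apply: ulim_ge => //; apply: filterE => i /=; exact: mdist_ge0. Qed.

Lemma udist_triangle x y z : udist x z <= udist x y + udist y z.
Proof.
apply/ler_addgt0Pl => e e0; apply: ulim_le => //.
have e20 : 0 < e / 2 by lra.
have h1 : U [set i | mdist (x i) (y i) < udist x y + e / 2].
  by apply: ulim_lt => //; rewrite ltrDl.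
have h2 : U [set i | mdist (y i) (z i) < udist y z + e / 2].
  by apply: ulim_lt => //; rewrite ltrDl.
apply: filterS (filterI h1 h2) => i /= [{}h1 {}h2].
by have := metric_triangle (x i) (y i) (z i); lra.
Qed.

(** The quotient of the sections by [udist x y = 0], a point being its equivalence class. The
    argument [V] keeps in the type the proof that [U] is an ultrafilter, on which the metric axioms
    of the instance below depend. *)
Record ultraproduct_carrier (V : UltraFilter U) := UltraproductCarrier {
  uclass : set usection;
  uclassP : exists x, uclass = [set y | udist x y = 0]
}.

Local Notation T := (ultraproduct_carrier UU).

Definition ucls (x : usection) : T :=
  UltraproductCarrier UU (ex_intro _ x erefl).

Definition urepr (c : T) : usection := projT1 (cid (uclassP c)).

Lemma ucls_eq x y : udist x y = 0 -> ucls x = ucls y.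
Proof.
move=> xy; rewrite /ucls.
have e : [set z | udist x z = 0] = [set z | udist y z = 0].
  apply/seteqP; split => z /= xz; apply/eqP; rewrite eq_le udist_ge0 andbT.
    by have := udist_triangle y x z; rewrite xz (udistC y x) xy addr0.
  by have := udist_triangle x y z; rewrite xz xy addr0.
move: (ex_intro _ x _) (ex_intro _ y _); rewrite e => p q.
by congr UltraproductCarrier; exact: Prop_irrelevance.
Qed.

Lemma ureprK c : ucls (urepr c) = c.
Proof.
rewrite /urepr; case: cid => x /=; case: c => A p /= Ax; subst A.
by congr UltraproductCarrier; exact: Prop_irrelevance.
Qed.

Lemma udist_urepr x : udist x (urepr (ucls x)) = 0.
Proof.
rewrite /urepr; case: cid => y /= e.
have : [set z | udist y z = 0] y by rewrite /= udistxx.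
by rewrite -e.
Qed.

Definition ucar_dist (c d : T) := udist (urepr c) (urepr d).

Lemma ucar_dist_cls x y : ucar_dist (ucls x) (ucls y) = udist x y.
Proof.
have hx := udist_urepr x; have hy := udist_urepr y.
have h1 := udist_triangle x (urepr (ucls x)) y.
have h2 := udist_triangle (urepr (ucls x)) (urepr (ucls y)) y.
have h3 := udist_triangle (urepr (ucls x)) x (urepr (ucls y)).
have h4 := udist_triangle x y (urepr (ucls y)).
rewrite (udistC (urepr (ucls y)) y) in h2; rewrite (udistC (urepr (ucls x)) x) in h3.
by apply/eqP; rewrite eq_le /ucar_dist; apply/andP; split; lra.
Qed.

HB.instance Definition _ := gen_eqMixin T.
HB.instance Definition _ := gen_choiceMixin T.

Lemma ucar_distxx c : ucar_dist c c = 0.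
Proof. exact: udistxx. Qed.

Lemma ucar_dist_eq0 c d : ucar_dist c d = 0 -> c = d.
Proof. by move=> /ucls_eq; rewrite !ureprK. Qed.

Lemma ucar_distC c d : ucar_dist c d = ucar_dist d c.
Proof. exact: udistC. Qed.

Lemma ucar_dist_triangle d c e : ucar_dist c e <= ucar_dist c d + ucar_dist d e.
Proof. exact: udist_triangle. Qed.

HB.instance Definition _ := isMetric.Build R T
  ucar_distxx ucar_dist_eq0 ucar_distC ucar_dist_triangle.

Lemma mdist_ucls x y : mdist (ucls x) (ucls y) = udist x y.
Proof. exact: ucar_dist_cls. Qed.

End UltraProduct.

Arguments udist {R L I} U {N_} x y.

Lemma dependent_choice_fun (I : Type) (T : I -> Type) (P : forall i, T i -> Prop) :
  (forall i, exists x, P i x) -> exists f, forall i, P i (f i).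
Proof. by move=> h; exists (fun i => projT1 (cid (h i))) => i; case: cid. Qed.

Section UltraProductStructure.
Context {R : realType} {L : signature R} {I : Type} {U : set_system I}.
Variables (UU : UltraFilter U) (N_ : I -> structure L).

Local Notation T := (ultraproduct_carrier N_ UU).
Local Notation cls := (ucls UU).

Definition row_at n (v : 'I_n -> usection N_) (i : I) : 'rV[N_ i]_n :=
  \row_k v k i.

Lemma near_tdist n (v w : 'I_n -> usection N_) r :
  tdist (\row_k cls (v k)) (\row_k cls (w k)) < r ->
  U [set i | tdist (row_at v i) (row_at w i) < r].
Proof.
move=> vw; have r0 : 0 < r by apply: le_lt_trans vw; exact: tdist_ge0.
have h k : U [set i | mdist (v k i) (w k i) < r].
  apply: ulim_lt; first exact: mdist_ubounded.
  have := mdist_le_tdist (\row_k cls (v k)) (\row_k cls (w k)) k.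
  by rewrite !mxE mdist_ucls => /le_lt_trans; apply.
apply: (filterS _ (filter_forall _ h)) => i /= hi.
by apply: tdist_ltP => // k; rewrite !mxE.
Qed.

Definition ultra_fun (f : funsym L) (a : 'rV[T]_(fun_arity f)) : T :=
  cls (fun i => fun_interp (row_at (fun k => urepr (a ord0 k)) i)).

Definition ultra_rel (P : relsym L) (a : 'rV[T]_(rel_arity P)) : R :=
  ulim U (fun i => rel_interp (row_at (fun k => urepr (a ord0 k)) i)).

Lemma rel_ubounded (P : relsym L) (v : 'I_(rel_arity P) -> usection N_) :
  ubounded (fun i => rel_interp (row_at v i)).
Proof. by exists (rel_bound P) => i; exact: rel_bounded. Qed.

Lemma row_urepr n (a : 'rV[T]_n) : \row_k cls (urepr (a ord0 k)) = a.
Proof. by apply/rowP => k; rewrite mxE ureprK. Qed.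

Lemma udist_fun (f : funsym L) (v w : 'I_(fun_arity f) -> usection N_) e : 0 < e ->
  tdist (\row_k cls (v k)) (\row_k cls (w k)) < fun_mod f e ->
  udist U (fun i => fun_interp (row_at v i)) (fun i => fun_interp (row_at w i))
    <= e.
Proof.
move=> e0 /near_tdist h; apply: ulim_le; first exact: mdist_ubounded.
by apply: filterS h => i /=; exact: fun_unif_cont.
Qed.

Lemma ulim_rel (P : relsym L) (v w : 'I_(rel_arity P) -> usection N_) e : 0 < e ->
  tdist (\row_k cls (v k)) (\row_k cls (w k)) < rel_mod P e ->
  `|ulim U (fun i => rel_interp (row_at v i)) -
    ulim U (fun i => rel_interp (row_at w i))| <= e.
Proof.
move=> e0 /near_tdist h; apply/ler_addgt0Pl => d d0.
have d20 : 0 < d / 2 by lra.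
have /cvgrPdist_lt/(_ _ d20) h1 := @ulim_cvg _ _ U UU _ (rel_ubounded v).
have /cvgrPdist_lt/(_ _ d20) h2 := @ulim_cvg _ _ U UU _ (rel_ubounded w).
have [i [[/= {}h {}h1] h2']] := filter_ex (filterI (filterI h h1) h2).
have := rel_unif_cont e0 h.
move: h1 h2'; rewrite /= !ltr_norml ler_norml => /andP[h1 h1'] /andP[h2' h2''].
by rewrite ler_norml => /andP[h3 h4]; apply/andP; split; lra.
Qed.

Lemma ultra_fun_cls (f : funsym L) (v : 'I_(fun_arity f) -> usection N_) :
  ultra_fun (\row_k cls (v k)) = cls (fun i => fun_interp (row_at v i)).
Proof.
apply: ucls_eq; apply/eqP; rewrite eq_le udist_ge0 andbT.
apply/ler_addgt0Pl => e e0; rewrite addr0; apply: udist_fun => //.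
rewrite row_urepr tdistxx; exact: fun_mod_gt0.
Qed.

Lemma ultra_rel_cls (P : relsym L) (v : 'I_(rel_arity P) -> usection N_) :
  ultra_rel (\row_k cls (v k)) = ulim U (fun i => rel_interp (row_at v i)).
Proof.
apply/eqP; rewrite -subr_eq0 -normr_le0.
apply/ler_addgt0Pl => e e0; rewrite addr0; apply: ulim_rel => //.
rewrite row_urepr tdistxx; exact: rel_mod_gt0.
Qed.

Lemma ultra_nonempty : [set: T] !=set0.
Proof.
by exists (cls (fun i => projT1 (cid (carrier_nonempty (N_ i))))).
Qed.

Lemma ultra_bounded (x y : T) : mdist x y <= diam_bound L.
Proof.
apply: ulim_le; first exact: mdist_ubounded.
by apply: filterE => i; exact: mdist_bounded.
Qed.

(* Along a rapidly Cauchy sequence [s], truncate at the last index up to which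
   the sequence is fast Cauchy in the given coordinate. *)
Lemma ultra_limit (s : nat -> usection N_) :
  (forall j k, udist U (s j) (s k) < 2^-1 ^+ j + 2^-1 ^+ k) ->
  exists y : usection N_, forall k, udist U (s k) y <= 2 * 2^-1 ^+ k.
Proof.
move=> cs.
pose A k i := forall j l, (j <= k)%N -> (l <= k)%N ->
  mdist (s j i) (s l i) < 2^-1 ^+ j + 2^-1 ^+ l.
have UA k : U (A k).
  have h (j l : 'I_k.+1) :
      U [set i | mdist (s j i) (s l i) < 2^-1 ^+ j + 2^-1 ^+ l].
    by apply: ulim_lt; [exact: mdist_ubounded|exact: cs].
  have {}h : U [set i | forall j l : 'I_k.+1,
      mdist (s j i) (s l i) < 2^-1 ^+ j + 2^-1 ^+ l].
    by apply: filter_forall => j; apply: filter_forall => l; exact: h.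
  apply: filterS h => i hi j l jk lk.
  by have := hi (Ordinal (jk : (j < k.+1)%N)) (Ordinal (lk : (l < k.+1)%N)).
suff h i : exists y : N_ i, forall k, A k i -> mdist (s k i) y <= 2 * 2^-1 ^+ k.
  have [y hy] := dependent_choice_fun h; exists y => k.
  apply: ulim_le; first exact: mdist_ubounded.
  by apply: filterS (UA k) => i; exact: hy.
have [allA|] := pselect (forall k, A k i).
  have [e e0|y hy] := @seq_complete _ _ (N_ i) (fun k => s k i).
    have e20 : 0 < e / 2 by lra.
    have [K hK] := pow2_small e20; exists K => j l Kj Kl.
    have := allA (maxn j l) _ _ (leq_maxl _ _) (leq_maxr _ _).
    by have := pow2_le R Kj; have := pow2_le R Kl; lra.
  exists y => k _; apply/ler_addgt0Pl => e e0.
  have e20 : 0 < e / 2 by lra.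
  have [K hK] := hy _ e20.
  have := hK _ (leq_maxl K k).
  have := allA (maxn K k) _ _ (leq_maxr _ _) (leqnn _).
  have := metric_triangle (s k i) (s (maxn K k) i) y.
  by have := pow2_le R (leq_maxr K k); lra.
move=> /existsNP exk.
have exk' : exists k, ~~ `[< A k i >] by case: exk => k nA; exists k; apply/asboolPn.
(* The least failing index is not 0, where the condition reads [0 < 2]. If it is [k+1], then [s k i]
   serves: whenever [A j i] holds, [j <= k], and [s j i] is within [2^-j + 2^-k] of [s k i]. *)
case: (ex_minnP exk') => [[|k]].
  move=> /asboolPn; case => j l; rewrite !leqn0 => /eqP-> /eqP->.
  by rewrite mdistxx expr0; lra.
move=> /asboolPn nA kmin; exists (s k i) => j Aj.
have jk : (j <= k)%N.
  rewrite leqNgt; apply/negP => kj; apply: nA => l m lk mk.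
  by apply: Aj; apply: leq_trans kj.
have /asboolP Ak : `[< A k i >] by apply: contraT => /kmin; rewrite ltnn.
have := Ak j k jk (leqnn _); have := pow2_le R jk; lra.
Qed.

(** A Cauchy filter contains a ball of radius [2^-k] for each [k]. Any two of these balls meet, so
    their centres satisfy the hypothesis of [ultra_limit]. *)
Lemma ultra_complete (F : set_system T) :
  ProperFilter F -> cauchy F -> exists x : T, F --> x.
Proof.
move=> FF cF; have /cauchyP cF' := (cF : cauchy F).
have h k : exists x : T, F (ball x (2^-1 ^+ k)).
  exact: cF' _ (pow2_gt0 R k).
have [x hx] := choice h.
have [j k|y hy] := @ultra_limit (fun k => urepr (x k)).
  have [z [h1 h2]] := filter_ex (filterI (hx j) (hx k)).
  rewrite -mdist_ucls !ureprK; move: h1 h2; rewrite !ballEmdist /= => h1 h2.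
  by have := metric_triangle (x j) z (x k); rewrite (metric_sym z); lra.
exists (cls y); apply/cvg_ballP => e e0.
have e30 : 0 < e / 3 by lra.
have [k hk] := pow2_small e30.
apply: filterS (hx k) => z; rewrite !ballEmdist /= => xz.
have := hy k; rewrite -mdist_ucls ureprK metric_sym => h1.
by have := metric_triangle (cls y) (x k) z; lra.
Qed.

Lemma ultra_fun_unif_cont (f : funsym L) (a b : 'rV[T]_(fun_arity f)) e : 0 < e ->
  tdist a b < fun_mod f e -> mdist (ultra_fun a) (ultra_fun b) <= e.
Proof.
move=> e0; rewrite -{1}(row_urepr a) -{1}(row_urepr b) => h.
by rewrite /ultra_fun mdist_ucls; exact: udist_fun.
Qed.

Lemma ultra_rel_bounded (P : relsym L) (a : 'rV[T]_(rel_arity P)) :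
  `|ultra_rel a| <= rel_bound P.
Proof.
have h := @rel_bounded _ L _ P.
rewrite ler_norml; apply/andP; split.
  apply: ulim_ge; first exact: rel_ubounded.
  by apply: filterE => i /=; have := h _ (row_at (fun k => urepr (a ord0 k)) i);
    rewrite ler_norml => /andP[].
apply: ulim_le; first exact: rel_ubounded.
by apply: filterE => i /=; have := h _ (row_at (fun k => urepr (a ord0 k)) i);
  rewrite ler_norml => /andP[].
Qed.

Lemma ultra_rel_unif_cont (P : relsym L) (a b : 'rV[T]_(rel_arity P)) e : 0 < e ->
  tdist a b < rel_mod P e -> `|ultra_rel a - ultra_rel b| <= e.
Proof.
move=> e0; rewrite -{1}(row_urepr a) -{1}(row_urepr b) => h.
exact: ulim_rel.
Qed.

Definition ultraproduct : structure L :=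
  Structure ultra_nonempty ultra_complete ultra_bounded ultra_fun_unif_cont
    ultra_rel_bounded ultra_rel_unif_cont.

Definition uclass_of (x : usection N_) : ultraproduct := cls x.

Lemma uclass_of_surj (c : ultraproduct) : exists x, c = uclass_of x.
Proof. by exists (urepr c); rewrite /uclass_of ureprK. Qed.

Lemma mdist_uclass_of (x y : usection N_) :
  mdist (uclass_of x) (uclass_of y) = ulim U (fun i => mdist (x i) (y i)).
Proof. exact: mdist_ucls. Qed.

Lemma Los_term n (t : term L n) (v : 'I_n -> usection N_) :
  term_eval t (\row_k uclass_of (v k)) =
    uclass_of (fun i => term_eval t (row_at v i)).
Proof.
elim: t => [k|f ts IH] /=.
  by rewrite mxE; congr uclass_of; apply: functional_extensionality_dep => i; rewrite mxE.
under eq_mx do rewrite IH.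
by rewrite ultra_fun_cls.
Qed.

Lemma formula_ubounded n (phi : formula L n) (v : 'I_n -> usection N_) :
  ubounded (fun i => formula_eval phi (row_at v i)).
Proof. by have [B hB] := formula_bounded phi; exists B. Qed.

Lemma extend_uclass n (s : usection N_) (v : 'I_n -> usection N_) :
  extend (uclass_of s) (\row_k uclass_of (v k)) =
  \row_k uclass_of (oapp v s (unlift ord0 k)).
Proof.
apply/rowP => k; rewrite extendE [RHS]mxE.
by case: (unlift ord0 k) => [j|] //=; rewrite mxE.
Qed.

Lemma row_at_extend n (s : usection N_) (v : 'I_n -> usection N_) i :
  row_at (fun k => oapp v s (unlift ord0 k)) i = extend (s i) (row_at v i).
Proof.
apply/rowP => k; rewrite extendE [LHS]mxE.
by case: (unlift ord0 k) => [j|] //=; rewrite mxE.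
Qed.

(** The step for a connective is its continuity along the convergent tuple of values. For [Sup] and
    [Inf], one inequality takes a near-optimal point of the ultraproduct, the other near-optimal
    points in every coordinate. *)
Theorem Los n (phi : formula L n) (v : 'I_n -> usection N_) :
  formula_eval phi (\row_k uclass_of (v k)) =
    ulim U (fun i => formula_eval phi (row_at v i)).
Proof.
elim: phi v => {n} [n t u|n P ts|n k u cu phis IH|n psi IH|n psi IH] v.
- by rewrite /= !Los_term mdist_uclass_of.
- rewrite /=; under eq_mx do rewrite Los_term.
  exact: ultra_rel_cls.
- rewrite /=; symmetry; apply: ulimP.
  have h : (\row_j formula_eval (phis j) (row_at v i)) @[i --> U] -->
      (\row_j formula_eval (phis j) (\row_k0 uclass_of (v k0)) : 'rV[R]_k).
    apply: cvg_row => j; rewrite IH; apply: ulim_cvg; exact: formula_ubounded.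
  apply: cvg_trans (cu _); exact: cvg_app h.
- have bS := formula_ubounded (Sup psi) v.
  apply/eqP; rewrite eq_le; apply/andP; split; apply/ler_addgt0Pl => e e0.
    have [c] := formula_sup_approx psi (\row_k uclass_of (v k)) e0.
    have [s ->] := uclass_of_surj c; rewrite extend_uclass IH => h.
    suff : ulim U (fun i => formula_eval psi
        (row_at (fun k => oapp v s (unlift ord0 k)) i)) <=
      ulim U (fun i => formula_eval (Sup psi) (row_at v i)) + 0 by lra.
    apply: ulim_leD; [exact: formula_ubounded|exact: bS|move=> i].
    by rewrite row_at_extend addr0; exact: formula_le_sup.
  have [s hs] := dependent_choice_fun
    (fun i => formula_sup_approx psi (row_at v i) e0).
  have := formula_le_sup psi (\row_k uclass_of (v k)) (uclass_of s).
  rewrite extend_uclass IH => h.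
  suff : ulim U (fun i => formula_eval (Sup psi) (row_at v i)) <=
    ulim U (fun i => formula_eval psi
        (row_at (fun k => oapp v s (unlift ord0 k)) i)) + e by lra.
  apply: ulim_leD; [exact: bS|exact: formula_ubounded|move=> i].
  by rewrite row_at_extend -lerBlDr; exact/ltW/hs.
- have bI := formula_ubounded (Inf psi) v.
  apply/eqP; rewrite eq_le; apply/andP; split; apply/ler_addgt0Pl => e e0.
    have [s hs] := dependent_choice_fun
      (fun i => formula_inf_approx psi (row_at v i) e0).
    have := formula_inf_le psi (\row_k uclass_of (v k)) (uclass_of s).
    rewrite extend_uclass IH => h.
    suff : ulim U (fun i => formula_eval psi
        (row_at (fun k => oapp v s (unlift ord0 k)) i)) <=
      ulim U (fun i => formula_eval (Inf psi) (row_at v i)) + e by lra.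
    apply: ulim_leD; [exact: formula_ubounded|exact: bI|move=> i].
    by rewrite row_at_extend; exact/ltW/hs.
  have [c] := formula_inf_approx psi (\row_k uclass_of (v k)) e0.
  have [s ->] := uclass_of_surj c; rewrite extend_uclass IH => h.
  suff : ulim U (fun i => formula_eval (Inf psi) (row_at v i)) <=
    ulim U (fun i => formula_eval psi
        (row_at (fun k => oapp v s (unlift ord0 k)) i)) + 0 by lra.
  apply: ulim_leD; [exact: bI|exact: formula_ubounded|move=> i].
  by rewrite row_at_extend addr0; exact: formula_inf_le.
Qed.

End UltraProductStructure.

(** * Predicates with parameters *)

Section ParametricPredicates.
Context {R : realType} {L : signature R}.
Implicit Types M N : structure L.

Definition sumv (T I J : Type) (v : I -> T) (w : J -> T) (s : I + J) : T :=
  match s with inl i => v i | inr j => w j end.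

(** A block of variables is bound at once, by induction on its size. Only a lower bound that is
    approached is asserted, since the infimum need not be attained. *)
Lemma fml_inf (I K : finType) (P : forall N, (I + K -> N) -> R) : fml P ->
  exists Q : forall N, (I -> N) -> R, [/\ fml Q,
    forall N v w, Q N v <= P N (sumv v w) &
    forall N v e, 0 < e -> exists w, P N (sumv v w) < Q N v + e].
Proof.
suff main k (P' : forall N, (I + 'I_k -> N) -> R) : fml P' ->
    exists Q : forall N, (I -> N) -> R, [/\ fml Q,
      forall N v w, Q N v <= P' N (sumv v w) &
      forall N v e, 0 < e -> exists w, P' N (sumv v w) < Q N v + e].
  move=> fP.
  pose s (x : I + K) : I + 'I_#|K| :=
    match x with inl i => inl i | inr k => inr (enum_rank k) end.
  have [Q [fQ Q1 Q2]] := main _ _ (fml_rename s fP).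
  have es N (v : I -> N) (w : K -> N) : sumv v (w \o enum_val) \o s = sumv v w.
    by apply/funext => -[i|k] //=; rewrite enum_rankK.
  exists Q; split => // [N v w|N v e e0]; first by rewrite -es; exact: Q1.
  have [w hw] := Q2 N v e e0; exists (w \o enum_rank); rewrite -es.
  suff -> : (w \o enum_rank) \o enum_val = w by [].
  by apply/funext => j /=; rewrite enum_valK.
elim: k P' => [|k IH] P' fP.
  have no_ord0 (T : Type) (j : 'I_0) : T by case: j => m; rewrite ltn0.
  pose s (x : I + 'I_0) : I := match x with inl i => i | inr j => no_ord0 I j end.
  have es N (v : I -> N) w : v \o s = sumv v w.
    by apply/funext => -[i|j] //; exact: no_ord0 j.
  exists (fun N v => P' N (v \o s)); split => [|N v w|N v e e0].
  - exact: fml_rename.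
  - by rewrite (es _ _ w).
  - by exists (no_ord0 N); rewrite (es _ _ (no_ord0 N)) ltrDl.
pose s (x : I + 'I_k.+1) : option (I + 'I_k) :=
  match x with
  | inl i => Some (inl i)
  | inr j => omap inr (unlift ord0 j)
  end.
have fP1 := fml_rename s fP.
have fI := fml_inf1 fP1.
have [Q [fQ Q1 Q2]] := IH _ fI.
pose cons_v N (x : N) (w : 'I_k -> N) (j : 'I_k.+1) := oapp w x (unlift ord0 j).
have es N (v : I -> N) x w : oapp (sumv v w) x \o s = sumv v (cons_v N x w).
  by apply/funext => -[i|j] //=; rewrite /cons_v; case: (unlift ord0 j).
have hi N (v : I + 'I_k -> N) :
    has_inf [set P' N (oapp v x \o s) | x in [set: N]].
  have [B hB] := fml_bounded fP; have [x0 _] := carrier_nonempty N.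
  split; first by eexists; exists x0.
  by exists (- B) => _ [x _ <-]; have := hB N (oapp v x \o s);
    rewrite ler_norml => /andP[].
exists Q; split => // [N v w|N v e e0].
  apply: le_trans (Q1 N v (fun j => w (lift ord0 j))) _.
  apply: ge_inf; first exact: (hi _ _).2.
  exists (w ord0) => //; rewrite es; congr (P' N _).
  apply/funext => -[i|j] //=; rewrite /cons_v.
  by case: (unliftP ord0 j) => [j' ->|->].
have e20 : 0 < e / 2 by lra.
have [w hw] := Q2 N v _ e20.
have [_ [x _ <-] hx] := inf_adherent e20 (hi N (sumv v w)).
exists (cons_v N x w); rewrite -es; lra.
Qed.

(* Parameters are named by constants from [C] and interpreted by [g : C -> N],
   so that one predicate makes sense in unrelated structures. *)
Definition pfml (C : Type) (I : finType)
    (P : forall N, (C -> N) -> (I -> N) -> R) :=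
  exists (J : finType) (c : J -> C) (Q : forall N, (I + J -> N) -> R),
    fml Q /\ forall N g v, P N g v = Q N (sumv v (g \o c)).

Section Closure.
Variable C : Type.
Local Notation pred I := (forall N, (C -> N) -> (I -> N) -> R).

Lemma pfml_ext (I : finType) (P Q : pred I) :
  (forall N g v, P N g v = Q N g v) -> pfml P -> pfml Q.
Proof.
by move=> PQ [J [c [P0 [fP hP]]]]; exists J, c, P0; split => // N g v; rewrite -PQ.
Qed.

Lemma pfml_fml (I : finType) (P : forall N, (I -> N) -> R) :
  fml P -> pfml (fun N (g : C -> N) v => P N v).
Proof.
move=> fP; exists void, (@of_void C), (fun N v => P N (v \o inl)); split => //.
exact: (@fml_rename _ _ _ (I + void)%type inl).
Qed.

Lemma pfml_rename (I I' : finType) (s : I -> I') (P : pred I) : pfml P ->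
  pfml (fun N g (v : I' -> N) => P N g (v \o s)).
Proof.
move=> [J [c [Q [fQ hQ]]]]; exists J, c.
pose t (x : I + J) : I' + J := match x with inl i => inl (s i) | inr j => inr j end.
exists (fun N v => Q N (v \o t)); split; first exact: fml_rename.
by move=> N g v; rewrite hQ; congr (Q N _); apply/funext => -[].
Qed.

Lemma pfml_const (I K : finType) (d : K -> C) (P : pred (I + K)%type) : pfml P ->
  pfml (fun N g (v : I -> N) => P N g (sumv v (g \o d))).
Proof.
move=> [J [c [Q [fQ hQ]]]]; exists (K + J)%type, (sumv d c).
pose t (x : (I + K) + J) : I + (K + J) :=
  match x with
  | inl (inl i) => inl i | inl (inr k) => inr (inl k) | inr j => inr (inr j)
  end.
exists (fun N v => Q N (v \o t)); split; first exact: fml_rename.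
by move=> N g v; rewrite hQ; congr (Q N _); apply/funext => -[[]|].
Qed.

Lemma pfml_comp (I : finType) (u : R -> R) (P : pred I) :
  continuous u -> pfml P -> pfml (fun N g v => u (P N g v)).
Proof.
move=> cu [J [c [Q [fQ hQ]]]]; exists J, c, (fun N v => u (Q N v)).
by split => [|N g v]; [exact: fml_comp|rewrite hQ].
Qed.

Lemma pfml_comp2 (I : finType) (u : R * R -> R) (P Q : pred I) :
  continuous u -> pfml P -> pfml Q -> pfml (fun N g v => u (P N g v, Q N g v)).
Proof.
move=> cu [J [c [P0 [fP hP]]]] [K [d [Q0 [fQ hQ]]]].
exists (J + K)%type, (sumv c d).
pose s (x : I + J) : I + (J + K) :=
  match x with inl i => inl i | inr j => inr (inl j) end.
pose t (x : I + K) : I + (J + K) :=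
  match x with inl i => inl i | inr j => inr (inr j) end.
exists (fun N v => u (P0 N (v \o s), Q0 N (v \o t))); split.
  by apply: (fml_comp2 cu); exact: fml_rename.
move=> N g v; rewrite hP hQ; congr (u (P0 N _, Q0 N _)).
  by apply/funext => -[].
by apply/funext => -[].
Qed.

Lemma pfml_cst (I : finType) (a : R) : pfml (fun N (g : C -> N) (v : I -> N) => a).
Proof. exact/pfml_fml/fml_cst. Qed.

Lemma pfml_dist (I : finType) (i j : I) :
  pfml (fun N (g : C -> N) (v : I -> N) => mdist (v i) (v j)).
Proof. exact/pfml_fml/fml_dist. Qed.

Lemma pfml_affine (I : finType) (a b : R) (P : pred I) :
  pfml P -> pfml (fun N g v => a * P N g v + b).
Proof.
apply: (@pfml_comp I (fun x => a * x + b)) => x.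
by apply: cvgD; [apply: cvgM => //; exact: cvg_cst|exact: cvg_cst].
Qed.

Lemma pfml_max (I : finType) (P Q : pred I) :
  pfml P -> pfml Q -> pfml (fun N g v => Num.max (P N g v) (Q N g v)).
Proof.
apply: (@pfml_comp2 I (fun x => Num.max x.1 x.2)) => x.
by apply: continuous_max; [exact: cvg_fst|exact: cvg_snd].
Qed.

Lemma pfml_min (I : finType) (P Q : pred I) :
  pfml P -> pfml Q -> pfml (fun N g v => Num.min (P N g v) (Q N g v)).
Proof.
apply: (@pfml_comp2 I (fun x => Num.min x.1 x.2)) => x.
by apply: continuous_min; [exact: cvg_fst|exact: cvg_snd].
Qed.

Lemma pfml_bigmax (I K : finType) (a : R) (P : K -> pred I) :
  (forall k, pfml (P k)) -> pfml (fun N g v => \big[Num.max/a]_k P k N g v).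
Proof.
move=> hP; elim: (index_enum K) => [|k r IH].
  by apply: pfml_ext (pfml_cst I a) => N g v; rewrite big_nil.
by apply: pfml_ext (pfml_max (hP k) IH) => N g v; rewrite big_cons.
Qed.

Lemma pfml_inf (I K : finType) (P : pred (I + K)%type) : pfml P ->
  exists Q : pred I, [/\ pfml Q,
    forall N g v w, Q N g v <= P N g (sumv v w) &
    forall N g v e, 0 < e -> exists w, P N g (sumv v w) < Q N g v + e].
Proof.
move=> [J [c [P0 [fP hP]]]].
pose s (x : (I + K) + J) : (I + J) + K :=
  match x with
  | inl (inl i) => inl (inl i) | inl (inr k) => inr k | inr j => inl (inr j)
  end.
have [Q [fQ Q1 Q2]] := fml_inf (fml_rename s fP).
have e N (g : C -> N) v w :
    sumv (sumv v (g \o c)) w \o s = sumv (sumv v w) (g \o c).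
  by apply/funext => -[[]|].
exists (fun N g v => Q N (sumv v (g \o c))); split => [|N g v w|N g v d d0].
- by exists J, c, Q.
- by rewrite hP -e.
- by have [w hw] := Q2 N (sumv v (g \o c)) d d0; exists w; rewrite hP -e.
Qed.

Lemma pfml_unif_cont (I : finType) (P : pred I) (e : R) :
  pfml P -> 0 < e -> exists2 d : R, 0 < d & forall N (g : C -> N) (v w : I -> N),
    (forall i, mdist (v i) (w i) < d) -> `|P N g v - P N g w| <= e.
Proof.
move=> [J [c [Q [fQ hQ]]]] e0; have [d d0 hd] := fml_unif_cont fQ e0.
exists d => // N g v w vw; rewrite !hQ; apply: hd => -[i|j] //=.
by rewrite mdistxx.
Qed.

(** [elementary_over] and [elementary_embedding] are the cases where the second interpretation is
    [val] and [id]; a common notion allows them to be composed and reversed. *)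
Definition elem_equiv N1 N2 (g1 : C -> N1) (g2 : C -> N2) :=
  forall (J : finType) (P : forall N, (J -> N) -> R), fml P ->
    forall c : J -> C, P N1 (g1 \o c) = P N2 (g2 \o c).

Lemma elem_equivC N1 N2 (g1 : C -> N1) (g2 : C -> N2) : elem_equiv g1 g2 -> elem_equiv g2 g1.
Proof. by move=> h J P fP c; rewrite (h _ _ fP). Qed.

Lemma elem_equiv_trans N1 N2 N3 (g1 : C -> N1) (g2 : C -> N2) (g3 : C -> N3) :
  elem_equiv g1 g2 -> elem_equiv g2 g3 -> elem_equiv g1 g3.
Proof. by move=> h h' J P fP c; rewrite (h _ _ fP) (h' _ _ fP). Qed.

(** Solvability of [P < r] amounts to [inf P < r], and [inf P] has no free variables left, so that
    its value is the same in both structures. A bound [<=] would not transfer, as the infimum need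
    not be attained. *)
Lemma transfer N1 N2 (g1 : C -> N1) (g2 : C -> N2) (K : finType) (P : pred K)
    (r : R) (w1 : K -> N1) : elem_equiv g1 g2 -> pfml P -> P N1 g1 w1 < r ->
  exists w2 : K -> N2, P N2 g2 w2 < r.
Proof.
move=> e12 fP h1.
have [Q [[J [c [Q0 [fQ hQ]]]] Q1 Q2]] := pfml_inf (@pfml_rename K (void + K)%type inr _ fP).
have hs N (v : void -> N) (w : K -> N) : sumv v w \o inr = w by [].
pose s (x : void + J) : J := match x with inl y => of_void J y | inr j => j end.
have hv N (g : C -> N) v : Q N g v = Q0 N ((g \o c) \o s).
  by rewrite hQ; congr (Q0 N _); apply/funext => -[[]|].
have v1 : void -> N1 by case.
have v2 : void -> N2 by case.
have lt : Q N2 g2 v2 < r.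
  rewrite (hv _ _ v2) -(e12 _ _ (fml_rename s fQ) c) -(hv _ _ v1).
  exact: le_lt_trans (Q1 N1 g1 v1 w1) h1.
have [|w hw] := Q2 N2 g2 v2 (r - Q N2 g2 v2); first by rewrite subr_gt0.
by exists w; move: hw; rewrite addrC subrK.
Qed.

End Closure.

Lemma pfml_reindex (C C' : Type) (h : C -> C') (I : finType)
    (P : forall N, (C -> N) -> (I -> N) -> R) : pfml P ->
  pfml (fun N (g : C' -> N) v => P N (g \o h) v).
Proof. by move=> [J [c [Q [fQ hQ]]]]; exists J, (h \o c), Q; split. Qed.

Lemma elem_equiv_reindex (C C' : Type) (h : C -> C') N1 N2
    (g1 : C' -> N1) (g2 : C' -> N2) : elem_equiv g1 g2 -> elem_equiv (g1 \o h) (g2 \o h).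
Proof. by move=> e J P fP c; have := e J P fP (h \o c). Qed.

Lemma pfml_tp M (A : set M) n (th : pformula A n) :
  pfml (fun N (g : A -> N) (v : 'I_n -> N) => tp g (\row_i v i) th).
Proof.
exists 'I_(nparams th), (params th ord0).
exists (fun N (v : 'I_n + 'I_(nparams th) -> N) =>
  formula_eval (pform th) (\row_k v (fintype.split k))); split.
  exact: (fml_rename (@fintype.split n (nparams th)) (fml_eval (pform th))).
move=> N g v; rewrite /tp; congr formula_eval; apply/rowP => k; rewrite !mxE.
by case: fintype.split => j; rewrite ?mxE.
Qed.

Lemma pfml_pformula M (A : set M) n
    (P : forall N, (A -> N) -> ('I_n -> N) -> R) : pfml P ->
  exists th : pformula A n, forall N g b, tp g b th = P N g (b ord0).
Proof.
move=> [J [c [Q [[phi hphi] hQ]]]].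
pose s (k : 'I_#|{: 'I_n + J}|) : 'I_(n + #|J|) :=
  match enum_val k with inl i => lshift _ i | inr j => rshift n (enum_rank j) end.
exists (PFormula (formula_rename phi s) (\row_k c (enum_val k))) => N g b.
rewrite /tp formula_renameE hQ hphi; congr formula_eval; apply/rowP => k.
rewrite [LHS]mxE [RHS]mxE /s; case: (enum_val k) => [i|j] /=.
  by rewrite row_mxEl.
by rewrite row_mxEr !mxE enum_rankK.
Qed.

Lemma elementary_over_equiv M (A : set M) N (g : A -> N) :
  elementary_over g <-> elem_equiv g val.
Proof.
split=> [eg J P [phi hphi] c|eg n phi a].
  have e N' (h : A -> N') : \row_k (h \o c) (enum_val k) =
      map_mx h (\row_(k < #|J|) c (enum_val k)).
    by apply/rowP => k; rewrite !mxE.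
  by rewrite !hphi !e; exact: eg.
have e N' (h : A -> N') : map_mx h a = \row_k (h \o a ord0) k.
  by apply/rowP => k; rewrite !mxE.
by rewrite !e; exact: eg _ _ (fml_eval phi) (a ord0).
Qed.

Lemma elementary_embedding_equiv M N (f : M -> N) :
  elementary_embedding f <-> elem_equiv f id.
Proof.
split=> [ef J P [phi hphi] c|ef n phi a].
  have e N' (h : M -> N') : \row_k (h \o c) (enum_val k) =
      map_mx h (\row_(k < #|J|) c (enum_val k)).
    by apply/rowP => k; rewrite !mxE.
  by rewrite !hphi !e ef map_mx_id.
have e N' (h : M -> N') : map_mx h a = \row_k (h \o a ord0) k.
  by apply/rowP => k; rewrite !mxE.
have := ef _ _ (fml_eval phi) (a ord0).
by rewrite -(e M id) -(e N f) map_mx_id.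
Qed.

End ParametricPredicates.

Section LosPredicates.
Context {R : realType} {L : signature R} {I : Type} {U : set_system I}.
Variables (UU : UltraFilter U) (N_ : I -> structure L).

Lemma Los_fml (J : finType) (P : forall N : structure L, (J -> N) -> R)
    (v : J -> usection N_) : fml P ->
  P _ (fun j => uclass_of UU (v j)) = ulim U (fun i => P (N_ i) (fun j => v j i)).
Proof.
move=> [phi hphi]; rewrite hphi (Los UU phi (fun k => v (enum_val k))).
by congr (ulim U _); apply: functional_extensionality_dep => i; rewrite hphi.
Qed.

Lemma Los_pfml (C : Type) (J : finType)
    (P : forall N : structure L, (C -> N) -> (J -> N) -> R)
    (g : C -> usection N_) (v : J -> usection N_) : pfml P ->
  P _ (fun c => uclass_of UU (g c)) (fun j => uclass_of UU (v j)) =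
    ulim U (fun i => P (N_ i) (fun c => g c i) (fun j => v j i)).
Proof.
move=> [K [c [Q [fQ hQ]]]]; rewrite hQ.
have -> : sumv (fun j => uclass_of UU (v j))
    ((fun c => uclass_of UU (g c)) \o c) =
    fun s => uclass_of UU (sumv v (g \o c) s) by apply/funext => -[].
rewrite (Los_fml _ fQ); congr (ulim U _).
apply: functional_extensionality_dep => i; rewrite hQ; congr (Q _ _).
by apply/funext => -[].
Qed.

End LosPredicates.

(** * Type spaces *)

Section Types.
Context {R : realType} {L : signature R}.
Implicit Types M N : structure L.

Section Basics.
Variables (M : structure L) (A : set M) (n : nat).
Local Notation S := (types A n).

Lemma type_ofP N (g : A -> N) (eg : elementary_over g) (b : 'rV[N]_n) :
  exists N' (g' : A -> N') (b' : 'rV[N']_n),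
    elementary_over g' /\ tp g b = tp g' b'.
Proof. by exists N, g, b. Qed.

Definition type_of N (g : A -> N) (eg : elementary_over g) (b : 'rV[N]_n) : S :=
  exist (fun p => p \in _) (tp g b) (mem_set (type_ofP eg b)).

Lemma type_ofE N (g : A -> N) (eg : elementary_over g) (b : 'rV[N]_n) :
  val (type_of eg b) = tp g b.
Proof. by []. Qed.

Lemma typeP (p : S) :
  exists N (g : A -> N) (eg : elementary_over g) b, p = type_of eg b.
Proof.
case: p => p pP; have [N [g [b [eg e]]]] := set_mem pP.
by exists N, g, eg, b; apply: val_inj.
Qed.

Lemma realizationsE N (g : A -> N) (eg : elementary_over g) (X : set S) b :
  realizations X g b <-> X (type_of eg b).
Proof.
split=> [[p Xp pb]|Xb]; last by exists (type_of eg b).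
by have <- : p = type_of eg b by apply: val_inj.
Qed.

Lemma pformula_continuous (th : pformula A n) : continuous (fun p : S => val p th).
Proof.
move=> p B /= hB; have h1 : continuous (fun q : S => val q).
  exact: initial_continuous.
have h2 : continuous (fun q : prod_topology (fun _ : pformula A n => R) => q th).
  exact: (@proj_continuous {classic (pformula A n)} (fun=> R) th).
exact: h1 _ _ (h2 _ _ hB).
Qed.

Lemma types_cvg (F : set_system S) (q : S) : Filter F ->
  (forall th, (fun p : S => val p th) @ F --> val q th) -> F --> q.
Proof.
move=> FF h.
have hv : (fun p : S => val p) @ F -->
    (val q : prod_topology (fun _ : pformula A n => R)).
  apply/cvg_sup => th C [_ [[D oD <-] Dq] sDC].
  have FD : F (fun p : S => D (val p th)).
    by apply: (h th D); exact: open_nbhs_nbhs.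
  by apply: filterS FD => p; exact: sDC.
move=> B [_ [[D oD <-] Dq] sDB].
have FD : F (fun p : S => D (val p)) by apply: (hv D); exact: open_nbhs_nbhs.
by apply: filterS FD => p; exact: sDB.
Qed.

Lemma tp_ubounded (I : Type) (th : pformula A n) (N_ : I -> structure L)
    (g : forall i, A -> N_ i) (b : forall i, 'rV[N_ i]_n) :
  ubounded (fun i => tp (g i) (b i) th).
Proof.
by have [B hB] := formula_bounded (pform th); exists B => i; exact: hB.
Qed.

(** An ultrafilter on the type space is itself the index of an ultraproduct of models realizing the
    types. The class of the chosen realizations realizes the limit. *)
Lemma types_compact : compact [set: S].
Proof.
rewrite compact_ultra => F UF _.
have h (p : S) : exists N (gb : (A -> N) * 'rV[N]_n),
    elementary_over gb.1 /\ val p = tp gb.1 gb.2.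
  by case: p => p pP; have [N [g [b [eg e]]]] := set_mem pP; exists N, (g, b).
have [N_ hN] := choice h.
have [gb hgb] := dependent_choice_fun hN.
pose g (a : A) : ultraproduct UF N_ := uclass_of UF (fun p => (gb p).1 a).
pose b : 'rV[ultraproduct UF N_]_n :=
  \row_i uclass_of UF (fun p => (gb p).2 ord0 i).
have eg : elementary_over g.
  apply/elementary_over_equiv => J P fP c.
  rewrite (Los_fml UF (fun j p => (gb p).1 (c j)) fP); apply: ulim_eqP.
    by have [B hB] := fml_bounded fP; exists B.
  move=> e e0; apply: filterE => p /=.
  have := (elementary_over_equiv (gb p).1).1 (hgb p).1 J P fP c.
  by move=> <-; rewrite subrr normr0 ltW.
exists (type_of eg b); split => //; apply: types_cvg => th.
have -> : val (type_of eg b) th = ulim F (fun p : S => val p th).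
  have := Los_pfml UF (fun a p => (gb p).1 a) (fun i p => (gb p).2 ord0 i) (pfml_tp th).
  rewrite /= => ->; congr (ulim F _); apply/funext => p.
  rewrite (hgb p).2; congr (tp _ _ th); apply/rowP => i; rewrite mxE.
  by [].
apply: ulim_cvg.
have [B hB] := formula_bounded (pform th); exists B => p.
by have [N [g' [eg' [b' ->]]]] := typeP p; exact: hB.
Qed.

End Basics.

(** The sets whose removal from [K] leaves a set with property [P] form a filter. If [P K] failed,
    it would be proper, and a cluster point in [K] would have a neighbourhood whose complement is in
    the filter. *)
Lemma compact_local (T : topologicalType) (K : set T) (P : set T -> Prop) :
  compact K -> P set0 -> (forall A B, P A -> P B -> P (A `|` B)) ->
  (forall A B, A `<=` B -> P B -> P A) ->
  (forall x, K x -> exists2 V, nbhs x V & P V) -> P K.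
Proof.
move=> cK P0 PU Psub Ploc; apply: contrapT => nPK.
pose F : set_system T := [set B | P (K `\` B)].
have FF : ProperFilter F.
  apply: Build_ProperFilter_ex.
    move=> B FB; apply: contrapT => nB; apply: nPK.
    apply: Psub FB => x Kx; split => // Bx; apply: nB; by exists x.
  split; rewrite /F /=.
  - by rewrite setDT.
  - move=> B C PB PC; apply: Psub (PU _ _ PB PC) => x [Kx nBC].
    have [Bx|] := pselect (B x); last by left.
    by right; split => // Cx; exact: nBC.
  - by move=> B C BC; apply: Psub => x [Kx nCx]; split => // /BC.
have FK : F K by rewrite /F /= setDv.
have [x [Kx clx]] := cK F FF FK.
have [V xV PV] := Ploc x Kx.
have FV : F (~` V) by rewrite /F /= setDE setCK; apply: Psub PV; exact: subIsetr.
by have [y []] := clx _ _ FV xV.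
Qed.

(** * Separation of closed sets of types by formulas *)

Section Separation.
Variables (M : structure L) (A : set M) (n : nat).
Local Notation S := (types A n).

Lemma type_neq (p q : S) : p <> q -> exists th, val p th <> val q th.
Proof.
move=> pq; apply: contrapT => h; apply: pq; apply: val_inj; apply/funext => th.
by apply: contrapT => e; apply: h; exists th.
Qed.

Lemma pformula_affine (a b : R) (th : pformula A n) :
  exists th' : pformula A n, forall p : S, val p th' = a * val p th + b.
Proof.
have [th' h] := pfml_pformula (pfml_affine a b (pfml_tp th)).
exists th' => p; have [N [g [eg [c ->]]]] := typeP p; rewrite !type_ofE h.
by congr (a * tp g _ th + b); apply/rowP => i; rewrite mxE.
Qed.

Lemma pformula_max (th1 th2 : pformula A n) :
  exists th : pformula A n, forall p : S,
    val p th = Num.max (val p th1) (val p th2).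
Proof.
have [th' h] := pfml_pformula (pfml_max (pfml_tp th1) (pfml_tp th2)).
exists th' => p; have [N [g [eg [c ->]]]] := typeP p; rewrite !type_ofE h.
have -> : \row_i c ord0 i = c by apply/rowP => i; rewrite mxE.
by [].
Qed.

Lemma pformula_min (th1 th2 : pformula A n) :
  exists th : pformula A n, forall p : S,
    val p th = Num.min (val p th1) (val p th2).
Proof.
have [th' h] := pfml_pformula (pfml_min (pfml_tp th1) (pfml_tp th2)).
exists th' => p; have [N [g [eg [c ->]]]] := typeP p; rewrite !type_ofE h.
have -> : \row_i c ord0 i = c by apply/rowP => i; rewrite mxE.
by [].
Qed.

Lemma pformula_cst (a : R) : exists th : pformula A n, forall p : S, val p th = a.
Proof.
have [th' h] := pfml_pformula (pfml_cst A 'I_n a).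
by exists th' => p; have [N [g [eg [c ->]]]] := typeP p; rewrite !type_ofE h.
Qed.

(** The values lie strictly beyond 0 and 1, so that the bounds 0 and 1 persist on neighbourhoods. *)
Lemma separate_points (p q : S) : p <> q ->
  exists th : pformula A n, val p th = -1 /\ val q th = 2.
Proof.
move=> /type_neq[th h]; pose d := val q th - val p th.
have d0 : d != 0 by rewrite subr_eq0; apply/eqP => /esym.
have [th' h'] := pformula_affine (3 / d) (- 1 - 3 / d * val p th) th.
exists th'; rewrite !h'; split; first by ring.
have -> : val q th = val p th + d by rewrite /d; ring.
by field.
Qed.

Lemma open_eval_lt (th : pformula A n) r : open [set p : S | val p th < r].
Proof.
have := @open_comp _ _ (fun p : S => val p th) [set x | x < r].
by apply; [move=> p _; exact: pformula_continuous|exact: open_lt].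
Qed.

Lemma open_eval_gt (th : pformula A n) r : open [set p : S | r < val p th].
Proof.
have := @open_comp _ _ (fun p : S => val p th) [set x | r < x].
by apply; [move=> p _; exact: pformula_continuous|exact: open_gt].
Qed.

Lemma closed_eval_le (th : pformula A n) r : closed [set p : S | val p th <= r].
Proof.
have -> : [set p : S | val p th <= r] = ~` [set p : S | r < val p th].
  by apply/seteqP; split => p /=; rewrite leNgt => /negP.
by apply: open_closedC; exact: open_eval_gt.
Qed.

Lemma closed_compact (F : set S) : closed F -> compact F.
Proof. by move=> cF; exact: (subclosed_compact cF (@types_compact M A n)). Qed.

(** Compactness is used twice: maxima of formulas over a cover of [G] for a fixed point of [F], then
    minima over a cover of [F]. Both operations stay within formulas, so a single one results. *)
Lemma separate_closed (F G : set S) : closed F -> closed G -> F `&` G = set0 ->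
  exists th : pformula A n, (forall p, F p -> val p th <= 0) /\
    (forall p, G p -> 1 <= val p th).
Proof.
move=> cF cG FG0.
apply: (@compact_local _ F (fun V => exists th : pformula A n,
  (forall p, V p -> val p th <= 0) /\ (forall p, G p -> 1 <= val p th))).
- exact: closed_compact.
- by have [th h] := pformula_cst 1; exists th; split => // p _; rewrite h.
- move=> V W [th1 [h1 h1']] [th2 [h2 h2']].
  have [th h] := pformula_min th1 th2; exists th; split => p.
    by rewrite h ge_min => -[/h1 ->|/h2 ->] //; rewrite orbT.
  by move=> Gp; rewrite h le_min h1' ?h2'.
- by move=> V W VW [th [h h']]; exists th; split => // p /VW; exact: h.
move=> p Fp.
suff [th [h h']] : exists th : pformula A n,
    val p th < 0 /\ (forall q, G q -> 1 <= val q th).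
  exists [set q | val q th < 0]; last by exists th; split => // q /ltW.
  by apply: open_nbhs_nbhs; split => //; exact: open_eval_lt.
apply: (@compact_local _ G (fun V => exists th : pformula A n,
  val p th < 0 /\ (forall q, V q -> 1 <= val q th))).
- exact: closed_compact.
- by have [th h] := pformula_cst (-1); exists th; rewrite h; split => //; lra.
- move=> V W [th1 [h1 h1']] [th2 [h2 h2']].
  have [th h] := pformula_max th1 th2; exists th; split => [|q].
    by rewrite h gt_max h1.
  by rewrite h le_max => -[/h1' ->|/h2' ->] //; rewrite orbT.
- by move=> V W VW [th [h h']]; exists th; split => // q /VW; exact: h'.
move=> q Gq.
have pq : p <> q.
  move=> pq; have : (F `&` G) p by split => //; rewrite pq.
  by rewrite FG0.
have [th [h h']] := separate_points pq.
exists [set q | 1 < val q th]; last by exists th; rewrite h; split => [|r /ltW] //; lra.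
by apply: open_nbhs_nbhs; split; [exact: open_eval_gt|rewrite /= h'; lra].
Qed.

End Separation.

End Types.

(** * Definable sets *)

Section Ultrapower.
Context {R : realType} {L : signature R} {I : Type} {U : set_system I}.
Variables (UU : UltraFilter U) (M : structure L).

Definition ultrapower : structure L := ultraproduct UU (fun _ : I => M).

Definition diag (x : M) : ultrapower := uclass_of UU (fun _ => x).

Lemma ulim_cst (a : R) : ulim U (fun _ => a) = a.
Proof. by apply: ulimP; exact: cvg_cst. Qed.

Lemma diag_elem_equiv : elem_equiv diag id.
Proof.
by move=> J P fP c; rewrite (Los_fml UU (fun j _ => c j) fP) ulim_cst.
Qed.

Lemma diag_elementary : elementary_embedding diag.
Proof. exact/elementary_embedding_equiv/diag_elem_equiv. Qed.

End Ultrapower.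

(** * Approximating types in a model and realizing them in its ultrapowers *)

Section Realization.
Context {R : realType} {L : signature R}.
Variables (M : structure L) (A : set M) (n : nat).
Local Notation S := (types A n).

Lemma elementary_val : elementary_over (val : A -> M).
Proof. by []. Qed.

Lemma elementary_over_embedding (N : structure L) (f : M -> N) :
  elementary_embedding f -> elementary_over (f \o (val : A -> M)).
Proof.
move=> /elementary_embedding_equiv ef; apply/elementary_over_equiv.
exact: (elem_equiv_reindex (val : A -> M) ef).
Qed.

Lemma closed_point (p : S) : closed [set p].
Proof.
have -> : [set p] = \bigcap_(th in [set: pformula A n])
    ([set q : S | val q th <= val p th] `&` ~` [set q | val q th < val p th]).
  apply/seteqP; split => [q -> th _|q h].
    by split => /=; rewrite ?lexx// ltxx.
  apply: val_inj; apply/funext => th; have [/= h1 /negP h2] := h th I.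
  by apply/eqP; rewrite eq_le h1 leNgt.
apply: closed_bigI => th _; apply: closedI; first exact: closed_eval_le.
by apply: open_closedC; exact: open_eval_lt.
Qed.

Lemma separate_nbhs (p : S) (V : set S) : nbhs p V ->
  exists th : pformula A n, val p th <= 0 /\ forall q, val q th < 1 -> V q.
Proof.
rewrite nbhsE => -[W [oW Wp] WV].
have [|th [h1 h2]] := separate_closed (@closed_point p) (open_closedC oW).
  by apply/seteqP; split => // q [/= -> ].
exists th; split; first exact: h1.
move=> q qth; apply: WV; apply: contrapT => /h2.
by rewrite leNgt qth.
Qed.

Lemma separate_point (D : set S) (p : S) : closed D -> ~ D p ->
  exists th : pformula A n, (forall q, D q -> val q th <= 0) /\ 1 <= val p th.
Proof.
move=> cD Dp; have [|th [h1 h2]] := separate_closed cD (@closed_point p).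
  by apply/seteqP; split => // q [/= + qp]; rewrite qp.
by exists th; split => //; exact: h2.
Qed.

(** An open condition satisfied in some model containing [A] transfers to [M] itself. *)
Lemma types_dense (p : S) (V : set S) : nbhs p V ->
  exists b : 'rV[M]_n, V (type_of elementary_val b).
Proof.
move=> /separate_nbhs[th [h1 h2]].
have [N [g [eg [c pE]]]] := typeP p.
have e : elem_equiv g (val : A -> M) by exact/elementary_over_equiv.
have [|w hw] := transfer (w1 := c ord0) (r := 1) e (pfml_tp th).
  have -> : \row_i c ord0 i = c by apply/rowP => i; rewrite mxE.
  by rewrite -(type_ofE eg) -pE (le_lt_trans h1).
by exists (\row_i w i); apply: h2.
Qed.

Lemma Los_tp (I : Type) (U : set_system I) (UU : UltraFilter U)
    (g : A -> I -> M) (b : I -> 'rV[M]_n) (th : pformula A n) :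
  tp (fun a => uclass_of UU (g a) : ultrapower UU M)
     (\row_k uclass_of UU (fun i => b i ord0 k)) th =
  ulim U (fun i => tp (fun a => g a i) (b i) th).
Proof.
have := Los_pfml UU g (fun k i => b i ord0 k) (pfml_tp th).
rewrite /= => ->; congr (ulim U _); apply/funext => i.
by congr (tp _ _ th); apply/rowP => k; rewrite mxE.
Qed.

Lemma type_cvg_tp (I : Type) (U : set_system I) (UU : UltraFilter U)
    (b : I -> 'rV[M]_n) (p : S) :
  (fun i => type_of elementary_val (b i)) @ U --> p ->
  tp (@diag _ _ _ _ UU M \o val) (\row_k uclass_of UU (fun i => b i ord0 k)) =
    val p.
Proof.
move=> bp; apply/funext => th; rewrite (Los_tp UU (fun a _ => val a)).
apply: ulimP.
have h := @pformula_continuous R L M A n th p.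
exact: cvg_trans (cvg_app _ bp) h.
Qed.

(** Approximations of [p] and of [q] inside [M] are indexed by one ultrafilter on pairs of tuples,
    so a single ultrapower of [M] realizes both. Hence the infimum in [type_dist] is over a nonempty
    set. *)
Lemma joint_realization (p q : S) :
  exists (N : structure L) (g : A -> N) (a b : 'rV[N]_n),
    [/\ elementary_over g, val p = tp g a & val q = tp g b].
Proof.
pose ty (b : 'rV[M]_n) : S := type_of elementary_val b.
pose F (r : S) : set_system 'rV[M]_n := filter_from (nbhs r) (fun V => ty @^-1` V).
have FF r : ProperFilter (F r).
  apply: filter_from_proper => [|V /types_dense[b Vb]]; last by exists b.
  apply: filter_from_filter; first by exists setT; exact: filterT.
  by move=> V W rV rW; exists (V `&` W) => //; exact: filterI.
have [U [UU FU]] := ultraFilterLemma (@filter_prod_proper _ _ (F p) (F q) _ _).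
have hp : (fun i => ty i.1) @ U --> p.
  move=> V pV; apply: FU; exists (ty @^-1` V, setT); last by move=> [? ?] [].
  by split; [exists V|exact: filterT].
have hq : (fun i => ty i.2) @ U --> q.
  move=> V qV; apply: FU; exists (setT, ty @^-1` V); last by move=> [? ?] [].
  by split; [exact: filterT|exists V].
exists (ultrapower UU M), (@diag _ _ _ _ UU M \o val).
exists (\row_k uclass_of UU (fun i => i.1 ord0 k)).
exists (\row_k uclass_of UU (fun i => i.2 ord0 k)).
split; first exact/elementary_over_embedding/diag_elementary.
  exact/esym/type_cvg_tp.
exact/esym/type_cvg_tp.
Qed.

End Realization.

(** * Definability as a first-order scheme *)

Section Schemes.
Context {R : realType} {L : signature R}.
Implicit Types M N : structure L.

Section General.
Variables (C : Type) (n : nat).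
Variable chi : nat -> forall N, (C -> N) -> ('I_n -> N) -> R.
Arguments chi : clear implicits.
Hypothesis fchi : forall l, pfml (chi l).

(* A first-order property of [chi], hence independent of the structure, which
   by completeness amounts to the definability of the set of common zeros. *)
Definition scheme N (g : C -> N) := forall j l x, chi j N g x < 1 ->
  forall eta, 0 < eta -> exists y,
    (forall i, mdist (x i) (y i) < 2^-1 ^+ j + eta) /\ chi l N g y < eta.

(** [Q] is [inf_y max (d (x, y) - 2^-j, chi_l y)]. It turns the conclusion of [scheme] into the
    inequality [Q < eta], with the same [Q] for every [eta]. *)
Lemma near_approx_pfml j l :
  exists Q : forall N, (C -> N) -> ('I_n -> N) -> R, pfml Q /\
    forall N g x eta, 0 < eta -> (Q N g x < eta <-> exists y,
    (forall i, mdist (x i) (y i) < 2^-1 ^+ j + eta) /\ chi l N g y < eta).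
Proof.
pose P N (g : C -> N) (v : 'I_n + 'I_n -> N) : R :=
  Num.max (1 * (\big[Num.max/0]_i mdist (v (inl i)) (v (inr i))) + - 2^-1 ^+ j)
    (chi l N g (v \o inr)).
have fP : pfml P.
  apply: pfml_max; last exact: (pfml_rename inr (fchi l)).
  by apply: pfml_affine; apply: pfml_bigmax => i; exact: pfml_dist.
have PE N g x y eta : 0 < eta -> (P N g (sumv x y) < eta <->
    (forall i, mdist (x i) (y i) < 2^-1 ^+ j + eta) /\ chi l N g y < eta).
  move=> e0; rewrite /P gt_max mul1r ltrBlDl; split.
    move=> /andP[h1 h2]; split => // i; apply: le_lt_trans h1.
    exact: (le_bigmax _ (fun i => mdist (x i) (y i))).
  move=> [h1 ->]; rewrite andbT; apply: bigmax_lt => [|i _]; last exact: h1.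
  by rewrite addr_gt0// pow2_gt0.
have [Q [fQ Q1 Q2]] := pfml_inf fP.
exists Q; split; first exact: fQ.
move=> N g x eta e0; split => [h|[y hy]]; last first.
  by apply: le_lt_trans (Q1 N g x y) _; exact: (PE N g x y eta e0).2 hy.
have [|y hy] := Q2 N g x (eta - Q N g x); first by rewrite subr_gt0.
exists y; apply: (PE N g x y eta e0).1.
by move: hy; rewrite addrC subrK.
Qed.

Lemma scheme_transfer N1 N2 (g1 : C -> N1) (g2 : C -> N2) :
  elem_equiv g1 g2 -> scheme g1 -> scheme g2.
Proof.
move=> e12 s1 j l x xj eta e0.
have [Q [fQ hQ]] := near_approx_pfml j l.
apply/(hQ N2 g2 x eta e0); rewrite ltNge; apply/negP => hx.
(* The failure [Q >= eta] is relaxed to the open condition [Q > eta / 2], which transfers and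
   contradicts the scheme in [N1] at [eta / 2]. *)
have e20 : 0 < eta / 2 by lra.
have [|x' hx'] := transfer (elem_equivC e12) (K := 'I_n) (r := 0) (w1 := x)
  (pfml_max (pfml_affine 1 (-1) (fchi j)) (pfml_affine (-1) (eta / 2) fQ)).
  by rewrite gt_max; apply/andP; split; lra.
move: hx'; rewrite gt_max => /andP[h1 h2].
have /(s1 j l x')/(_ _ e20)/(hQ N1 g1 x' _ e20) : chi j N1 g1 x' < 1 by lra.
by lra.
Qed.

(** The scheme is iterated with [eta = 2^-(j+k)]: the steps have length at most [2 * 2^-(j+k)] and
    add up to [4 * 2^-j]. The limit exists because structures are complete. *)
Lemma scheme_near N (g : C -> N) j x : scheme g -> chi j N g x < 1 ->
  exists y, (forall i, mdist (x i) (y i) <= 4 * 2^-1 ^+ j) /\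
    forall l, chi l N g y <= 0.
Proof.
move=> sg xj.
have step (k : nat) (z : 'I_n -> N) : exists z' : 'I_n -> N,
    chi (j + k)%N N g z < 1 ->
    (forall i, mdist (z i) (z' i) <= 2 * 2^-1 ^+ (j + k)) /\
    chi (j + k.+1)%N N g z' < 1.
  have [h|h] := ltP (chi (j + k)%N N g z) 1; last by exists z.
  have [z' [h1 h2]] := sg _ (j + k.+1)%N _ h _ (pow2_gt0 R (j + k)).
  exists z' => _; split => [i|]; first by have := h1 i; lra.
  by apply: lt_le_trans h2 _; rewrite exprn_ile1; lra.
pose f k := projT1 (choice (step k)); have hf k := projT2 (choice (step k)).
pose s := fix s k := if k is k'.+1 then f k' (s k') else x.
have sP k : chi (j + k)%N N g (s k) < 1.
  elim: k => [|k IH]; first by rewrite addn0.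
  by have [] := hf k _ IH.
have sd k i : mdist (s k i) (s k.+1 i) <= 2 * 2^-1 ^+ (j + k).
  by have [] := hf k _ (sP k).
have sdm k m i : mdist (s k i) (s (k + m)%N i) <=
    4 * 2^-1 ^+ (j + k) - 4 * 2^-1 ^+ (j + (k + m)).
  elim: m => [|m IH]; first by rewrite addn0 mdistxx subrr.
  have := metric_triangle (s k i) (s (k + m)%N i) (s (k + m.+1)%N i).
  by have := sd (k + m)%N i; rewrite addnS [(j + (k + m).+1)%N]addnS exprS; lra.
have sdle k m i : (k <= m)%N -> mdist (s k i) (s m i) <= 4 * 2^-1 ^+ (j + k).
  move=> km; have := sdm k (m - k)%N i; rewrite subnKC//.
  by have := pow2_gt0 R (j + m); lra.
have lim i : exists y, forall e : R, 0 < e -> exists K, forall m, (K <= m)%N ->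
    mdist (s m i) y < e.
  apply: (@seq_complete _ _ N (fun k => s k i)) => e e0.
  have e80 : 0 < e / 8 by lra.
  have [K hK] := pow2_small e80; exists K => a b Ka Kb.
  have h1 := sdle _ _ i Ka; have h2 := sdle _ _ i Kb.
  rewrite metric_sym in h1; have h3 := metric_triangle (s a i) (s K i) (s b i).
  by have := pow2_le R (leq_addl j K); lra.
have [y hy] := choice lim.
have yd k i : mdist (s k i) (y i) <= 4 * 2^-1 ^+ (j + k).
  apply/ler_addgt0Pl => e e0; have [K hK] := hy i e e0.
  have := hK _ (leq_maxl K k); have := sdle _ _ i (leq_maxr K k).
  by have := metric_triangle (s k i) (s (maxn K k) i) (y i); lra.
exists y; split => [i|l]; first by have := yd 0%N i; rewrite addn0.
apply/ler_addgt0Pl => e e0; rewrite addr0.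
have e20 : 0 < e / 2 by lra.
have [d d0 hd] := pfml_unif_cont (fchi l) e20.
have m0 : 0 < Num.min (d / 8) (e / 2) by rewrite lt_min; apply/andP; split; lra.
have [k] := pow2_small m0; rewrite lt_min => /andP[k1 k2].
(* The sequence itself only satisfies [chi (j + k) < 1]. A separate point near its [k]-th term makes
   [chi l] small, and uniform continuity of [chi l] carries this over to [y]. *)
have [z [zd zl]] := sg _ l _ (sP k) _ m0.
have kj := pow2_le R (leq_addl j k).
have := hd N g y z; have zi i : mdist (y i) (z i) < d.
  have h1 := yd k i; have h2 := zd i.
  have h3 := metric_triangle (y i) (s k i) (z i).
  rewrite (metric_sym (y i) (s k i)) in h3.
  have : Num.min (d / 8) (e / 2) <= d / 8 by rewrite ge_min lexx.
  by lra.
move=> /(_ zi); rewrite ler_norml => /andP[h1 h2].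
have : Num.min (d / 8) (e / 2) <= e / 2 by rewrite ge_min lexx orbT.
by lra.
Qed.

End General.

Section Definable.
Variables (M : structure L) (A : set M) (n : nat).
Local Notation S := (types A n).

Definition eval_tp (th : pformula A n) N (g : A -> N) (v : 'I_n -> N) : R :=
  tp g (\row_i v i) th.

Lemma eval_tpE (th : pformula A n) N (g : A -> N) (b : 'rV[N]_n) :
  eval_tp th g (b ord0) = tp g b th.
Proof. by congr (tp g _ th); apply/rowP => i; rewrite mxE. Qed.

Definition tscheme (chi : nat -> pformula A n) N (g : A -> N) :=
  scheme (fun l => eval_tp (chi l)) g.

Lemma tscheme_transfer chi N1 N2 (g1 : A -> N1) (g2 : A -> N2) :
  elementary_over g1 -> elementary_over g2 -> tscheme chi g1 -> tscheme chi g2.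
Proof.
move=> /elementary_over_equiv e1 /elementary_over_equiv e2.
apply: scheme_transfer => [l|]; first exact: pfml_tp.
exact: elem_equiv_trans e1 (elem_equivC e2).
Qed.

Definition zeros (chi : nat -> pformula A n) : set S :=
  [set p | forall l, val p (chi l) <= 0].

Lemma zeros_closed chi : closed (zeros chi).
Proof.
have -> : zeros chi = \bigcap_(l in [set: nat]) [set p : S | val p (chi l) <= 0].
  by apply/seteqP; split => [p h l _|p h l]; [exact: h|exact: h l I].
by apply: closed_bigI => l _; exact: closed_eval_le.
Qed.

Lemma type_dist_le N (g : A -> N) (eg : elementary_over g) (a b : 'rV[N]_n) :
  type_dist (type_of eg a) (type_of eg b) <= tdist a b.
Proof.
apply: ge_inf; last by exists N, g, a, b.
by exists 0 => _ [N' [g' [a' [b' [_ _ _ ->]]]]]; exact: tdist_ge0.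
Qed.

Lemma type_dist_lt (p q : S) r : type_dist p q < r ->
  exists N (g : A -> N) (a b : 'rV[N]_n),
    [/\ elementary_over g, val p = tp g a, val q = tp g b & tdist a b < r].
Proof.
move=> pq.
have [N [g [a [b [eg pa qb]]]]] := joint_realization p q.
have [|_ [N' [g' [a' [b' [h1 h2 h3 ->]]]]] h4] := inf_lt _ pq.
  by exists (tdist a b), N, g, a, b.
by exists N', g', a', b'.
Qed.

Lemma thickeningP (D : set S) r p : thickening D r p <->
  exists2 q, D q & type_dist p q < r.
Proof.
rewrite /thickening /=; split=> [/ereal_inf_lt[_ [q Dq <-]]|[q Dq pq]].
  by rewrite lte_fin => h; exists q.
apply: le_lt_trans (_ : ((type_dist p q)%:E < r%:E)%E); last by rewrite lte_fin.
by apply: ereal_inf_lbound; exists q.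
Qed.

(** The scheme need be known in one model only, since it transfers. The open sets [chi j < 1] then
    lie within [4 * 2^-j] of the zeros by [scheme_near]. *)
Lemma scheme_definable chi N (g : A -> N) : elementary_over g ->
  tscheme chi g -> definable (zeros chi).
Proof.
move=> eg sg; split; first exact: zeros_closed.
move=> e e0; have e40 : 0 < e / 4 by lra.
have [j hj] := pow2_small e40.
exists [set p : S | val p (chi j) < 1]; split; first exact: open_eval_lt.
  by move=> p /(_ j) h /=; rewrite (le_lt_trans h).
move=> p /=; have [N' [g' [eg' [b ->]]]] := typeP p.
rewrite type_ofE -eval_tpE => hb.
have [|y [y1 y2]] := scheme_near _ (tscheme_transfer eg eg' sg) hb.
  by move=> l; exact: pfml_tp.
apply/thickeningP; exists (type_of eg' (\row_i y i)).
  by move=> l; rewrite type_ofE; exact: y2.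
apply: le_lt_trans (type_dist_le _ _ _) _; apply: tdist_ltP => // i.
by rewrite mxE; have := y1 i; lra.
Qed.

(** [chi l] is at most 0 on [D] and at least 1 outside an open set within [2^-l] of [D]. Distances
    between types are witnessed in some other model [N'], so the scheme is verified there and
    brought back by the formula of [near_approx_pfml]. *)
Lemma definable_scheme (D : set S) : definable D ->
  exists chi : nat -> pformula A n,
    (forall N (g : A -> N), elementary_over g -> tscheme chi g) /\
    D = zeros chi.
Proof.
move=> [cD hD].
have h (l : nat) : exists th : pformula A n, (forall p, D p -> val p th <= 0) /\
    (forall p, val p th < 1 -> exists2 q, D q & type_dist p q < 2^-1 ^+ l).
  have [V [oV DV VD]] := hD _ (pow2_gt0 R l).
  have [|th [h1 h2]] := separate_closed cD (open_closedC oV).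
    by apply/seteqP; split => // p [/= /DV].
  exists th; split => // p pth; apply/thickeningP/VD; apply: contrapT => /h2.
  by rewrite leNgt pth.
have [chi hchi] := choice h; exists chi; split.
  move=> N g eg j l x xj eta e0.
  have [Q [fQ hQ]] := near_approx_pfml (fun l => pfml_tp (chi l)) j l.
  apply/(hQ N g x eta e0).
  have [q Dq /type_dist_lt[N' [g' [a [b [eg' ha hb ab]]]]]] :=
    (hchi j).2 (type_of eg (\row_i x i)) xj.
  have [th hth] := pfml_pformula fQ.
  have -> : Q N g x = Q N' g' (a ord0).
    have <- : (\row_i x i) ord0 = x by apply/funext => i; rewrite mxE.
    by rewrite -!hth -ha.
  apply/(hQ N' g' _ _ e0); exists (b ord0); split => [i|].
    apply: le_lt_trans (mdist_le_tdist _ _ _) _.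
    by apply: lt_trans ab _; rewrite ltrDl.
  by have := (hchi l).1 q Dq; rewrite hb -eval_tpE => /le_lt_trans; apply.
apply/seteqP; split => [p Dp l|p hp]; first exact: (hchi l).1.
apply: contrapT => nDp.
have [th [h1 h2]] := separate_point cD nDp.
have [|d d0 hd] := pfml_unif_cont (e := 2^-1) (pfml_tp th) _.
  by rewrite invr_gt0.
have [l hl] := pow2_small d0.
have [|q Dq /type_dist_lt[N [g [a [b [eg ha hb ab]]]]]] := (hchi l).2 p.
  by apply: le_lt_trans (hp l) _.
have := hd N g (a ord0) (b ord0); have hab i : mdist (a ord0 i) (b ord0 i) < d.
  apply: le_lt_trans (mdist_le_tdist _ _ _) _; exact: lt_trans ab hl.
move=> /(_ hab).
have := eval_tpE th g a; have := eval_tpE th g b; rewrite /eval_tp => -> ->.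
rewrite -ha -hb ler_norml => /andP[_ h3].
by have := h1 q Dq; lra.
Qed.

End Definable.
End Schemes.

(** * Separated points and algebraic sets *)

Section SeparatedPoints.
Context {R : realType}.

Lemma seq_choice (T : choiceType) (P : T -> Prop) (Q : T -> T -> Prop) :
  (forall ys : seq T, exists y, P y /\ forall m, m \in ys -> Q m y) ->
  exists s : nat -> T, (forall k, P (s k)) /\
    forall j k, (j < k)%N -> Q (s j) (s k).
Proof.
move=> h; have [F hF] := choice h.
pose pre := fix pre k := if k is k'.+1 then F (pre k') :: pre k' else [::].
exists (fun k => F (pre k)); split => [k|j k jk]; first exact: (hF _).1.
apply: (hF _).2; elim: k jk => // k IH; rewrite ltnS leq_eqVlt inE.
by case/predU1P => [->|/IH ->]; rewrite ?eqxx// orbT.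
Qed.

Section Metric.
Variables (T : metricType R) (n : nat).
Implicit Types (K : set 'rV[T]_n) (i : 'I_n) (e : R).

(** Finite families can be expressed by formulas and transferred, while infinite sequences
    contradict compactness. Separation is measured in one fixed coordinate, the one to which [D]
    will be projected. *)
Definition kpts k i e K := exists x : 'I_k -> 'rV[T]_n,
  (forall l, K (x l)) /\
  forall l m, l != m -> e <= mdist (x l ord0 i) (x m ord0 i).

Definition separated_seq i e K := exists s : nat -> 'rV[T]_n,
  (forall k, K (s k)) /\
  forall j k, (j < k)%N -> e <= mdist (s j ord0 i) (s k ord0 i).

Lemma kpts_sub k i e e' K K' : K `<=` K' -> e' <= e ->
  kpts k i e K -> kpts k i e' K'.
Proof.
move=> KK' ee' [x [h1 h2]]; exists x; split => [l|l m lm]; first exact: KK'.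
by rewrite (le_trans ee')// h2.
Qed.

Lemma kpts_leq k k' i e K : (k' <= k)%N -> kpts k i e K -> kpts k' i e K.
Proof.
move=> kk [x [h1 h2]]; exists (x \o widen_ord kk); split => [l|l m lm].
  exact: h1.
by apply: h2; apply: contra lm => /eqP[/eqP]; rewrite (inj_eq val_inj).
Qed.

Lemma separated_seq_kpts k i e K : separated_seq i e K -> kpts k i e K.
Proof.
move=> [s [s1 s2]]; exists (fun l => s l); split => // l m lm.
have [h|h|h] := ltngtP l m; first exact: s2.
- by rewrite metric_sym; exact: s2.
- by rewrite (val_inj h) eqxx in lm.
Qed.

(** Greedy choice with the pigeonhole principle: among [m + 1] points pairwise [e] apart, no two are
    within [e/2] of the same one of [m] given points. *)
Lemma kpts_separated_seq i e K : (forall k, kpts k i e K) ->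
  separated_seq i (e / 2) K.
Proof.
move=> hK; apply: (@seq_choice _ K
  (fun y z : 'rV[T]_n => e / 2 <= mdist (y ord0 i) (z ord0 i))) => ys.
have [x [x1 x2]] := hK (size ys).+1.
apply: contrapT => no.
have h (l : 'I_(size ys).+1) : exists j : 'I_(size ys),
    mdist (nth (x l) ys j ord0 i) (x l ord0 i) < e / 2.
  apply: contrapT => nj; apply: no; exists (x l); split => // m mys.
  rewrite leNgt; apply/negP => lt; apply: nj.
  have jl : (index m ys < size ys)%N by rewrite index_mem.
  by exists (Ordinal jl); rewrite /= nth_index.
have [f hf] := choice h.
have /injectivePn [l [m lm flm]] : ~~ injectiveb f.
  apply/injectiveP => /leq_card; rewrite !card_ord.
  by rewrite ltnn.
have := x2 _ _ lm; have := hf l; have := hf m.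
rewrite -flm (set_nth_default (x l)) ?ltn_ord // => h1 h2 h3.
have := metric_triangle (x l ord0 i) (nth (x l) ys (f l) ord0 i) (x m ord0 i).
by rewrite (metric_sym (x l ord0 i) (nth (x l) ys (f l) ord0 i)); lra.
Qed.

Lemma compact_not_separated i e K : compact K -> 0 < e -> ~ separated_seq i e K.
Proof.
move=> cK e0 [s [s1 s2]].
have FK : (s @ \oo) K by exists 0%N => // k _; exact: s1.
have [x [_ clx]] := cK _ _ FK.
have e20 : 0 < e / 2 by lra.
have nb : nbhs x (ball x (e / 2)) by exact: nbhsx_ballx.
have [_ [[k _ <-] [_ hk]]] := clx (s @` setT) _ ltac:(by exists 0%N => // k _; exists k) nb.
have [_ [[m km <-] [_ hm]]] := clx (s @` [set m | (k < m)%N]) _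
  ltac:(by exists k.+1 => // m km; exists m) nb.
have := s2 _ _ km; have := hk ord0 i; have := hm ord0 i.
rewrite !ballEmdist /= => h1 h2.
have := metric_triangle (s k ord0 i) (x ord0 i) (s m ord0 i).
by rewrite (metric_sym (s k ord0 i) (x ord0 i)); lra.
Qed.

End Metric.

(** If every coordinate of [K] had finite [e]-nets for all [e], each coordinate of an ultrafilter on
    [K] would be Cauchy, hence convergent, and [K] would be compact. Where nets fail, a separated
    sequence is chosen greedily. *)
Lemma noncompact_separated (L : signature R) (N : structure L) n
    (K : set 'rV[N]_n) : closed K -> ~ compact K ->
  exists i (e : R), 0 < e /\ separated_seq i e K.
Proof.
move=> clK nK; apply: contrapT => no; apply: nK.
have net i (e : R) : 0 < e -> exists ys : seq 'rV[N]_n, forall y, K y ->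
    exists2 m, m \in ys & mdist (m ord0 i) (y ord0 i) < e.
  move=> e0; apply: contrapT => nys; apply: no; exists i, e; split => //.
  apply: (@seq_choice _ K
    (fun y z : 'rV[N]_n => e <= mdist (y ord0 i) (z ord0 i))) => ys.
  apply: contrapT => ny; apply: nys; exists ys => y Ky.
  apply: contrapT => nm; apply: ny; exists y; split => // m mys.
  by rewrite leNgt; apply/negP => lt; apply: nm; exists m.
rewrite compact_ultra => U UU UK.
have lim i : exists y : N, forall e : R, 0 < e ->
    U [set x | mdist y (x ord0 i) < e].
  have cF : cauchy ((fun x : 'rV[N]_n => x ord0 i) @ U).
    apply/cauchyP => e e0; have [ys hys] := net i e e0.
    apply: contrapT => nx.
    have hall (m : 'I_(size ys)) (y0 := tnth (in_tuple ys) m) :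
        U (~` [set x | mdist (y0 ord0 i) (x ord0 i) < e]).
      have [h|//] := in_ultra_setVsetC [set x : 'rV[N]_n |
        mdist (y0 ord0 i) (x ord0 i) < e] UU.
      case: nx; exists (y0 ord0 i).
      suff : U [set x : 'rV[N]_n | ball (y0 ord0 i) e (x ord0 i)] by [].
      by apply: filterS h => x /=; rewrite ballEmdist.
    have hall' : U (fun x => forall m : 'I_(size ys),
        ~ mdist (tnth (in_tuple ys) m ord0 i) (x ord0 i) < e).
      exact: filter_forall hall.
    have [x [Kx hx]] := filter_ex (filterI UK hall').
    have [m mys hm] := hys x Kx.
    have /tnthP[j mj] : m \in in_tuple ys by [].
    by apply: (hx j); rewrite -mj.
  have [y hy] := carrier_complete (fmap_proper_filter _ _) cF.
  exists y => e e0; have yB : nbhs y (ball y e) by exact: nbhsx_ballx.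
  have : U [set x : 'rV[N]_n | ball y e (x ord0 i)] := hy _ yB.
  by apply: filterS => x; rewrite /= ballEmdist.
have [y hy] := choice lim.
have Uy : U --> (\row_i y i : 'rV[N]_n).
  apply/cvg_ballP => e e0.
  have : U (fun x : 'rV[N]_n => forall i, mdist (y i) (x ord0 i) < e).
    by apply: filter_forall => i; exact: hy.
  apply: filterS => x hx; split => // i j.
  by rewrite ballEmdist /= mxE (ord1 i).
exists (\row_i y i); split => //; apply: clK => B /Uy UB.
by have [x Bx] := filter_ex (filterI UK UB); exists x.
Qed.

End SeparatedPoints.

Section AlgebraicSets.
Context {R : realType} {L : signature R}.
Implicit Types M N : structure L.

Lemma closed_realizations M (A : set M) n (X : set (types A n)) N (g : A -> N) :
  elementary_over g -> closed X -> closed (realizations X g).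
Proof.
move=> eg cX.
have ct : continuous (type_of eg : 'rV[N]_n -> types A n).
  move=> b; have FF : Filter (type_of eg @ nbhs b).
    exact: fmap_filter (nbhs_filter b).
  apply: types_cvg => th; apply/cvgrPdist_le => e e0.
  have [d d0 hd] := pfml_unif_cont (pfml_tp th) e0.
  have : nbhs b (ball b d) by exact: nbhsx_ballx.
  apply: filterS => c [_ bc]; rewrite /= -!(eval_tpE th g).
  by apply: hd => i; have := bc ord0 i; rewrite ballEmdist.
have -> : realizations X g = type_of eg @^-1` X.
  by apply/seteqP; split => b /(realizationsE eg).
by apply: closed_comp => // b _; exact: ct.
Qed.

Lemma nonalgebraic_separated M (A : set M) n (X : set (types A n)) :
  closed X -> ~ algebraic X ->
  exists N (g : A -> N), elementary_over g /\
    exists i (e : R), 0 < e /\ separated_seq i e (realizations X g).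
Proof.
move=> cX nX; apply: contrapT => no; apply: nX => N g eg.
apply: contrapT => nc; apply: no; exists N, g; split => //.
exact: (noncompact_separated (closed_realizations eg cX) nc).
Qed.

Lemma separated_nonalgebraic M (A : set M) n (X : set (types A n)) N
    (g : A -> N) i e : elementary_over g -> 0 < e ->
  separated_seq i e (realizations X g) -> ~ algebraic X.
Proof. by move=> eg e0 h aX; exact: (compact_not_separated (aX N g eg) e0 h). Qed.

Lemma elementary_isometry M N (f : M -> N) : elementary_embedding f ->
  forall x y, mdist (f x) (f y) = mdist x y.
Proof.
move=> /elementary_embedding_equiv ef x y.
exact: (ef _ _ (fml_dist true false) (fun b : bool => if b then x else y)).
Qed.

(** The range of an elementary embedding is an isometric copy of a complete structure, hence
    closed. *)
Lemma far_from_range M N (f : M -> N) x : elementary_embedding f ->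
  ~ range f x -> exists2 d : R, 0 < d & forall m, d <= mdist (f m) x.
Proof.
move=> ef nx; apply: contrapT => no.
have h (k : nat) : exists m, mdist (f m) x < 2^-1 ^+ k.
  apply: contrapT => nm; apply: no; exists (2^-1 ^+ k); first exact: pow2_gt0.
  by move=> m; rewrite leNgt; apply/negP => lt; apply: nm; exists m.
have [s hs] := choice h.
have [e e0|y hy] := @seq_complete _ _ M s.
  have e20 : 0 < e / 2 by lra.
  have [K hK] := pow2_small e20; exists K => j l Kj Kl.
  rewrite -(elementary_isometry ef).
  have := metric_triangle (f (s j)) x (f (s l)); rewrite (metric_sym x).
  have := hs j; have := hs l; have := pow2_le R Kj; have := pow2_le R Kl; lra.
apply: nx; exists y => //; apply: mdist_positivity; apply/eqP.
rewrite eq_le mdist_ge0 andbT; apply/ler_addgt0Pl => e e0; rewrite addr0.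
have e20 : 0 < e / 2 by lra.
have [K hK] := hy _ e20; have [k hk] := pow2_small e20.
have := hK _ (leq_maxl K k); have := hs (maxn K k).
have := pow2_le R (leq_maxr K k).
have := metric_triangle (f y) (f (s (maxn K k))) x.
by rewrite (elementary_isometry ef) (metric_sym y); lra.
Qed.

(* A type over [A] realized away from a model containing [A] is approximated
   by infinitely many separated points of that model, and an ultrapower indexed
   by sequences turns these into separated realizations. *)
Lemma far_nonalgebraic M (A : set M) n (X : set (types A n)) N (f : M -> N)
    (ef : elementary_embedding f) (x : 'rV[N]_n) i (d : R) : 0 < d ->
  (forall m, d <= mdist (f m) (x ord0 i)) ->
  X (type_of (elementary_over_embedding (A := A) ef) x) -> ~ algebraic X.
Proof.
move=> d0 hd Xp; set p := type_of _ x in Xp.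
pose ty (b : 'rV[M]_n) : types A n := type_of (@elementary_val _ _ _ A) b.
pose Sep (s : nat -> 'rV[M]_n) := forall j k, (j < k)%N ->
  d / 2 <= mdist (s j ord0 i) (s k ord0 i).
have near_p V : nbhs p V -> exists s : nat -> 'rV[M]_n,
    (forall k, V (ty (s k))) /\ Sep s.
  move=> /separate_nbhs[th [th1 th2]].
  apply: (@seq_choice _ (fun b => V (ty b)) (fun y z : 'rV[M]_n =>
    d / 2 <= mdist (y ord0 i) (z ord0 i))) => ys.
  (* [P < 0] says that a tuple satisfies [th < 1] and is more than [d/2] away from each listed point
     in coordinate [i]. Halving [d] makes the condition strict at [x]. *)
  pose P N' (g : M -> N') (v : 'I_n + 'I_(size ys) -> N') : R :=
    Num.max (1 * tp (g \o (val : A -> M)) (\row_k v (inl k)) th + (-1))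
    (\big[Num.max/-1]_l (-1 * mdist (v (inr l)) (v (inl i)) + d / 2)).
  have fP : pfml P.
    apply: pfml_max.
      apply: pfml_affine.
      exact: (pfml_rename inl (pfml_reindex val (pfml_tp th))).
    by apply: pfml_bigmax => l; apply: pfml_affine; exact: pfml_dist.
  have fP' := pfml_const (fun l => tnth (in_tuple ys) l ord0 i) fP.
  have ef' := (elementary_embedding_equiv f).1 ef.
  have [|w hw] := transfer (r := 0) (w1 := x ord0) ef' fP'.
    rewrite /P gt_max; apply/andP; split.
      have -> : \row_k sumv (x ord0) (f \o (fun l => tnth (in_tuple ys) l ord0 i)) (inl k) = x.
        by apply/rowP => k; rewrite mxE.
      by have := th1; rewrite type_ofE; lra.
    apply: bigmax_lt => [|l _]; first by rewrite ltrN10.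
    by rewrite /=; have := hd (tnth (in_tuple ys) l ord0 i); lra.
  exists (\row_k w k); move: hw; rewrite /P gt_max => /andP[h1 h2]; split.
    by apply: th2; rewrite type_ofE; move: h1; rewrite /=; lra.
  move=> m mys; have /tnthP[l ml] : m \in in_tuple ys by [].
  have := le_lt_trans (le_bigmax _ _ l) h2.
  by rewrite /= -ml mxE; lra.
pose F : set_system (nat -> 'rV[M]_n) := filter_from (nbhs p)
  (fun V => [set s | (forall k, V (ty (s k))) /\ Sep s]).
have FF : ProperFilter F.
  apply: filter_from_proper => [|V /near_p[s hs]]; last by exists s.
  apply: filter_from_filter; first by exists setT; exact: filterT.
  move=> V W pV pW; exists (V `&` W); first exact: filterI.
  by move=> s [h1 h2]; split; split => // k; have [] := h1 k.
have [U [UU FU]] := ultraFilterLemma FF.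
pose w k : 'rV[ultrapower UU M]_n :=
  \row_j uclass_of UU (fun s : nat -> 'rV[M]_n => s k ord0 j).
have eg := elementary_over_embedding (A := A) (@diag_elementary _ _ _ _ UU M).
have wp k : tp (@diag _ _ _ _ UU M \o val) (w k) = val p.
  apply: type_cvg_tp => V pV; apply: FU; exists V => // s [h _]; exact: h.
have d20 : 0 < d / 2 by lra.
apply: (separated_nonalgebraic (i := i) eg d20).
exists w; split => [k|j k jk]; first by exists p.
rewrite !mxE mdist_uclass_of; apply: ulim_ge; first exact: mdist_ubounded.
by apply: FU; exists setT; [exact: filterT|move=> s [_]; apply].
Qed.

Lemma algebraic_realized M (A : set M) n (X : set (types A n)) N (f : M -> N)
    (ef : elementary_embedding f) (x : 'rV[N]_n) i :
  algebraic X -> realizations X (f \o val) x -> range f (x ord0 i).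
Proof.
move=> aX /(realizationsE (elementary_over_embedding (A := A) ef)) Xx.
apply: contrapT => /(far_from_range ef)[d d0 hd].
exact: (far_nonalgebraic d0 hd Xx).
Qed.

(** The same [c] has to serve for both values of [t], so the points of the two families and the
    entries of [c] are variables of a single predicate. *)
Lemma kpts_transfer (C : Type) n (J : finType) (i : bool -> 'I_n)
    (Th : bool -> forall N, (C -> N) -> ('I_n + J -> N) -> R)
    N1 N2 (g1 : C -> N1) (g2 : C -> N2) (b : J -> N1) (e : R) k :
  (forall t, pfml (Th t)) -> elem_equiv g1 g2 -> 0 < e ->
  (forall t, kpts k (i t) e [set x | Th t N1 g1 (sumv (x ord0) b) < 0]) ->
  exists c : J -> N2, forall t,
    kpts k (i t) (e / 2) [set x | Th t N2 g2 (sumv (x ord0) c) < 0].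
Proof.
move=> fT e12 e0 h.
pose V := (bool * 'I_k * 'I_n + J)%type.
pose s t l (z : 'I_n + J) : V :=
  match z with inl j => inl (t, l, j) | inr j => inr j end.
pose P N (g : C -> N) (v : V -> N) : R :=
  Num.max (\big[Num.max/-1]_(tl : bool * 'I_k) Th tl.1 N g (v \o s tl.1 tl.2))
  (\big[Num.max/-1]_(tlm : bool * {lm : 'I_k * 'I_k | lm.1 != lm.2})
    (-1 * mdist (v (inl (tlm.1, (val tlm.2).1, i tlm.1)))
                (v (inl (tlm.1, (val tlm.2).2, i tlm.1))) + 3 * e / 4)).
have fP : pfml P.
  apply: pfml_max; apply: pfml_bigmax => -[t z].
    exact: (pfml_rename (s t z) (fT t)).
  by apply: pfml_affine; exact: pfml_dist.
have [x hx] := choice h.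
pose v1 (z : V) : N1 :=
  match z with inl (t, l, j) => x t l ord0 j | inr j => b j end.
have [|v2] := transfer (r := 0) (w1 := v1) e12 fP.
  rewrite /P gt_max; apply/andP; split; apply: bigmax_lt; rewrite ?ltrN10//.
    move=> [t l] _ /=; have := (hx t).1 l.
    by rewrite /=; congr (Th t N1 g1 _ < 0); apply/funext => -[].
  move=> [t [[l m] lm]] _ /=; have := (hx t).2 l m lm; lra.
rewrite /P gt_max => /andP[h1 h2]; exists (v2 \o inr) => t.
exists (fun l => \row_j v2 (inl (t, l, j))); split => [l|l m lm].
  have := le_lt_trans (le_bigmax _ _ (t, l)) h1.
  rewrite /=; congr (Th t N2 g2 _ < 0).
  by apply/funext => -[j|j] //=; rewrite mxE.
have := le_lt_trans (le_bigmax _ _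
  (t, exist (fun lm : 'I_k * 'I_k => lm.1 != lm.2) (l, m) lm)) h2.
by rewrite !mxE /=; lra.
Qed.

(** Countably many conditions must become the vanishing of one continuous function: the supremum of
    the [chi l] truncated to [[0, 2^-l]]. It is continuous because all but finitely many terms are
    below any given [e]. *)
Lemma zeros_zeroset M (A : set M) n (chi : nat -> pformula A n)
    (th : pformula A n) (r : R) :
  zeroset (zeros chi `&` [set p | val p th <= r]).
Proof.
have [z hz] := pformula_cst A n 0.
have trunc l : exists ch : pformula A n, forall p : types A n,
    val p ch = Num.min (2^-1 ^+ l) (Num.max 0 (val p (chi l))).
  have [c hc] := pformula_cst A n (2^-1 ^+ l).
  have [m hm] := pformula_max z (chi l); have [k hk] := pformula_min c m.
  by exists k => p; rewrite hk hc hm hz.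
have [ch hch] := choice trunc.
pose f l (p : types A n) : R := val p (ch l).
have fE l p : f l p = Num.min (2^-1 ^+ l) (Num.max 0 (val p (chi l))) := hch l p.
have cf l : continuous (f l) by exact: pformula_continuous.
have f0 l p : 0 <= f l p by rewrite fE le_min ltW ?pow2_gt0// le_max lexx.
have fle l p : f l p <= 2^-1 ^+ l by rewrite fE ge_min lexx.
pose F p := sup [set f l p | l in [set: nat]].
have hF p : has_sup [set f l p | l in [set: nat]].
  split; first by exists (f 0%N p), 0%N.
  exists 1 => _ [l _ <-]; apply: le_trans (fle l p) _.
  by have := pow2_le R (leq0n l); rewrite expr0.
have fF l p : f l p <= F p by apply: ub_le_sup; [exact: (hF p).2|exists l].
have cF : continuous F.
  move=> p; have FFp : Filter (nbhs p) := nbhs_filter p.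
  apply/cvgrPdist_le => e e0; have [k hk] := pow2_small e0.
  have : \forall q \near p, forall l : 'I_k, `|f l p - f l q| <= e.
    apply: (@filter_forall _ _
      (fun (l : 'I_k) (q : types A n) => `|f l p - f l q| <= e) _ FFp) => l.
    by have /cvgrPdist_le/(_ _ e0) := cf l p.
  apply: filterS => q hq.
  have hq' l : `|f l p - f l q| <= e.
    have [lk|kl] := ltnP l k; first exact: (hq (Ordinal lk)).
    have := pow2_le R kl; have := f0 l p; have := f0 l q.
    have := fle l p; have := fle l q; rewrite ler_norml => *.
    by apply/andP; split; lra.
  rewrite ler_norml; apply/andP; split.
    suff : F q <= F p + e by lra.
    apply: ge_sup; first exact: (hF q).1.
    move=> _ [l _ <-]; have := fF l p; have := hq' l.
    by rewrite ler_norml => /andP[] *; lra.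
  suff : F p <= F q + e by lra.
  apply: ge_sup; first exact: (hF p).1.
  move=> _ [l _ <-]; have := fF l q; have := hq' l.
  by rewrite ler_norml => /andP[] *; lra.
have [th1 h1] := pformula_affine 1 (- r) th; have [th2 h2] := pformula_max z th1.
have th2E (p : types A n) : val p th2 = Num.max 0 (val p th - r) by rewrite h2 hz h1 mul1r.
have F0 p : 0 <= F p by exact: le_trans (f0 0%N p) (fF 0%N p).
have th20 (p : types A n) : 0 <= val p th2 by rewrite th2E le_max lexx.
exists (fun p => F p + val p th2); split.
  move=> p; have FFp : Filter (nbhs p) := nbhs_filter p.
  exact: (cvgD (cF p) (@pformula_continuous _ _ _ _ _ th2 p)).
apply/seteqP; split => [p [/= hp1 hp2]|p /= hp].
  rewrite th2E (max_idPl _) ?addr0; last by rewrite subr_le0.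
  apply/eqP; rewrite eq_le F0 andbT; apply: ge_sup; first exact: (hF p).1.
  by move=> _ [l _ <-]; rewrite fE ge_min (max_idPl (hp1 l)) lexx orbT.
have Fp : F p <= 0 by rewrite -hp lerDl th20.
have : val p th2 <= 0 by rewrite -hp lerDr F0.
rewrite th2E ge_max => /andP[_ h]; split; last by rewrite /= -subr_le0.
move=> l; have := le_trans (fF l p) Fp.
by rewrite fE ge_min leNgt pow2_gt0 /= ge_max => /andP[].
Qed.

End AlgebraicSets.

(** * Minimal sets *)

Section MinimalSets.
Context {R : realType} {L : signature R}.
Implicit Types M N : structure L.

Definition inT (M : structure L) (x : M) : [set: M] :=
  exist (fun y => y \in [set: M]) x (mem_set I).

Lemma inTK M (x : [set: M]) : inT (val x) = x.
Proof. exact: val_inj. Qed.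

Lemma elementary_overT M N (g : [set: M] -> N) :
  elementary_over g -> elementary_embedding (g \o @inT M).
Proof.
move=> /elementary_over_equiv eg; apply/elementary_embedding_equiv.
exact: (elem_equiv_reindex (@inT M) eg).
Qed.

Lemma realizations_zeros M (A : set M) n (chi : nat -> pformula A n) N
    (g : A -> N) (b : 'rV[N]_n) : elementary_over g ->
  realizations (zeros chi) g b <-> forall l, eval_tp (chi l) g (b ord0) <= 0.
Proof.
move=> eg; split=> [/(realizationsE eg) h l|h].
  by rewrite eval_tpE; exact: (h l).
by apply/(realizationsE eg) => l; rewrite type_ofE -eval_tpE.
Qed.

(** A point with [chi l < 1] is within [4 * 2^-l <= e/8] of a common zero. Moving the points there
    lowers their separation by at most [e/4] and changes [Phi] by at most [s]. *)
Lemma kpts_move C n (chi : nat -> forall N, (C -> N) -> ('I_n -> N) -> R)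
    N (g : C -> N) (Phi : ('I_n -> N) -> R) (d r s e : R) l k i :
  (forall l, pfml (chi l)) -> scheme chi g ->
  (forall x y, (forall i, mdist (x i) (y i) < d) -> `|Phi x - Phi y| <= s) ->
  4 * 2^-1 ^+ l < d -> 4 * 2^-1 ^+ l <= e / 8 ->
  kpts k i (e / 2) [set x | chi l N g (x ord0) < 1 /\ Phi (x ord0) < r] ->
  kpts k i (e / 4) [set x | (forall l, chi l N g (x ord0) <= 0) /\
    Phi (x ord0) <= r + s].
Proof.
move=> fchi sg hPhi ld le [x [x1 x2]].
have [y hy] := choice (fun l' => scheme_near fchi sg (x1 l').1).
exists (fun l' => \row_j y l' j); split => [l'|l1 l2 l12].
  have e' : (\row_j y l' j) ord0 = y l' by apply/funext => j; rewrite mxE.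
  rewrite /= e'; split; first exact: (hy l').2.
  have := hPhi (x l' ord0) (y l'); have hxy j : mdist (x l' ord0 j) (y l' j) < d.
    exact: le_lt_trans ((hy l').1 j) ld.
  by move=> /(_ hxy); rewrite ler_norml => /andP[h1 h2]; have := (x1 l').2; lra.
rewrite !mxE; have := x2 _ _ l12; have := (hy l1).1 i; have := (hy l2).1 i.
have := metric_triangle (x l1 ord0 i) (y l1 i) (x l2 ord0 i).
have := metric_triangle (y l1 i) (y l2 i) (x l2 ord0 i).
by rewrite (metric_sym (y l2 i)); lra.
Qed.

(** Vanishing of all [chi l] is not an open condition. Only [chi l < 1] for one large [l] is
    transferred, which halves the separation; moving the points back onto the zeros halves it again.
    Meanwhile the bound goes from [r] to [(r + r') / 2] and then to [r']. *)
Lemma kpts_scheme_transfer C n (J : finType) (i : bool -> 'I_n)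
    (chi : nat -> forall N, (C -> N) -> ('I_n -> N) -> R)
    (Phi : bool -> forall N, (C -> N) -> ('I_n + J -> N) -> R)
    N1 N2 (g1 : C -> N1) (g2 : C -> N2) (b : J -> N1) (e r r' : R) k :
  (forall l, pfml (chi l)) -> (forall t, pfml (Phi t)) ->
  elem_equiv g1 g2 -> scheme chi g2 -> 0 < e -> r < r' ->
  (forall t, kpts k (i t) e [set x | (forall l, chi l N1 g1 (x ord0) <= 0) /\
    Phi t N1 g1 (sumv (x ord0) b) <= r]) ->
  exists c : J -> N2, forall t, kpts k (i t) (e / 4) [set x |
    (forall l, chi l N2 g2 (x ord0) <= 0) /\
    Phi t N2 g2 (sumv (x ord0) c) <= r'].
Proof.
move=> fchi fPhi e12 s2 e0 rr' h.
have s0 : 0 < (r' - r) / 2 by lra.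
have [d1 d10 hd1] := pfml_unif_cont (fPhi true) s0.
have [d2 d20 hd2] := pfml_unif_cont (fPhi false) s0.
have m0 : 0 < Num.min (Num.min d1 d2) (e / 8) / 4.
  rewrite divr_gt0// !lt_min d10 d20 /=; lra.
have [l hl] := pow2_small m0.
have hl' : 4 * 2^-1 ^+ l < Num.min (Num.min d1 d2) (e / 8) by lra.
move: hl'; rewrite !lt_min => /andP[/andP[ld1 ld2] le].
pose Th (t : bool) N (g : C -> N) (v : 'I_n + J -> N) : R :=
  Num.max (1 * chi l N g (v \o inl) + (-1)) (1 * Phi t N g v + - ((r + r') / 2)).
have fT t : pfml (Th t).
  apply: pfml_max; apply: pfml_affine; last exact: fPhi.
  exact: (pfml_rename inl (fchi l)).
have [t|c hc] := kpts_transfer (b := b) fT e12 e0 (k := k) (i := i).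
  apply: kpts_sub (h t) => // x [h1 h2]; rewrite /= /Th gt_max.
  have := h1 l; rewrite (_ : sumv (x ord0) b \o inl = x ord0) //.
  by move=> h3; apply/andP; split; lra.
exists c => t.
have ht x y : (forall j, mdist (x j) (y j) < Num.min d1 d2) ->
    `|Phi t N2 g2 (sumv x c) - Phi t N2 g2 (sumv y c)| <= (r' - r) / 2.
  move=> hxy; case: t; [apply: hd1|apply: hd2] => -[j|j] /=;
    rewrite ?mdistxx //; by have := hxy j; rewrite lt_min => /andP[].
have := @kpts_move C n chi N2 g2 (fun x => Phi t N2 g2 (sumv x c))
  (Num.min d1 d2) ((r + r') / 2) ((r' - r) / 2) e l k (i t) fchi s2 ht.
rewrite lt_min ld1 ld2 => /(_ isT (ltW le)).
have -> : (r + r') / 2 + (r' - r) / 2 = r' by field.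
apply; apply: kpts_sub (hc t) => // x; rewrite /= /Th gt_max => /andP[].
rewrite (_ : sumv (x ord0) c \o inl = x ord0) // => h1 h2.
by split; lra.
Qed.

Section Alternative.
Variables (M : structure L) (n : nat) (D : set (types [set: M] n)).
Hypothesis hD : minimal D.

Lemma minimal_alternative (th : pformula [set: M] n) (r s : R) : r < s ->
  algebraic (D `&` [set p | val p th <= r]) \/
  algebraic (D `&` [set p | s <= val p th]).
Proof.
move=> rs; have [defD _ minD] := hD; have [chi [_ DE]] := definable_scheme defD.
have [th' hth'] := pformula_affine (-1) 0 th.
have h2 : D `&` [set p | s <= val p th] = D `&` [set p | val p th' <= - s].
  congr (_ `&` _); apply/seteqP; split => p /=; rewrite hth' mulN1r addr0 lerN2; exact: id.
apply: contrapT => no.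
have n1 : ~ algebraic (D `&` [set p | val p th <= r]) by move=> a; apply: no; left.
have n2 : ~ algebraic (D `&` [set p | s <= val p th]) by move=> a; apply: no; right.
apply: (minD (D `&` [set p | val p th <= r]) (D `&` [set p | s <= val p th])) => //.
- by rewrite DE; exact: zeros_zeroset.
- by rewrite h2 DE; exact: zeros_zeroset.
- apply/seteqP; split => // p [[_ /= h1] [_ /= h3]].
  by move: (le_lt_trans h1 rs); rewrite ltNge h3.
Qed.

(* Non-minimality of [D] over a larger parameter set; the booleans make the two
   non-algebraic pieces interchangeable. *)
Definition splitting N (g : [set: M] -> N) (J : finType) (b : J -> N)
    (Psi : bool -> forall N, ('I_n + J -> N) -> R) (i : bool -> 'I_n) (e : R) :=
  [/\ forall t, fml (Psi t), 0 < e,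
    forall N' v, Psi true N' v + Psi false N' v = 1 &
    forall t k, kpts k (i t) e
      [set x | realizations D g x /\ Psi t N (sumv (x ord0) b) <= 6^-1]].

Lemma zeroset_closed (A : set M) m (F : set (types A m)) : zeroset F -> closed F.
Proof.
move=> [phi [cphi ->]].
have -> : [set p | phi p = 0] = phi @^-1` [set 0] by [].
by apply: closed_comp => // p _; exact: cphi.
Qed.

End Alternative.

(** The failure of compactness of [F] is known in one model only, and [F] need not be definable.
    Relaxing it to the points of [E] where [th] is small gives families in every model, with a
    common [e]. *)
Lemma separated_over M (A : set M) n (E F : set (types A n))
    (th : pformula A n) : definable E -> closed F -> ~ algebraic F ->
  F `<=` E `&` [set p | val p th <= 0] ->
  exists i (e : R), 0 < e /\ forall N (g : A -> N), elementary_over g ->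
    forall k, kpts k i e
      [set x | realizations E g x /\ eval_tp th g (x ord0) <= 6^-1].
Proof.
move=> defE cF nF FE.
have [chi [schi EE]] := definable_scheme defE.
have [N1 [g1 [eg1 [i [e [e0 sep]]]]]] := nonalgebraic_separated cF nF.
exists i, (e / 4); split => [|N g eg k]; first by lra.
have e12 : elem_equiv g1 g.
  apply: elem_equiv_trans ((elementary_over_equiv g1).1 eg1) _.
  exact/elem_equivC/elementary_over_equiv.
have r0 : (0 : R) < 6^-1 by rewrite invr_gt0.
have [|c hc] := @kpts_scheme_transfer A n void (fun _ => i)
  (fun l => eval_tp (chi l)) (fun _ N g v => eval_tp th g (v \o inl)) N1 N g1 g
  (of_void N1) e 0 6^-1 k (fun l => pfml_tp (chi l))
  (fun _ => pfml_rename inl (pfml_tp th)) e12 (schi N g eg) e0 r0.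
  move=> _; apply: kpts_sub (separated_seq_kpts k sep) => // x.
  move=> /(realizationsE eg1)/FE[]; rewrite EE => h1 h2; split => [l|].
    by rewrite eval_tpE; exact: (h1 l).
  rewrite (_ : sumv _ _ \o inl = x ord0) // eval_tpE; exact: h2.
apply: kpts_sub (hc true) => // x [h1 h2]; split => //.
by rewrite EE; apply/realizations_zeros.
Qed.

Section Splitting.
Variables (M : structure L) (n : nat) (D : set (types [set: M] n)).
Hypothesis hD : minimal D.

Lemma nonminimal_splitting N (g : [set: M] -> N) (B : set N)
    (E F G : set (types B n)) : definable E -> same_set g D E ->
  zeroset F -> zeroset G -> F `<=` E -> G `<=` E -> F `&` G = set0 ->
  ~ algebraic F -> ~ algebraic G ->
  exists (J : finType) (b : J -> N) Psi i e, splitting D g b Psi i e.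
Proof.
move=> defE same /zeroset_closed cF /zeroset_closed cG FE GE FG nF nG.
have [th [hF hG]] := separate_closed cF cG FG.
have [th' hth'] := pformula_affine (-1) 1 th.
have [|i1 [e1 [e10 h1]]] := separated_over (th := th) defE cF nF.
  by move=> p Fp; split; [exact: FE|exact: hF].
have [|i2 [e2 [e20 h2]]] := separated_over (th := th') defE cG nG.
  move=> p Gp; split; first exact: GE.
  have := hG p Gp; rewrite /mkset hth'; set x := val p th; move=> ?; lra.
have [J [c [Q [fQ hQ]]]] := pfml_tp th.
have ev := @elementary_val _ _ N B.
exists J, (val \o c), (fun t => if t then Q else fun N' v => -1 * Q N' v + 1).
exists (fun t : bool => if t then i1 else i2), (Num.min e1 e2).
have idE : elementary_embedding (@id N).
  by apply/elementary_embedding_equiv => J' P fP d.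
have DE : realizations D g = realizations E val := same N id idE.
split.
- case=> //; have := fml_comp (u := fun x => -1 * x + 1) _ fQ; apply=> x.
  by apply: cvgD; [apply: cvgM => //; exact: cvg_cst|exact: cvg_cst].
- by rewrite lt_min e10.
- by move=> N' v; rewrite mulN1r; ring.
move=> t k; rewrite DE; case: t.
  apply: kpts_sub (h1 N val ev k); last by rewrite ge_min lexx.
  by move=> x [hx]; rewrite /eval_tp hQ.
apply: kpts_sub (h2 N val ev k); last by rewrite ge_min lexx orbT.
move=> x [hx]; rewrite eval_tpE -(type_ofE ev) hth' type_ofE -eval_tpE.
by rewrite /eval_tp hQ.
Qed.

Lemma nonalgebraic_extension N (g : [set: M] -> N) (B : set N)
    (E : set (types B n)) : elementary_over g ->
  same_set g D E -> ~ algebraic E.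
Proof.
move=> eg same; have [defD nD _] := hD.
have [z hz] := pformula_cst [set: M] n 0.
have [|i [e [e0 h]]] := separated_over (th := z) defD defD.1 nD.
  by move=> p Dp; split => //; rewrite /mkset hz.
have idE : elementary_embedding (@id N).
  by apply/elementary_embedding_equiv => J' P fP d.
have DE : realizations D g = realizations E val := same N id idE.
have e20 : 0 < e / 2 by lra.
apply: (separated_nonalgebraic (i := i) (@elementary_val _ _ N B) e20).
apply: kpts_separated_seq => k; apply: kpts_sub (h N g eg k) => //.
by move=> x [hx _]; rewrite -DE.
Qed.

Lemma strongly_minimal_splitting :
  (forall N (g : [set: M] -> N) (J : finType) (b : J -> N) Psi i e,
    elementary_over g -> ~ splitting D g b Psi i e) -> strongly_minimal D.
Proof.
move=> no; have [defD nD minD] := hD; split => // N g eg B E defE same.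
split => // [|F G zF zG FE GE FG [nF nG]].
  exact: nonalgebraic_extension eg same.
have [J [b [Psi [i [e h]]]]] :=
  nonminimal_splitting defE same zF zG FE GE FG nF nG.
exact: no h.
Qed.

(** A single [c] with both families for every [k] makes the parts of [D] where [Psi true <= 1/3] and
    where [Psi true >= 2/3] non-algebraic over [M]. *)
Lemma splitting_separated N (g : [set: M] -> N) (J : finType) (b : J -> N) Psi i e :
  splitting D g b Psi i e -> elementary_over g ->
  (exists c : J -> M, forall t k, kpts k (i t) (e / 4)
    [set x | realizations D val x /\ Psi t M (sumv (x ord0) c) <= 3^-1]) ->
  False.
Proof.
move=> [fPsi e0 Psi1 _] eg [c hc].
have [th hth] := pfml_pformula
  (pfml_const (@inT M \o c) (pfml_fml [set: M] (fPsi true))).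
have ev := @elementary_val _ _ M [set: M].
have e80 : 0 < e / 4 / 2 by lra.
have thE (x : 'rV[M]_n) :
    val (type_of ev x) th = Psi true M (sumv (x ord0) c).
  by rewrite type_ofE hth.
have lt : (3^-1 : R) < 2 / 3 by lra.
have [] := minimal_alternative hD th lt.
  apply: (separated_nonalgebraic (i := i true) ev e80).
  apply: kpts_separated_seq => k; apply: kpts_sub (hc true k) => // x.
  move=> [/(realizationsE ev) Dx hx]; apply/(realizationsE ev); split => //.
  by rewrite /mkset thE.
apply: (separated_nonalgebraic (i := i false) ev e80).
apply: kpts_separated_seq => k; apply: kpts_sub (hc false k) => // x.
move=> [/(realizationsE ev) Dx hx]; apply/(realizationsE ev); split => //.
rewrite /mkset thE; have := Psi1 M (sumv (x ord0) c); lra.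
Qed.

(** The complete type of [b] with finitely many parameters settles all [k] at once, so one [c']
    serves for every [k]. The parameters [a] of [chi l] are recovered only approximately, as [a'];
    the scheme absorbs the error by moving the points back into [D]. *)
Lemma splitting_saturated N (g : [set: M] -> N) (J : finType) (b : J -> N) Psi i e :
  elementary_over g -> approx_aleph0_saturated M -> ~ splitting D g b Psi i e.
Proof.
move=> eg sat spl; have [fPsi e0 Psi1 hk] := spl.
apply: (splitting_separated spl eg).
have [defD nD _] := hD; have [chi [schi DE]] := definable_scheme defD.
(* Room for the bound on [Psi]: [1/6 < 1/5] for the transfer and [1/5 + 1/12 < 1/3] for the move
   into [D]. *)
have s0 : (0 : R) < 12^-1 by rewrite invr_gt0.
have [d1 d10 hd1] := fml_unif_cont (fPsi true) s0.
have [d2 d20 hd2] := fml_unif_cont (fPsi false) s0.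
have m0 : 0 < Num.min (Num.min d1 d2) (e / 8) / 4.
  rewrite divr_gt0// !lt_min d10 d20 /=; lra.
have [l hl] := pow2_small m0.
have : 4 * 2^-1 ^+ l < Num.min (Num.min d1 d2) (e / 8) by lra.
rewrite !lt_min => /andP[/andP[ld1 ld2] le].
pose q := nparams (chi l); pose a : 'rV[M]_q := map_mx val (params (chi l)).
(* With the parameters [a'] the value of [chi l] will be below [1/4]; returning to [a] adds at most
   [1/4], which stays below 1. *)
have s4 : (0 : R) < 4^-1 by rewrite invr_gt0.
have [d d0 hd] := formula_unif_cont (pform (chi l)) s4.
have ef := elementary_overT eg; set f := g \o @inT M in ef.
pose b' : 'rV[N]_#|J| := \row_j b (enum_val j).
pose ty := type_of (elementary_over_embedding (A := set0) ef)
  (row_mx b' (map_mx f a)).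
have [|c' [a' [qE aa']]] := sat #|J| q a ty d d0.
  by exists N, f, b'.
have eqv : elem_equiv (row_mx b' (map_mx f a) ord0) (row_mx c' a' ord0).
  move=> K P fP s.
  have [th hth] := pfml_pformula (pfml_rename s (pfml_fml (set0 : set M) fP)).
  by rewrite -(hth _ (f \o val)) -(hth _ val) -qE.
exists (fun j => c' ord0 (enum_rank j)) => t k.
pose S := 'I_(#|J| + q).
pose Q N' (h : S -> N') (x : 'I_n -> N') : R :=
  formula_eval (pform (chi l)) (row_mx (\row_j x j) (\row_j h (rshift #|J| j))).
pose W (t : bool) N' (h : S -> N') (x : 'I_n + void -> N') : R :=
  Num.max (1 * Q N' h (x \o inl) + (- 4^-1))
   (1 * Psi t N' (sumv (x \o inl) (fun j => h (lshift q (enum_rank j)))) + (- 5^-1)).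
have fQ : pfml Q.
  exists 'I_q, (@rshift #|J| q), (fun N' (v : 'I_n + 'I_q -> N') =>
    formula_eval (pform (chi l)) (\row_j v (fintype.split j))); split.
    exact: (fml_rename (@fintype.split n q) (fml_eval (pform (chi l)))).
  move=> N' h x; congr formula_eval; apply/rowP => j; rewrite !mxE.
  by case: fintype.split => j'; rewrite mxE.
have fW t' : pfml (W t').
  apply: pfml_max; apply: pfml_affine; first exact: (pfml_rename inl fQ).
  exact: (pfml_rename inl (pfml_const (fun j : J => lshift q (enum_rank j))
    (pfml_fml S (fPsi t')))).
have [t'|w hw] := kpts_transfer (b := of_void N) fW eqv e0 (k := k) (i := i).
  apply: kpts_sub (hk t' k) => // x [Dx hx]; rewrite /mkset /W gt_max.
  rewrite (_ : sumv _ _ \o inl = x ord0) //.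
  have -> : Q N (row_mx b' (map_mx f a) ord0) (x ord0) = eval_tp (chi l) g (x ord0).
    congr formula_eval; congr row_mx; apply/rowP => j.
    rewrite mxE row_mxEr !mxE /f /=; congr g; exact: inTK.
  have -> : (fun j => row_mx b' (map_mx f a) ord0 (lshift q (enum_rank j))) = b.
    by apply/funext => j; rewrite row_mxEl mxE enum_rankK.
  move: Dx; rewrite DE => /(realizations_zeros _ _ eg)/(_ l) Dx.
  by apply/andP; split; lra.
have ev := @elementary_val _ _ M [set: M].
pose c j := c' ord0 (enum_rank j).
have hPsi x y : (forall j, mdist (x j) (y j) < Num.min d1 d2) ->
    `|Psi t M (sumv x c) - Psi t M (sumv y c)| <= 12^-1.
  move=> hxy; case: t {hw}; [apply: hd1|apply: hd2] => -[j|j] /=;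
    rewrite ?mdistxx //; by have := hxy j; rewrite lt_min => /andP[].
have := @kpts_move _ n (fun l => eval_tp (chi l)) M val
  (fun x => Psi t M (sumv x c)) (Num.min d1 d2) 5^-1 12^-1 e l k (i t)
  (fun l => pfml_tp (chi l)) (schi M val ev) hPsi.
rewrite lt_min ld1 ld2 => /(_ isT (ltW le)) mv.
apply: (@kpts_sub _ _ _ _ _ _ _ _ _ _ _ (mv _)) => //.
  move=> x [h1 h2]; split; first by rewrite DE; apply/realizations_zeros.
  by apply: le_trans h2 _; lra.
apply: kpts_sub (hw t) => // x; rewrite /mkset /W gt_max.
rewrite (_ : sumv _ _ \o inl = x ord0) //.
have -> : (fun j => row_mx c' a' ord0 (lshift q (enum_rank j))) = c.
  by apply/funext => j; rewrite row_mxEl.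
move=> /andP[h1 h2]; split; last by lra.
have := hd M (row_mx (\row_j x ord0 j) a) (row_mx (\row_j x ord0 j) a').
have aa : tdist (row_mx (\row_j x ord0 j) a) (row_mx (\row_j x ord0 j) a') < d.
  apply: tdist_ltP => // j; rewrite !mxE; case: fintype.split => j'.
    by rewrite mxE mdistxx.
  exact: le_lt_trans (mdist_le_tdist _ _ _) aa'.
move=> /(_ aa).
have -> : formula_eval (pform (chi l)) (row_mx (\row_j x ord0 j) a) =
  eval_tp (chi l) val (x ord0) by [].
have -> : formula_eval (pform (chi l)) (row_mx (\row_j x ord0 j) a') =
    Q M (row_mx c' a' ord0) (x ord0).
  by congr formula_eval; congr row_mx; apply/rowP => j; rewrite mxE row_mxEr.
by rewrite ler_norml => /andP[h3 h4]; lra.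
Qed.

End Splitting.

End MinimalSets.

(** * Ultrapowers over the natural numbers *)

Section UltrapowerMaps.
Context {R : realType} {L : signature R} {U : set_system nat}.
Variable UU : UltraFilter U.
Implicit Types M N : structure L.

Definition ultrapower_map M N (f : M -> N) (c : ultrapower UU M) :
    ultrapower UU N :=
  uclass_of UU (fun k => f (urepr c k)).

Lemma ultrapower_mapE M N (f : M -> N) (s : nat -> M) :
  elementary_embedding f ->
  ultrapower_map f (uclass_of UU s) = uclass_of UU (fun k => f (s k)).
Proof.
move=> ef; apply: mdist_positivity; rewrite mdist_uclass_of.
have <- : mdist (uclass_of UU (urepr (uclass_of UU s))) (uclass_of UU s) = 0.
  by rewrite {1}/uclass_of ureprK mdistxx.
rewrite mdist_uclass_of; congr (ulim U _); apply/funext => k.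
exact: elementary_isometry.
Qed.

Lemma ultrapower_map_elementary M N (f : M -> N) :
  elementary_embedding f -> elementary_embedding (ultrapower_map f).
Proof.
move=> /elementary_embedding_equiv ef; apply/elementary_embedding_equiv.
move=> J P fP c.
have := Los_fml UU (N_ := fun _ : nat => N) (fun j k => f (urepr (c j) k)) fP.
rewrite /comp /ultrapower_map => ->.
have := Los_fml UU (N_ := fun _ : nat => M) (fun j k => urepr (c j) k) fP.
have -> : (fun j => uclass_of UU (urepr (c j))) = c.
  by apply/funext => j; rewrite /uclass_of ureprK.
move=> ->; congr (ulim U _); apply/funext => k.
exact: (ef J P fP (fun j => urepr (c j) k)).
Qed.

Hypothesis oU : \oo `<=` U.

(** Once a term comes within [e/2] of [m], every later term is at least [e/2] away, and [U] contains
    the tails. *)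
Lemma limit_far M (s : nat -> M) (e : R) : 0 < e ->
  (forall j k, (j < k)%N -> e <= mdist (s j) (s k)) ->
  forall m, e / 2 <= mdist (diag UU m) (uclass_of UU s).
Proof.
move=> e0 hs m; rewrite mdist_uclass_of.
apply: ulim_ge; first exact: mdist_ubounded.
have [[k0 hk0]|no] := pselect (exists k, mdist m (s k) < e / 2); last first.
  apply: filterE => k /=; rewrite leNgt; apply/negP => h; apply: no.
  by exists k.
apply: oU; exists k0.+1 => // k /= kk.
rewrite leNgt; apply/negP => h; have := hs _ _ kk.
by have := metric_triangle (s k0) m (s k); rewrite (metric_sym (s k0) m); lra.
Qed.

End UltrapowerMaps.

Lemma nonprincipal_ultrafilter : exists U : set_system nat,
  UltraFilter U /\ \oo `<=` U.
Proof. exact: ultraFilterLemma. Qed.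

(** * Transfer along embeddings and the sequence of parameters in [M] *)

Section Transfer.
Context {R : realType} {L : signature R}.
Implicit Types M N : structure L.

Lemma models_elementary (T : theory L) M N (f : M -> N) :
  elementary_embedding f -> models M T -> models N T.
Proof.
move=> ef hM sigma Ts v; have [x0 _] := carrier_nonempty M.
have -> : v = map_mx f (\row_(j < 0) x0) by apply/rowP => -[].
by rewrite ef; exact: hM.
Qed.

Lemma realizations_elementary M (A : set M) n (X : set (types A n)) N
    (f : M -> N) (b : 'rV[M]_n) : elementary_embedding f ->
  realizations X (f \o val) (map_mx f b) <-> realizations X val b.
Proof.
move=> ef; suff e : tp (f \o (val : A -> M)) (map_mx f b) = tp val b.
  by rewrite /realizations /mkset e.
apply/funext => th; rewrite /tp.
have -> : row_mx (map_mx f b) (map_mx (f \o (val : A -> M)) (params th)) =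
    map_mx f (row_mx b (map_mx val (params th))).
  by rewrite map_row_mx map_mx_comp.
exact: ef.
Qed.

Lemma splitting_family M n (D : set (types [set: M] n)) N
    (g : [set: M] -> N) (J : finType) (b : J -> N) Psi i e :
  minimal D -> elementary_over g -> splitting D g b Psi i e ->
  exists t (c : nat -> J -> M),
    (forall k (th : pformula [set: M] n),
      (forall N' (h : [set: M] -> N') x,
        tp h x th = Psi t N' (sumv (x ord0) (h \o @inT R L M \o c k))) ->
      algebraic (D `&` [set p | val p th <= 2 / 5])) /\
    forall k, kpts k (i t) (e / 4) [set x | realizations D val x /\
      Psi t M (sumv (x ord0) (c k)) <= 3^-1].
Proof.
move=> hD eg [fPsi e0 Psi1 hk].
have [defD nD _] := hD; have [chi [schi DE]] := definable_scheme defD.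
have ev := @elementary_val _ _ M [set: M].
have lt1 : (6^-1 : R) < 3^-1 by lra.
have e12 : elem_equiv g val by exact/elementary_over_equiv.
have h k : exists c : J -> M, forall t, kpts k (i t) (e / 4)
    [set x | realizations D val x /\ Psi t M (sumv (x ord0) c) <= 3^-1].
  have [t|c hc] := @kpts_scheme_transfer _ _ [set: M] n J i
    (fun l => eval_tp (chi l)) (fun t N' h v => Psi t N' v) N M g val b e
    6^-1 3^-1 k (fun l => pfml_tp (chi l)) (fun t => pfml_fml _ (fPsi t))
    e12 (schi M val ev) e0 lt1.
    apply: kpts_sub (hk t k) => // x [Dx hx]; split => //.
    by apply/realizations_zeros => //; rewrite -DE.
  exists c => t; apply: kpts_sub (hc t) => // x [Dx hx]; split => //.
  by rewrite DE; apply/realizations_zeros.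
have [c hc] := choice h.
pose good t k := forall th : pformula [set: M] n,
  (forall N' (h : [set: M] -> N') x,
    tp h x th = Psi t N' (sumv (x ord0) (h \o @inT R L M \o c k))) ->
  algebraic (D `&` [set p | val p th <= 2 / 5]).
(* Symmetric about [1/2]: the two [Psi] add up to 1, so [Psi true >= 3/5] means [Psi false <= 2/5].
   The gap between [1/3] and [2/5] is kept for the thickening. *)
have lt2 : (2 / 5 : R) < 3 / 5 by lra.
have alt k : good true k \/ good false k.
  have [th hth] := pfml_pformula
    (pfml_const (@inT R L M \o c k) (pfml_fml [set: M] (fPsi true))).
  have [a|a] := minimal_alternative hD th lt2; [left|right] => th' hth'.
    suff -> : [set p : types [set: M] n | val p th' <= 2 / 5] =
        [set p | val p th <= 2 / 5] by [].
    apply/seteqP; split => p; have [N' [h' [eh [x ->]]]] := typeP p;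
      by rewrite /mkset !type_ofE hth hth'.
  suff -> : [set p : types [set: M] n | val p th' <= 2 / 5] =
      [set p | 3 / 5 <= val p th] by [].
  apply/seteqP; split => p; have [N' [h' [eh [x ->]]]] := typeP p;
    rewrite /mkset !type_ofE hth hth' => hx;
    have := Psi1 N' (sumv (x ord0) (h' \o @inT R L M \o c k)); rewrite /comp in hx *; lra.
have [t ht] : exists t, forall k, exists k', (k <= k')%N /\ good t k'.
  apply: contrapT => no.
  have no' t : exists k, forall k', (k <= k')%N -> ~ good t k'.
    apply: contrapT => no'; apply: no; exists t => k.
    apply: contrapT => no''; apply: no'; exists k => k' kk' gk'.
    by apply: no''; exists k'.
  have [k1 h1] := no' true; have [k2 h2] := no' false.
  have [] := alt (maxn k1 k2); first exact: h1 (leq_maxl _ _).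
  exact: h2 (leq_maxr _ _).
have [s hs] := choice ht.
exists t, (c \o s); split => [k|k]; first exact: (hs k).2.
exact: kpts_leq (hs k).1 (hc (s k) t).
Qed.

End Transfer.

(** * Vaughtian pairs *)

Section Pair.
Context {R : realType} {L : signature R}.
Implicit Types N : structure L.

Lemma scheme_ext (C C' : Type) n (X : nat -> forall N, (C -> N) -> ('I_n -> N) -> R)
    (X' : nat -> forall N, (C' -> N) -> ('I_n -> N) -> R)
    N (g : C -> N) (g' : C' -> N) :
  (forall l x, X l N g x = X' l N g' x) -> scheme X g -> scheme X' g'.
Proof.
move=> e sg j l x; rewrite -e => xj eta e0.
by have [y [y1 y2]] := sg j l x xj eta e0; exists y; rewrite -e.
Qed.

(** * Projection to one coordinate *)

Section Fiber.
Variables (C : Type) (n : nat) (i : 'I_n).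
Variable X : nat -> forall N, (C -> N) -> ('I_n -> N) -> R.
Arguments X : clear implicits.
Hypothesis fX : forall l, pfml (X l).

(** [Q (z)] is [inf_x max (d (z, x_i) / a, X_l x, Phi x)]; dividing by [a] makes the threshold 1
    correspond to the distance [a]. *)
Lemma fiber_inf (a : R) l (Phi : forall N, (C -> N) -> ('I_n -> N) -> R) :
  0 < a -> pfml Phi ->
  exists Q : forall N, (C -> N) -> ('I_1 -> N) -> R, [/\ pfml Q,
    forall N g x, X l N g x <= 0 -> Phi N g x <= 0 -> Q N g (fun _ => x i) <= 0 &
    forall N g z, Q N g z < 1 ->
      exists x, [/\ X l N g x < 1, Phi N g x < 1 & mdist (z ord0) (x i) < a]].
Proof.
move=> a0 fPhi.
pose P N (g : C -> N) (v : 'I_1 + 'I_n -> N) : R :=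
  Num.max (a^-1 * mdist (v (inl ord0)) (v (inr i)) + 0)
    (Num.max (X l N g (v \o inr)) (Phi N g (v \o inr))).
have fP : pfml P.
  apply: pfml_max; first by apply: pfml_affine; exact: pfml_dist.
  by apply: pfml_max; [exact: (pfml_rename inr (fX l))|exact: (pfml_rename inr fPhi)].
have [Q [fQ Q1 Q2]] := pfml_inf fP.
exists Q; split => // [N g x x1 x2|N g z z1].
  apply: le_trans (Q1 N g _ x) _.
  by rewrite /P /= mdistxx mulr0 addr0 !ge_max lexx x1 x2.
have [|x hx] := Q2 N g z (1 - Q N g z); first by rewrite subr_gt0.
move: hx; rewrite addrC subrK /P /= addr0 !gt_max => /andP[h1 /andP[h2 h3]].
by exists x; split => //; move: h1; rewrite mulrC ltr_pdivrMr// mul1r.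
Qed.

Lemma projection_scheme :
  exists Q : nat -> forall N, (C -> N) -> ('I_1 -> N) -> R,
  [/\ forall l, pfml (Q l),
    forall N g x, (forall l, X l N g x <= 0) ->
      forall l, Q l N g (fun _ => x i) <= 0 &
    forall l N g z, scheme X g -> Q l N g z < 1 ->
      exists x, (forall l, X l N g x <= 0) /\ mdist (z ord0) (x i) < 2^-1 ^+ l].
Proof.
(* The distance [2^-(l+3)] in the fibre and the move by [4 * 2^-(l+3)] onto the zeros together stay
   below [2^-l]. *)
have h l := fiber_inf (l + 3) (pow2_gt0 R (l + 3)) (pfml_cst C 'I_n 0).
have [Q hQ] := choice h; exists Q; split => [l|N g x hx l|l N g z sg].
- by have [] := hQ l.
- by have [_ h1 _] := hQ l; exact: h1.
have [_ _ h2] := hQ l; move=> /h2[x [x1 _ zx]].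
have [y [y1 y2]] := scheme_near fX sg x1.
exists y; split => //; have := y1 i.
have := metric_triangle (z ord0) (x i) (y i).
have e8 : 8 * 2^-1 ^+ (l + 3) = 2^-1 ^+ l :> R.
  by rewrite exprD !exprS expr0; field.
by have := pow2_gt0 R l; lra.
Qed.

End Fiber.

Variables (T : theory L) (M : structure L).
Hypothesis hM : models M T.
Variables (n : nat) (D : set (types [set: M] n)).
Hypothesis hD : minimal D.
Variable chi : nat -> pformula [set: M] n.
Hypothesis schi : forall N (g : [set: M] -> N), elementary_over g -> tscheme chi g.
Hypothesis DE : D = zeros chi.
Variables (J : finType) (Phi : forall N, ('I_n + J -> N) -> R).
Hypothesis fPhi : fml Phi.
Variables (i : 'I_n) (e : R) (c : nat -> J -> M).
Hypothesis e0 : 0 < e.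
Hypothesis algPhi : forall k (th : pformula [set: M] n),
  (forall N (h : [set: M] -> N) x,
    tp h x th = Phi (sumv (x ord0) (h \o @inT R L M \o c k))) ->
  algebraic (D `&` [set p | val p th <= 2 / 5]).
Hypothesis kptsPhi : forall k, kpts k i e
  [set x | realizations D val x /\ Phi (sumv (x ord0) (c k)) <= 3^-1].

(* Names for the countably many parameters of [D] and for those of [Phi]. *)
Let cst := ({l : nat & 'I_(nparams (chi l))} + J)%type.

Let X l N (g : cst -> N) (x : 'I_n -> N) : R :=
  formula_eval (pform (chi l))
    (row_mx (\row_j x j) (\row_j g (inl (existT _ l j)))).

Let gk k (s : cst) : M :=
  match s with
  | inl p => val (params (chi (tag p)) ord0 (tagged p))
  | inr j => c k j
  end.

Let phi N (g : cst -> N) (x : 'I_n -> N) : R := Phi (sumv x (g \o inr)).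

Let fX l : pfml (X l).
Proof.
exists 'I_(nparams (chi l)), (fun j => inl (existT _ l j)).
exists (fun N (v : 'I_n + 'I_(nparams (chi l)) -> N) =>
  formula_eval (pform (chi l)) (\row_j v (fintype.split j))); split.
  exact: (fml_rename (@fintype.split n _) (fml_eval (pform (chi l)))).
move=> N h x; congr formula_eval; apply/rowP => j; rewrite !mxE.
by case: fintype.split => j'; rewrite mxE.
Qed.

Let fphi : pfml phi.
Proof. exact: (pfml_const inr (pfml_fml cst fPhi)). Qed.

Let X_tp l k N (h : [set: M] -> N) x :
  X l (h \o @inT R L M \o gk k) x = eval_tp (chi l) h x.
Proof.
congr formula_eval; congr row_mx; apply/rowP => j; rewrite !mxE /=.
by congr h; exact: inTK.
Qed.

Let X_scheme k N (h : [set: M] -> N) : elementary_over h ->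
  scheme X (h \o @inT R L M \o gk k).
Proof.
move=> eh; apply: scheme_ext (schi eh) => l x.
by rewrite X_tp.
Qed.

Let X_zeros k N (h : [set: M] -> N) (x : 'rV[N]_n) : elementary_over h ->
  realizations D h x <-> forall l, X l (h \o @inT R L M \o gk k) (x ord0) <= 0.
Proof.
move=> eh; rewrite DE; split=> [/(realizations_zeros _ _ eh) h1 l|h1].
  by rewrite X_tp.
by apply/(realizations_zeros _ _ eh) => l; rewrite -(X_tp l k).
Qed.

Lemma psi_exists (d : R) : 0 < d ->
  exists Q : forall N, (cst -> N) -> ('I_1 -> N) -> R, [/\ pfml Q,
    forall N g x, (forall l, X l g x <= 0) -> phi g x <= 3^-1 ->
      Q N g (fun _ => x i) <= 0 &
    forall N g z, scheme X g -> Q N g z < 1 ->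
      exists x, [/\ forall l, X l g x <= 0, phi g x <= 2 / 5 &
        mdist (z ord0) (x i) < 2 * d]].
Proof.
move=> d0.
have s0 : (0 : R) < 30^-1 by rewrite invr_gt0.
have [d1 d10 hd1] := pfml_unif_cont fphi s0.
have m0 : 0 < Num.min d d1 / 4 by rewrite divr_gt0// lt_min d0.
have [l hl] := pow2_small m0.
have : 4 * 2^-1 ^+ l < Num.min d d1 by lra.
rewrite lt_min => /andP[ld ld1].
(* [30 t - 10] takes [1/3] to 0 and [11/30] to 1. Moving the point onto the zeros costs at most
   another [1/30], which gives [2/5]. *)
have [Q [fQ Q1 Q2]] := fiber_inf i fX l d0 (pfml_affine 30 (-10) fphi).
exists Q; split => // [N g x x1 x2|N g z sg /Q2[x [x1 x2 x3]]].
  apply: Q1; first exact: x1.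
  by rewrite -lerBrDr sub0r opprK; lra.
have [y [y1 y2]] := scheme_near fX sg x1.
exists y; split => //; last first.
  by have := y1 i; have := metric_triangle (z ord0) (x i) (y i); lra.
have := hd1 N g x y; have xy j : mdist (x j) (y j) < d1.
  exact: le_lt_trans (y1 j) ld1.
by move=> /(_ xy); rewrite ler_norml => /andP[h1 h2]; lra.
Qed.

(** The embedding [f] is the ultrapower of the diagonal [M -> M1], not the diagonal of [M1], and the
    parameters [gs] are the class of the [gk k]. So a point of [Y] in [M2] with [psi < 1/2] is
    represented by points of [M1] close to [M]. [Y] describes the projection of [D] to coordinate
    [i]; the type with [rho <= 0] is where the dictionaric case starts. *)
Theorem definable_pair :
  exists N1 N2 (f : N1 -> N2) (A : set N1) (Y : set (types A 1))
    (rho : pformula A 1),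
    [/\ models N1 T, models N2 T, definable Y,
      vaughtian_for f (Y `&` [set p | val p rho < 2^-1]) &
      exists2 p, Y p /\ val p rho <= 0 & ~ algebraic [set p]].
Proof.
have [U [UU oU]] := nonprincipal_ultrafilter.
pose M1 := ultrapower UU M; pose dg := @diag _ _ _ _ UU M.
have edg : elementary_embedding dg by exact: diag_elementary.
have ev := @elementary_val _ _ M [set: M].
have edv : elementary_over (dg \o (val : [set: M] -> M)).
  exact: elementary_over_embedding.
pose M2 := ultrapower UU M1; pose f := @ultrapower_map _ _ _ UU M M1 dg.
have ef : elementary_embedding (f : M1 -> M2) by exact: ultrapower_map_elementary.
have [s [sD ssep]] : separated_seq i (e / 2) (realizations D val).
  by apply: kpts_separated_seq => k; apply: kpts_sub (kptsPhi k) => // x [].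
pose xs : 'rV[M1]_n := \row_j uclass_of UU (fun k => s k ord0 j).
have e20 : 0 < e / 2 by rewrite divr_gt0.
have xs_far m : e / 4 <= mdist (dg m) (xs ord0 i).
  have -> : e / 4 = e / 2 / 2 by field.
  by rewrite mxE; exact: (limit_far UU oU e20 (s := fun k => s k ord0 i) ssep m).
have xsD : realizations D (dg \o val) xs.
  rewrite DE; apply/realizations_zeros => // l; rewrite eval_tpE.
  rewrite (Los_tp UU (fun a _ => val a)); apply: ulim_le.
    exact: tp_ubounded.
  apply: filterE => k /=.
  by move: (sD k); rewrite DE => /(realizations_zeros _ _ ev)/(_ l); rewrite eval_tpE.
(* With [d = e/8], the points given by [psi2] are closer than [2 d = e/4], the lower bound for the
   distance from the [i]-th coordinate of [xs] to [M]. *)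
have d0 : 0 < e / 8 by rewrite divr_gt0.
have [psi [fpsi psi1 psi2]] := psi_exists d0.
have [pr [fpr pr1 pr2]] := projection_scheme i fX.
have pr_scheme N (g : cst -> N) : scheme X g -> scheme pr g.
  move=> sg j l z /(pr2 _ _ _ _ sg)[x [x1 x2]] eta eta0.
  exists (fun _ => x i); split; last exact: le_lt_trans (pr1 _ _ _ x1 l) eta0.
  by move=> k; rewrite (ord1 k); apply: lt_trans x2 _; rewrite ltrDl.
(* By minimality one of [psi (x_i) <= 1/2] and [1 <= psi (x_i)] is algebraic on
   [D], and [xs] shows that the second is not. *)
have alg_psi k (th : pformula [set: M] n) :
    (forall N (h : [set: M] -> N) x,
      tp h x th = psi N (h \o @inT R L M \o gk k) (fun _ => x ord0 i)) ->
    algebraic (D `&` [set p | val p th <= 2^-1]).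
  move=> hth; have lt : (2^-1 : R) < 1 by lra.
  have [//|a] := minimal_alternative hD th lt.
  have far : ~ range dg (xs ord0 i).
    by move=> [m _ hm]; have := xs_far m; rewrite hm mdistxx; lra.
  have [xs1|xs1] := ltP (psi M1 (dg \o gk k) (fun _ => xs ord0 i)) 1; last first.
    case: far; apply: (@algebraic_realized _ _ _ _ _ _ _ _ edg xs i a).
    apply/(realizationsE edv); split; first exact/(realizationsE edv).
    by rewrite /mkset type_ofE hth.
  (* If [psi < 1] at [xs_i], some [x] in [D] with [phi <= 2/5] has [x_i] closer than [e/4] to
     [xs_i]; by [algPhi] this [x_i] lies in [M], against [xs_far]. *)
  have [x [x1 x2 x3]] := psi2 M1 _ _ (X_scheme (k := k) edv) xs1.
  have [th' hth'] := pfml_pformula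
    (pfml_const (@inT R L M \o c k) (pfml_fml [set: M] fPhi)).
  have a' := algPhi hth'.
  have [m _ hm] : range dg ((\row_j x j) ord0 i).
    apply: (@algebraic_realized _ _ _ _ _ _ _ _ edg (\row_j x j) i a'); apply/(realizationsE edv).
    have xe : (\row_j x j) ord0 = x by apply/funext => j; rewrite mxE.
    split; last by rewrite /mkset type_ofE hth' xe.
    by apply/(realizationsE edv)/(X_zeros k _ edv); rewrite xe.
  have := xs_far m; rewrite hm mxE metric_sym => h; lra.
(* The index [l] must not depend on [k], so that the estimate survives in the ultrapower; it comes
   from a modulus of [psi] common to all interpretations of the names. *)
have near_M (eta tau : R) : 0 < eta -> 0 < tau -> exists l, forall k z,
    pr l M1 (dg \o gk k) z < 1 -> psi M1 (dg \o gk k) z <= 2^-1 - tau ->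
    exists m, mdist (dg m) (z ord0) < eta.
  move=> eta0 tau0; have [d1 d10 hd1] := pfml_unif_cont fpsi tau0.
  have m0 : 0 < Num.min eta d1 by rewrite lt_min eta0.
  have [l] := pow2_small m0; rewrite lt_min => /andP[l1 l2].
  exists l => k z /(pr2 _ _ _ _ (X_scheme (k := k) edv))[x [x1 x2]] hz.
  have [th hth] := pfml_pformula (pfml_rename (fun _ : 'I_1 => i)
    (pfml_reindex (@inT R L M \o gk k) fpsi)).
  have xe : (\row_j x j) ord0 = x by apply/funext => j; rewrite mxE.
  have [m _ hm] : range dg ((\row_j x j) ord0 i).
    apply: (@algebraic_realized _ _ _ _ _ _ _ _ edg (\row_j x j) i (alg_psi k th hth)).
    apply/(realizationsE edv); split.
      by apply/(realizationsE edv)/(X_zeros k _ edv); rewrite xe.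
    rewrite /mkset type_ofE hth xe.
    have := hd1 M1 (dg \o gk k) z (fun _ => x i).
    have zx j : mdist (z j) (x i) < d1 by rewrite (ord1 j); exact: lt_trans x2 l2.
    by move=> /(_ zx); rewrite ler_norml => /andP[h1 h2]; rewrite /comp in h1 h2 hz *; lra.
  exists m; rewrite hm mxE metric_sym; exact: lt_trans x2 l1.
pose gs (a : cst) : M1 := uclass_of UU (fun k => gk k a).
pose A : set M1 := range gs.
have gsA a : A (gs a) by exists a.
pose sA (a : cst) : A := exist (fun y => y \in A) (gs a) (mem_set (gsA a)).
have gs_scheme : scheme X gs.
  by apply: scheme_ext (X_scheme (k := 0%N) edv) => l x.
have eA := @elementary_val _ _ M1 A.
have [zeta hzeta] := choice (fun l => pfml_pformula (pfml_reindex sA (fpr l))).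
have [rho hrho] := pfml_pformula (pfml_reindex sA fpsi).
have zeta_scheme : tscheme zeta (val : A -> M1).
  apply: scheme_ext (pr_scheme _ _ gs_scheme) => l z.
  rewrite /eval_tp hzeta; congr (pr l M1 _ _); apply/funext => j.
  by rewrite mxE.
pose Y := zeros zeta.
have defY : definable Y by exact: scheme_definable eA zeta_scheme.
have efA : elementary_over (f \o (val : A -> M1)) by exact: elementary_over_embedding.
have [x0 _] := carrier_nonempty M.
have [w hw] := dependent_choice_fun kptsPhi.
(* The [j]-th point of the [k]-th family, with the default [x0] for the finitely many [k <= j],
   which [U] ignores. *)
pose wj j : M1 := uclass_of UU (fun k =>
  if insub j is Some j' then w k j' ord0 i else x0).
have wjE j : U [set k | exists j' : 'I_k, val j' = j /\ insub j = Some j'].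
  apply: oU; exists j.+1 => // k /= jk.
  by exists (Ordinal jk); split => //; rewrite insubT.
have wj_sep j1 j2 : (j1 < j2)%N -> e <= mdist (wj j1) (wj j2).
  move=> j12; rewrite mdist_uclass_of; apply: ulim_ge; first exact: mdist_ubounded.
  apply: filterS (filterI (wjE j1) (wjE j2)) => k [[a [a1 ae]] [b [b1 be]]].
  rewrite /= ae be; apply: (hw k).2; apply: contraTN j12 => /eqP ab.
  by rewrite -a1 -b1 ab ltnn.
have Los1 (P : forall N, (cst -> N) -> ('I_1 -> N) -> R) (s' : nat -> M) : pfml P ->
    P M1 gs (fun _ => uclass_of UU s') = ulim U (fun k => P M (gk k) (fun _ => s' k)).
  by move=> fP; exact: (Los_pfml UU (fun a k => gk k a) (fun _ k => s' k) fP).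
have ub1 (P : forall N, (cst -> N) -> ('I_1 -> N) -> R) N (g : nat -> cst -> N)
    (z : nat -> 'I_1 -> N) : pfml P -> ubounded (fun k => P N (g k) (z k)).
  move=> [K [d [Q [fQ hQ]]]]; have [B hB] := fml_bounded fQ; exists B => k.
  by rewrite hQ.
have wj_le0 (P : forall N, (cst -> N) -> ('I_1 -> N) -> R) j : pfml P ->
    (forall k x, (forall l, X l (gk k) x <= 0) -> phi (gk k) x <= 3^-1 ->
      P M (gk k) (fun _ => x i) <= 0) ->
    P M1 gs (fun _ => wj j) <= 0.
  move=> fP hP; rewrite Los1//; apply: ulim_le; first exact: ub1.
  apply: filterS (wjE j) => k [a [a1 ae]]; have [Da wa] := (hw k).1 a.
  by rewrite /= ae; apply: hP => //; exact/(X_zeros k _ ev).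
pose y : M2 := uclass_of UU wj.
(* [M2] also extends [M1] along the diagonal. For this embedding, not for [f], the limit [y] of the
   [wj j] is shown to be far from [M1], which makes its type non-algebraic. *)
pose dg1 := @diag _ _ _ _ UU M1.
have edg1 : elementary_embedding dg1 by exact: diag_elementary.
have y_far m : e / 2 <= mdist (dg1 m) y by exact: limit_far.
have edA : elementary_over (dg1 \o (val : A -> M1)) by exact: elementary_over_embedding.
pose yr : 'rV[M2]_1 := \row_j y.
have y_le0 (P : forall N, (cst -> N) -> ('I_1 -> N) -> R) (th : pformula A 1) :
    pfml P -> (forall N (h : A -> N) b, tp h b th = P N (h \o sA) (b ord0)) ->
    (forall j, P M1 gs (fun _ => wj j) <= 0) ->
    val (type_of edA yr) th <= 0.
  move=> fP hth h; rewrite type_ofE hth.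
  have -> : yr ord0 = fun _ => uclass_of UU wj by apply/funext => j; rewrite mxE.
  have -> : P M2 ((dg1 \o (val : A -> M1)) \o sA) (fun _ => uclass_of UU wj) =
      ulim U (fun k => P M1 gs (fun _ => wj k)).
    exact: (Los_pfml UU (fun a _ => gs a) (fun _ k => wj k) fP).
  apply: ulim_le; first exact: ub1.
  by apply: filterE => k; exact: h.
pose p := type_of edA yr.
have pY : Y p.
  move=> l; apply: (y_le0 _ _ (fpr l) (hzeta l)) => j.
  by apply: wj_le0 => // k x hx _; exact: pr1.
have prho : val p rho <= 0.
  apply: (y_le0 _ _ fpsi hrho) => j.
  by apply: wj_le0 => // k x hx1 hx2; exact: psi1.
have pna : ~ algebraic [set p].
  apply: (far_nonalgebraic (i := ord0) (d := e / 2) (ef := edg1) (x := yr)) => //.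
    by move=> m; rewrite mxE; exact: y_far.
  exact: val_inj.
have fx_far m : e / 4 <= mdist (f m) (uclass_of UU (fun _ => xs ord0 i)).
  rewrite mdist_uclass_of; apply: ulim_ge; first exact: mdist_ubounded.
  by apply: filterE => k; exact: xs_far.
exists M1, M2, f, A, Y, rho; split.
- exact: models_elementary edg hM.
- exact: models_elementary ef (models_elementary edg hM).
- exact: defY.
- split.
  + apply: card_le_trans (card_image_le _ _) _; exact: countableP.
  + by exists p => //; split => //; apply: le_lt_trans prho _; rewrite invr_gt0.
  + exact: ef.
  + move=> fT; have : [set: M2] (uclass_of UU (fun _ => xs ord0 i)) by [].
    rewrite -fT => -[m _ hm]; have := fx_far m; rewrite hm mdistxx.
    by rewrite leNgt divr_gt0.
  apply/seteqP; split => [z zX|_ [b bX <-]]; last first.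
    exact/(realizations_elementary _ _ ef).
  suff [m _ hm] : range f (z ord0 ord0).
    have ze : z = map_mx f (\row_(j < 1) m).
      by apply/rowP => j; rewrite !mxE hm (ord1 j).
    exists (\row_(j < 1) m) => //; move: zX; rewrite ze.
    by move/(realizations_elementary _ _ ef).
  apply: contrapT => /(far_from_range ef)[eta eta0 hfar].
  move/(realizationsE efA): zX => [zY zrho].
  (* Half the gap: [psi] equals [1/2 - 2 tau] at [z], hence is below [1/2 - tau] on a set of
     coordinates in [U], as [near_M] requires. *)
  pose tau := (2^-1 - psi M2 ((f \o (val : A -> M1)) \o sA) (z ord0)) / 2.
  have tau0 : 0 < tau.
    by rewrite divr_gt0// subr_gt0 -hrho.
  have eta20 : 0 < eta / 2 by rewrite divr_gt0.
  have [l hl] := near_M _ _ eta20 tau0.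
  have [r zr] := uclass_of_surj (z ord0 ord0).
  have ze : z ord0 = fun _ : 'I_1 => uclass_of UU r.
    by apply/funext => j; rewrite (ord1 j).
  have fgs : (f \o (val : A -> M1)) \o sA =
      fun a => uclass_of UU (fun k => dg (gk k a)).
    by apply/funext => a; rewrite /= /f ultrapower_mapE.
  have Los2 (P : forall N, (cst -> N) -> ('I_1 -> N) -> R) : pfml P ->
      P M2 ((f \o (val : A -> M1)) \o sA) (z ord0) =
      ulim U (fun k => P M1 (dg \o gk k) (fun _ => r k)).
    move=> fP; rewrite ze fgs.
    exact: (Los_pfml UU (fun a k => dg (gk k a)) (fun _ k => r k) fP).
  have U1 : U [set k | pr l M1 (dg \o gk k) (fun _ => r k) < 1].
    apply: ulim_lt; first exact: (ub1 (pr l)).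
    by rewrite -(Los2 (pr l))// -hzeta; exact: le_lt_trans (zY l) ltr01.
  have U2 : U [set k | psi M1 (dg \o gk k) (fun _ => r k) < 2^-1 - tau].
    apply: ulim_lt; first exact: (ub1 psi).
    rewrite -(Los2 psi)// /tau; move: tau0; rewrite /tau.
    set x := psi M2 _ _; move=> ?; lra.
  have hm k : exists m, pr l M1 (dg \o gk k) (fun _ => r k) < 1 ->
      psi M1 (dg \o gk k) (fun _ => r k) < 2^-1 - tau ->
      mdist (dg m) (r k) < eta / 2.
    have [h1|h1] := ltP (pr l M1 (dg \o gk k) (fun _ => r k)) 1; last by exists x0.
    have [h2|h2] := ltP (psi M1 (dg \o gk k) (fun _ => r k)) (2^-1 - tau);
      last by exists x0.
    by have [m hm] := hl k _ h1 (ltW h2); exists m.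
  have [m hm'] := choice hm.
  have := hfar (uclass_of UU m); rewrite zr /f ultrapower_mapE// mdist_uclass_of.
  suff : ulim U (fun k => mdist (dg (m k)) (r k)) <= eta / 2.
    by move=> h1 /le_trans/(_ h1); rewrite leNgt ltr_pdivrMr// ltr_pMr// ltr1n.
  apply: ulim_le; first exact: mdist_ubounded.
  apply: filterS (filterI U1 U2) => k [h1 h2].
  exact: ltW (hm' k h1 h2).
- by exists p.
Qed.

End Pair.

(** * Definable neighbourhoods in dictionaric theories *)

Section Dictionaric.
Context {R : realType} {L : signature R}.
Implicit Types N : structure L.
Variables (M : structure L) (A : set M) (n : nat).
Local Notation S := (types A n).

Lemma definable0 : definable (set0 : set S).
Proof.
split; first exact: closed0.
by move=> e e0; exists set0; split => //; exact: open0.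
Qed.

Lemma definableU (C C' : set S) : definable C -> definable C' ->
  definable (C `|` C').
Proof.
move=> [cC hC] [cC' hC']; split; first exact: closedU.
move=> e e0; have [V [oV CV VC]] := hC e e0; have [W [oW CW WC]] := hC' e e0.
exists (V `|` W); split; first exact: openU.
  by move=> p [/CV|/CW]; [left|right].
move=> p [/VC|/WC] /thickeningP[q Cq pq]; apply/thickeningP; exists q => //.
  by left.
by right.
Qed.

(** Unions of two definable sets are definable, so compactness of [Z] passes from definable
    neighbourhoods of its points to a definable set around [Z]. *)
Lemma dictionaric_closed (T : theory L) (Z O : set S) :
  dictionaric T -> models M T -> closed Z -> open O -> Z `<=` O ->
  exists C, [/\ definable C, Z `<=` C & C `<=` O].
Proof.
move=> dT hM cZ oO ZO.
apply: (@compact_local _ Z (fun V => exists C,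
  [/\ definable C, V `<=` C & C `<=` O])).
- exact: closed_compact.
- by exists set0; split => //; exact: definable0.
- move=> V W [C [dC VC CO]] [C' [dC' WC' CO']]; exists (C `|` C'); split.
  + exact: definableU.
  + by move=> p [/VC|/WC']; [left|right].
  + by move=> p [/CO|/CO'].
- by move=> V W VW [C [dC WC CO]]; exists C; split => // p /VW /WC.
move=> p Zp.
have [|C [dC iC CO]] := dT M hM n A p (~` O) (open_closedC oO).
  by move=> nOp; exact: nOp (ZO p Zp).
exists C => //; exists C; split => // q Cq; apply: contrapT => nOq.
by have : (C `&` ~` O) q by []; rewrite CO.
Qed.

Definition near_set (C : set S) N (g : A -> N) (r : R) (x : 'rV[N]_n) :=
  exists y, realizations C g y /\ forall j, mdist (x ord0 j) (y ord0 j) < r.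

(** The formula is [inf_y max (2 d (x, y) / r - 2, chi_l y)]. Where it is below 1, some [y] is
    within [3 r / 2] of [x] and less than [r / 2] from a point of [C]. *)
Lemma near_set_enlarge (C : set S) (r : R) : definable C -> 0 < r ->
  exists th : pformula A n, forall N (g : A -> N) (eg : elementary_over g) x,
    (near_set C g r x -> val (type_of eg x) th <= 0) /\
    (val (type_of eg x) th < 1 -> near_set C g (2 * r) x).
Proof.
move=> dC r0; have [chi [schi CE]] := definable_scheme dC.
have r8 : 0 < r / 8 by lra.
have [l hl] := pow2_small r8.
pose P N (g : A -> N) (v : 'I_n + 'I_n -> N) : R :=
  Num.max (2 / r * (\big[Num.max/0]_j mdist (v (inl j)) (v (inr j))) + - 2)
    (eval_tp (chi l) g (v \o inr)).
have fP : pfml P.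
  apply: pfml_max; last exact: (pfml_rename inr (pfml_tp (chi l))).
  by apply: pfml_affine; apply: pfml_bigmax => j; exact: pfml_dist.
have [Q [fQ Q1 Q2]] := pfml_inf fP.
have [th hth] := pfml_pformula fQ.
exists th => N g eg x; rewrite type_ofE hth; split=> [[y [Cy xy]]|hQ].
  apply: le_trans (Q1 N g _ (y ord0)) _; rewrite /P ge_max; apply/andP; split.
    rewrite subr_le0 mulrAC ler_pdivrMr// ler_pM2l//.
    by apply: bigmax_le => [|j _]; [exact: ltW|exact: ltW (xy j)].
  by move: Cy; rewrite CE => /(realizations_zeros _ _ eg).
have [|y] := Q2 N g (x ord0) (1 - Q N g (x ord0)); first by rewrite subr_gt0.
rewrite addrC subrK /P gt_max => /andP[y1 y2].
have [|z [z1 z2]] := scheme_near _ (schi N g eg) y2.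
  by move=> k; exact: pfml_tp.
exists (\row_j z j); split.
  rewrite CE; apply/realizations_zeros => // k.
  by rewrite (_ : (\row_j z j) ord0 = z) //; apply/funext => j; rewrite mxE.
move=> j; rewrite mxE.
have := metric_triangle (x ord0 j) (y j) (z j).
have : mdist (x ord0 j) (y j) < 3 / 2 * r.
  apply: le_lt_trans (le_bigmax 0 (fun j => mdist (x ord0 j) (y j)) j) _.
  move: y1; rewrite /= ltrBlDr mulrAC ltr_pdivrMr//.
  set b := \big[_/_]_(_ < _) _; move=> ?; lra.
by have := z1 j; lra.
Qed.

Lemma closed_near_set (C : set S) N (g : A -> N) (eg : elementary_over g) x :
  closed C -> (forall r : R, 0 < r -> near_set C g r x) -> C (type_of eg x).
Proof.
move=> cC h; apply: contrapT => nC.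
have [th [th1 th2]] := separate_point cC nC.
have s0 : (0 : R) < 2^-1 by rewrite invr_gt0.
have [d d0 hd] := pfml_unif_cont (pfml_tp th) s0.
have [y [/(realizationsE eg)/th1 Cy xy]] := h d d0.
have : `|eval_tp th g (x ord0) - eval_tp th g (y ord0)| <= 2^-1 := hd N g _ _ xy.
move: th2 Cy; rewrite !type_ofE -!(eval_tpE th g) => h1 h2.
by rewrite ler_norml => /andP[h3 h4]; lra.
Qed.

Lemma realizations_type_of (C : set S) N (g : A -> N) (eg : elementary_over g) x :
  C (type_of eg x) -> realizations C g x.
Proof. by move=> h; apply/(realizationsE eg). Qed.

(* [Q] is the Hausdorff limit of definable sets [C k], contained in smaller and
   smaller neighbourhoods of [Y], such that [C k.+1] contains all points of [Y]
   close to [C k]. *)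
Lemma dictionaric_relative (T : theory L) (Y : set S) (rho : pformula A n) p :
  dictionaric T -> models M T -> definable Y -> Y p -> val p rho <= 0 ->
  exists Q, [/\ definable Q, Q `<=` Y, Q p &
    Q `<=` [set q | val q rho < 2^-1]].
Proof.
move=> dT hM dY Yp prho.
have s0 : (0 : R) < 8^-1 by rewrite invr_gt0.
have [d d0 hd] := pfml_unif_cont (pfml_tp rho) s0.
(* [d / 16] keeps the change of [rho] over a distance [8 eps0] within [1/8]; [1/16] absorbs the
   factor 10 in the scheme for [om]. *)
pose eps0 := Num.min (d / 16) (16^-1).
have eps00 : 0 < eps0 by rewrite lt_min invr_gt0 divr_gt0//=.
have eps0d : 8 * eps0 < d.
  have : eps0 <= d / 16 by rewrite ge_min lexx.
  by lra.
have eps0e : 16 * eps0 <= 1.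
  have : eps0 <= 16^-1 by rewrite ge_min lexx orbT.
  by lra.
pose eps k : R := eps0 * 2^-1 ^+ k.
have epsS k : eps k.+1 = eps k / 2 by rewrite /eps exprS; field.
have eps_gt0 k : 0 < eps k by rewrite mulr_gt0 ?pow2_gt0.
pose nearY k (C : set S) := forall N (g : A -> N), elementary_over g ->
  forall x, realizations C g x -> near_set Y g (eps k) x.
pose Inv k (C : set S) := [/\ definable C, C p & nearY k C].
pose up k (C C' : set S) := forall N (g : A -> N), elementary_over g ->
  forall x, realizations C g x -> near_set C' g (eps k) x.
pose dn k (C C' : set S) := forall N (g : A -> N), elementary_over g ->
  forall x, realizations C' g x -> near_set C g (2 * eps k) x.
have refine k (Z O : set S) : closed Z -> open O -> Z `<=` O -> Z `<=` Y ->
    exists C, [/\ definable C, Z `<=` C, C `<=` O & nearY k C].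
  move=> cZ oO ZO ZY.
  (* Besides [O], the set [C] is confined to the [eps k]-neighbourhood of [Y]; the radius is halved
     because [near_set_enlarge] doubles it. *)
  have e2 : 0 < eps k / 2 by rewrite divr_gt0.
  have [th hth] := near_set_enlarge dY e2.
  have [||C [dC ZC CO]] := dictionaric_closed (Z := Z)
    (O := O `&` [set q : S | val q th < 1]) dT hM cZ.
  - by apply: openI => //; exact: open_eval_lt.
  - move=> q Zq; split; first exact: ZO.
    have [N [g [eg [x qE]]]] := typeP q.
    apply: le_lt_trans (_ : 0 < 1); last exact: ltr01.
    rewrite qE; apply: (hth N g eg x).1; exists x; split.
      by apply/(realizationsE eg); rewrite -qE; exact: ZY.
    by move=> j; rewrite mdistxx.
  exists C; split => // [q /CO[]//|N g eg x /(realizationsE eg)/CO[_ h]].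
  have := (hth N g eg x).2 h.
  by rewrite (_ : 2 * (eps k / 2) = eps k)//; field.
have init : exists C, Inv 0%N C /\ C `<=` [set q : S | val q rho < 4^-1].
  have [||||C [dC ZC CO nC]] := refine 0%N [set p] [set q : S | val q rho < 4^-1].
  - exact: closed_point.
  - exact: open_eval_lt.
  - by move=> _ ->; apply: le_lt_trans prho _; rewrite invr_gt0.
  - by move=> _ ->.
  by exists C; split => //; split => //; exact: ZC.
have step k C : exists C', Inv k C -> [/\ Inv k.+1 C', up k C C' & dn k C C'].
  have [[dC Cp nC]|no] := pselect (Inv k C); last by exists C.
  have [th hth] := near_set_enlarge dC (eps_gt0 k).
  (* [th <= 0] covers the points of [Y] within [eps k] of [C], and [th < 1] keeps [C'] within
     [2 eps k] of [C]. *)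
  have [||||C' [dC' ZC CO nC']] := refine k.+1 (Y `&` [set q : S | val q th <= 0])
    [set q : S | val q th < 1].
  - by apply: closedI; [exact: dY.1|exact: closed_eval_le].
  - exact: open_eval_lt.
  - by move=> q [_ h]; apply: le_lt_trans h _; exact: ltr01.
  - by move=> q [].
  have inC' N (g : A -> N) (eg : elementary_over g) y :
      realizations Y g y -> near_set C g (eps k) y -> realizations C' g y.
    move=> /(realizationsE eg) Yy yC; apply: (realizations_type_of (eg := eg)).
    by apply: ZC; split => //; exact: (hth N g eg y).1.
  exists C' => _; split.
  - split => //; have [N [g [eg [x pE]]]] := typeP p.
    rewrite pE; apply/(realizationsE eg); apply: (inC' N g eg).
      by apply/(realizationsE eg); rewrite -pE.
    exists x; split; first by apply/(realizationsE eg); rewrite -pE.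
    by move=> j; rewrite mdistxx.
  - move=> N g eg x Cx; have [y [Yy xy]] := nC N g eg x Cx.
    exists y; split => //; apply: (inC' N g eg) => //.
    by exists x; split => // j; rewrite metric_sym.
  - by move=> N g eg x /(realizationsE eg)/CO/(hth N g eg x).2.
have [C0 [C0I C0rho]] := init.
pose next k C := projT1 (cid (step k C)).
pose C := fix C k := if k is k'.+1 then next k' (C k') else C0.
have CI k : Inv k (C k).
  elim: k => [//|k IH]; rewrite /= /next; case: cid => C' /= hC'.
  by have [] := hC' IH.
have Cup k : up k (C k) (C k.+1).
  by rewrite /= /next; case: cid => C' /= hC'; have [] := hC' (CI k).
have Cdn k : dn k (C k) (C k.+1).
  by rewrite /= /next; case: cid => C' /= hC'; have [] := hC' (CI k).
have Cup' k m N (g : A -> N) (eg : elementary_over g) x :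
    realizations (C k) g x -> exists y, realizations (C (k + m)%N) g y /\
      forall j, mdist (x ord0 j) (y ord0 j) <= 2 * eps k - 2 * eps (k + m)%N.
  move=> Cx; elim: m => [|m [y [Cy xy]]].
    by exists x; rewrite addn0; split => // j; rewrite mdistxx subrr.
  have [z [Cz yz]] := Cup _ N g eg y Cy.
  exists z; rewrite addnS; split => // j.
  have := metric_triangle (x ord0 j) (y ord0 j) (z ord0 j).
  by have := xy j; have := yz j; rewrite epsS; lra.
have Cdn' k m N (g : A -> N) (eg : elementary_over g) x :
    realizations (C (k + m)%N) g x -> exists y, realizations (C k) g y /\
      forall j, mdist (x ord0 j) (y ord0 j) <= 4 * eps k - 4 * eps (k + m)%N.
  elim: m x => [|m IH] x.
    by rewrite addn0 => Cx; exists x; split => // j; rewrite mdistxx subrr.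
  rewrite addnS => Cx; have [y [Cy xy]] := Cdn _ N g eg x Cx.
  have [z [Cz yz]] := IH y Cy; exists z; split => // j.
  have := metric_triangle (x ord0 j) (y ord0 j) (z ord0 j).
  by have := xy j; have := yz j; rewrite epsS; lra.
have e4 k : 0 < 4 * eps k by rewrite mulr_gt0.
(* All later sets stay within [4 eps k] of [C k], the sum of the radii [2 eps], so [om k <= 0] on
   them, while [om k < 1] only within [8 eps k]. The common zeros of [om] are the limit. *)
have [om hom] : exists om : nat -> pformula A n, forall k N (g : A -> N)
    (eg : elementary_over g) x,
    (near_set (C k) g (4 * eps k) x -> val (type_of eg x) (om k) <= 0) /\
    (val (type_of eg x) (om k) < 1 -> near_set (C k) g (2 * (4 * eps k)) x).
  have h k : exists th : pformula A n, forall N (g : A -> N)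
      (eg : elementary_over g) x,
      (near_set (C k) g (4 * eps k) x -> val (type_of eg x) th <= 0) /\
      (val (type_of eg x) th < 1 -> near_set (C k) g (2 * (4 * eps k)) x).
    by have [dC _ _] := CI k; exact: near_set_enlarge dC (e4 k).
  by have [om hom] := choice h; exists om.
have om_le0 k l N (g : A -> N) (eg : elementary_over g) x : (k <= l)%N ->
    realizations (C l) g x -> val (type_of eg x) (om k) <= 0.
  move=> kl; rewrite -(subnKC kl) => /(Cdn' _ _ _ _ eg)[y [Cy xy]].
  apply: (hom k N g eg x).1; exists y; split => // j.
  by have := xy j; have := eps_gt0 (k + (l - k))%N; lra.
have som N (g : A -> N) : elementary_over g -> tscheme om g.
  move=> eg j l x xj eta eta0.
  have [y [Cy xy]] := (hom j N g eg (\row_k x k)).2 xj.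
  (* [8 eps j] from [om j < 1], and [2 eps j] for the passage from [C j] to [C l]. *)
  have eps_small : 10 * eps j < 2^-1 ^+ j + eta.
    rewrite /eps; have := pow2_gt0 R j; set t := 2^-1 ^+ j => t0.
    have : 10 * (eps0 * t) <= t.
      by rewrite mulrA ler_piMl ?ltW//; lra.
    by lra.
  have [jl|lj] := leqP j l.
    have [z [Cz yz]] := Cup' j (l - j)%N N g eg y Cy.
    rewrite subnKC// in Cz yz; exists (z ord0); split => [k|].
      have := metric_triangle (x k) (y ord0 k) (z ord0 k).
      have := xy k; rewrite mxE; have := yz k; have := eps_gt0 l; lra.
    rewrite eval_tpE -(type_ofE eg); apply: le_lt_trans eta0.
    exact: om_le0 (leqnn l) Cz.
  exists (y ord0); split => [k|].
    by have := xy k; rewrite mxE; have := eps_gt0 j; lra.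
  rewrite eval_tpE -(type_ofE eg); apply: le_lt_trans eta0.
  exact: om_le0 (ltnW lj) Cy.
have ev := @elementary_val _ _ M A.
exists (zeros om); split.
- exact: scheme_definable ev (som M val ev).
- move=> q qQ; have [N [g [eg [x qE]]]] := typeP q; rewrite qE in qQ *.
  apply: closed_near_set; first exact: dY.1.
  move=> r r0; have r9 : 0 < r / 9 by rewrite divr_gt0.
  have [k hk] := pow2_small r9.
  (* [8 eps k] to reach [C k], and one more [eps k] to reach [Y]. *)
  have epsk : 9 * eps k < r.
    have : eps k <= 2^-1 ^+ k.
      by rewrite /eps ler_piMl ?ltW ?pow2_gt0//; lra.
    by lra.
  have [y [Cy xy]] := (hom k N g eg x).2 (le_lt_trans (qQ k) ltr01).
  have [_ _ nC] := CI k; have [z [Yz yz]] := nC N g eg y Cy.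
  exists z; split => // j; have := xy j; have := yz j.
  by have := metric_triangle (x ord0 j) (y ord0 j) (z ord0 j); lra.
- move=> k; have [N [g [eg [x pE]]]] := typeP p; rewrite pE.
  apply: om_le0 (leqnn k) _; apply/(realizationsE eg); rewrite -pE.
  by have [] := CI k.
- move=> q qQ; have [N [g [eg [x qE]]]] := typeP q; rewrite qE in qQ *.
  have [y [/(realizationsE eg)/C0rho Cy xy]] :=
    (hom 0%N N g eg x).2 (le_lt_trans (qQ 0%N) ltr01).
  (* [rho < 1/4] on [C 0], and the distance [8 eps0 < d] adds at most [1/8], which stays below
     [1/2]. *)
  have xyd j : mdist (x ord0 j) (y ord0 j) < d.
    have := xy j; rewrite /eps expr0 mulr1 => h; lra.
  have : `|eval_tp rho g (x ord0) - eval_tp rho g (y ord0)| <= 8^-1.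
    exact: hd N g _ _ xyd.
  move: Cy; rewrite /mkset !type_ofE -!(eval_tpE rho g) => h1.
  by rewrite ler_norml => /andP[h2 h3]; lra.
Qed.

End Dictionaric.

Lemma vaughtian_subset (R : realType) (L : signature R) (N1 N2 : structure L)
    (f : N1 -> N2) (A : set N1) (X Q : set (types A 1)) p :
  vaughtian_for f X -> Q `<=` X -> Q p -> ~ algebraic [set p] ->
  vaughtian_for f Q.
Proof.
move=> [cA _ ef fN XE] QX Qp pna; split => //; first by exists p.
apply/seteqP; split => [z [q Qq qz]|_ [b bQ <-]]; last first.
  exact/(realizations_elementary _ _ ef).
have : realizations X (f \o val) z by exists q => //; exact: QX.
rewrite XE => -[b _ bz]; exists b => //.
by apply/(realizations_elementary _ _ ef); rewrite bz; exists q.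
Qed.

Theorem proposition5p4 (R : realType) (L : signature R) (T : theory L)
    (M : structure L) (hM : models M T) (n : nat)
    (D : set (types [set: M] n)) (hD : minimal D) :
  ((dictionaric T /\ ~ has_vaughtian_pair T) \/
     ~ has_open_in_definable_vaughtian_pair T -> strongly_minimal D) /\
  (approx_aleph0_saturated M -> strongly_minimal D).
Proof.
split=> [noV|sat]; apply: strongly_minimal_splitting => // N g J b Psi i e eg;
  last exact: splitting_saturated.
move=> spl; have [t [c [algPsi kptsPsi]]] := splitting_family hD eg spl.
have [fPsi e0 _ _] := spl; have [defD _ _] := hD.
have [chi [schi DE]] := definable_scheme defD.
have e40 : 0 < e / 4 by rewrite divr_gt0.
have [N1 [N2 [f [A [Y [rho [m1 m2 dY vf [p [Yp prho] pna]]]]]]]] :=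
  definable_pair hM hD schi DE (fPsi t) e40 algPsi kptsPsi.
case: noV => [[dT noV]|noV]; apply: noV; last first.
  exists N1, N2, f, A, (Y `&` [set q | val q rho < 2^-1]); split => //.
  exists [set q | val q rho < 2^-1], Y; split => //; last exact: setIC.
  exact: open_eval_lt.
(* The open-in-definable set is shrunk to a definable one that still contains [p]; gaining no new
   points in the larger model passes to subsets. *)
have [Q [dQ QY Qp Qrho]] := dictionaric_relative dT m1 dY Yp prho.
exists N1, N2, f, A, Q; split => //.
apply: (vaughtian_subset (p := p) vf) => // q Qq.
by split; [exact: QY|exact: Qrho].
Qed.
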